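(* Assume the setting and standing assumptions of the context, and suppose that $\psi$ is non-strongly convex (i.e. $\mu_\psi=0$, so $\phi_0$ may be nonsmooth). Let $c_0,c_1>0$, let $b$ be a positive integer, and let $P$, $Q$, $L_{\Phi_\gamma}$, $B_\psi$ be as in the context. Let $\{x_t\}_{t=0}^T$ be generated by the algorithm of the context after $T$ iterations using $$\hat b_1=\hat b_2:=b,\quad b_1=b_2:=\frac{c_0b}{\gamma^2},\quad \hat b_0:=c_1^2[b(T+1)]^{1/3},\quad b_0:=\frac{c_0\hat b_0}{\gamma^2},\quad \gamma_t:=\gamma\in(0,1],$$ $$\beta_t=\hat\beta_t:=1-\frac{b^{1/2}}{[\hat b_0(T+1)]^{1/2}},\quad \theta_t=\theta:=\frac{L_{\Phi_\gamma}b^{3/4}}{P[\hat b_0(T+1)]^{1/4}},\quad \eta_t=\eta:=\frac{2}{L_{\Phi_\gamma}(3+\theta)},$$ where the batch sizes are chosen so that $\beta_t,\theta_t\in(0,1]$. Then the output $\bar x_T$ satisfies $$\mathbb{E}\big[\|\mathcal{G}_\eta(\bar x_T)\|^2\big]\le\frac{\hat\Delta_0}{[b(T+1)]^{2/3}},\qquad \hat\Delta_0:=16\sqrt{c_1}\,P\big(\Psi_0(x_0)-\Psi_0^\star+B_\psi\big)+\frac{24Q}{c_1}.$$ The total number of iterations $T$ to achieve $\mathbb{E}[\|\mathcal{G}_\eta(\bar x_T)\|^2]\le\varepsilon^2$ is at most $T:=\big\lfloor\frac{\hat\Delta_0^{3/2}}{b\varepsilon^3}\big\rfloor$. The total numbers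 of function evaluations $\mathcal{T}_F$ and Jacobian evaluations $\mathcal{T}_J$ are respectively at most $$\mathcal{T}_F:=\frac{c_0c_1^2\hat\Delta_0^{1/2}}{\gamma^2\varepsilon}+\frac{3c_0\hat\Delta_0^{3/2}}{\gamma^2\varepsilon^3}=\mathcal{O}\Big(\frac{\hat\Delta_0^{3/2}}{\gamma^2\varepsilon^3}\Big),\qquad \mathcal{T}_J:=\frac{c_1^2\hat\Delta_0^{1/2}}{\varepsilon}+\frac{3\hat\Delta_0^{3/2}}{\varepsilon^3}=\mathcal{O}\Big(\frac{\hat\Delta_0^{3/2}}{\varepsilon^3}\Big).$$ If $\gamma:=c_2\varepsilon$ for some $c_2>0$, then $\mathcal{T}_F=\frac{c_0c_1^2\hat\Delta_0^{1/2}}{c_2^2\varepsilon^3}+\frac{3c_0\hat\Delta_0^{3/2}}{c_2^2\varepsilon^5}=\mathcal{O}\big(\frac{\hat\Delta_0^{3/2}}{\varepsilon^5}\big)$.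
   Context: Problem. $\mathbf{F}:\mathbb{R}^p\times\Omega\to\mathbb{R}^q$ is a stochastic vector function on a probability space $(\Omega,\mathbb{P})$, $F(x):=\mathbb{E}_\xi[\mathbf{F}(x,\xi)]$, with Jacobians $\mathbf{F}'(x,\xi)$ and $F'(x)=\mathbb{E}_\xi[\mathbf{F}'(x,\xi)]$; $K\in\mathbb{R}^{q\times n}$; $\psi:\mathbb{R}^n\to\mathbb{R}\cup\{+\infty\}$ and $\mathcal{R}:\mathbb{R}^p\to\mathbb{R}\cup\{+\infty\}$ are proper, closed, convex. The minimax problem is $\min_x\max_y\{\mathcal{R}(x)+\mathbb{E}_\xi[\langle Ky,\mathbf{F}(x,\xi)\rangle]-\psi(y)\}$, equivalently $\min_x\Psi_0(x):=\phi_0(F(x))+\mathcal{R}(x)$ with $\phi_0(u):=\max_{y}\{\langle K^\top u,y\rangle-\psi(y)\}$. It is assumed that $\Psi_0^\star:=\inf_x\Psi_0(x)>-\infty$. Norms are Euclidean (spectral norm for $K$, Frobenius norm for Jacobians). Assumptions. There are constants $L_F,\sigma_F,\sigma_J,M_F,M_\psi\in(0,+\infty)$ such that for all $x,y\in\mathrm{dom}(\Psi_0)$: $\mathbb{E}_\xi[\|\mathbf{F}'(x,\xi)-\mathbf{F}'(y,\xi)\|^2]\le L_F^2\|x-y\|^2$; $\mathbb{E}_\xi[\|\mathbf{F}(x,\xi)-F(x)\|^2]\le\sigma_F^2$; $\mathbb{E}_\xi[\|\mathbf{F}'(x,\xi)-F'(x)\|^2]\le\sigma_J^2$; $\mathbb{E}_\xi[\|\mathbf{F}'(x,\xi)\|^2]\le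 M_F^2$; and $\sup\{\|y\|:y\in\mathrm{dom}(\psi)\}\le M_\psi$. Smoothing. $d:\mathrm{dom}(\psi)\to\mathbb{R}_+$ is a continuously differentiable, $1$-strongly convex function with $\min_yd(y)=0$; $B_\psi:=\sup\{d(y):y\in\mathrm{dom}(\psi)\}$. For $\gamma>0$: $\phi_\gamma(u):=\max_y\{\langle u,Ky\rangle-\psi(y)-\gamma d(y)\}$ with unique maximizer $y_\gamma^*(u)$; $\Phi_\gamma(x):=\phi_\gamma(F(x))$, $\nabla\Phi_\gamma(x)=F'(x)^\top Ky_\gamma^*(F(x))$. The gradient mapping is $\mathcal{G}_\eta(x):=\frac1\eta\big(x-\mathrm{prox}_{\eta\mathcal{R}}(x-\eta\nabla\Phi_\gamma(x))\big)$. Algorithm. Start from $x_0\in\mathrm{dom}(\Psi_0)$. Set $\tilde F_0:=\frac1{b_0}\sum_{\xi_i\in\mathcal{B}^0}\mathbf{F}(x_0,\xi_i)$, $\tilde J_0:=\frac1{\hat b_0}\sum_{\hat\xi_i\in\hat{\mathcal{B}}^0}\mathbf{F}'(x_0,\hat\xi_i)$. For $t\ge1$, $\tilde F_t:=\beta_{t-1}\tilde F_{t-1}+\frac{\beta_{t-1}}{b_1}\sum_{\xi_i\in\mathcal{B}_t^1}[\mathbf{F}(x_t,\xi_i)-\mathbf{F}(x_{t-1},\xi_i)]+\frac{1-\beta_{t-1}}{b_2}\sum_{\zeta_i\in\mathcal{B}_t^2}\mathbf{F}(x_t,\zeta_i)$, $\tilde J_t:=\hat\beta_{t-1}\tilde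 J_{t-1}+\frac{\hat\beta_{t-1}}{\hat b_1}\sum_{\hat\xi_i\in\hat{\mathcal{B}}_t^1}[\mathbf{F}'(x_t,\hat\xi_i)-\mathbf{F}'(x_{t-1},\hat\xi_i)]+\frac{1-\hat\beta_{t-1}}{\hat b_2}\sum_{\hat\zeta_i\in\hat{\mathcal{B}}_t^2}\mathbf{F}'(x_t,\hat\zeta_i)$. For $t=0,1,\dots,T$: $v_t:=\tilde J_t^\top Ky_{\gamma_t}^*(\tilde F_t)$, $\hat x_{t+1}:=\mathrm{prox}_{\eta_t\mathcal{R}}(x_t-\eta_tv_t)$, $x_{t+1}:=(1-\theta_t)x_t+\theta_t\hat x_{t+1}$. The mini-batches $\mathcal{B}^0,\hat{\mathcal{B}}^0,\mathcal{B}_t^1,\hat{\mathcal{B}}_t^1,\mathcal{B}_t^2,\hat{\mathcal{B}}_t^2$ have sizes $b_0,\hat b_0,b_1,\hat b_1,b_2,\hat b_2$; each consists of i.i.d. copies of $\xi$ drawn independently of the past iterations; the mini-batches within one iteration may be correlated with each other. Output: $\bar x_T$ chosen at random from $\{x_0,\dots,x_T\}$ with probability of $x_t$ proportional to $\theta_t/L_{\Phi_{\gamma_t}}$ (uniform for constant parameters). Constants. $\kappa:=1$ if $\mathcal{B}_t^1$ is independent of $\mathcal{B}_t^2$ and $\kappa:=2$ otherwise; $\hat\kappa:=1$ if $\hat{\mathcal{B}}_t^1$ is independent of $\hat{\mathcal{B}}_t^2$ and $\hat\kappa:=2$ otherwise. For given $c_0>0$: $P:=\frac{\sqrt{26}\|K\|}{3\sqrt{c_0}}\sqrt{\kappa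 M_F^4\|K\|^2+c_0\hat\kappa L_F^2M_\psi^2}$, $Q:=\frac{26}{9c_0}\|K\|^2\big(\kappa M_F^2\|K\|^2\sigma_F^2+c_0\hat\kappa M_\psi^2\sigma_J^2\big)$, $L_{\Phi_\gamma}:=L_FM_\psi\|K\|+\frac{M_F^2\|K\|^2}{\gamma}$. Batch sizes and iteration numbers are integers; as in the paper, rounding to integers (and the difference between $T$ and $T+1$ in complexity counts) is ignored in the formulas. *)

(* Defs.v *)
From HB Require Import structures.
From mathcomp Require Import all_boot all_order all_algebra.
From mathcomp Require Import all_classical all_reals all_analysis.

Set Implicit Arguments.
Unset Strict Implicit.
Unset Printing Implicit Defensive.

Import Order.TTheory GRing.Theory Num.Theory.
Import numFieldNormedType.Exports.

Local Open Scope classical_set_scope.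
Local Open Scope ring_scope.

(* Points of R^k are column vectors.  The library norm on matrices is the
   sup norm; it is used below only for its topology and for derivatives. *)

Section euclidean.
Context {R : realType}.

Definition dot {k} (u v : 'cV[R]_k) : R := \sum_(i < k) u i 0 * v i 0.

(* Frobenius norm; on column vectors it is the Euclidean norm. *)
Definition frob {k l} (A : 'M[R]_(k, l)) : R :=
  Num.sqrt (\sum_(i < k) \sum_(j < l) A i j ^+ 2).

Definition spectral {k l} (A : 'M[R]_(k, l)) : R :=
  sup [set frob (A *m y) | y in [set y : 'cV[R]_l | frob y <= 1]].

(* The library jacobian 'J acts on row vectors; this is its transpose for maps
   between spaces of column vectors. *)
Definition jac {k l} (f : 'cV[R]_k -> 'cV[R]_l) (x : 'cV[R]_k) : 'M[R]_(l, k) :=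
  \matrix_(i, j) ('d f x (delta_mx j 0)) i 0.

Definition grad {k} (f : 'cV[R]_k -> R) (x : 'cV[R]_k) : 'cV[R]_k :=
  \col_j ('d f x (delta_mx j 0) : R).

Definition dom {k} (f : 'cV[R]_k -> \bar R) : set 'cV[R]_k :=
  [set x | (f x < +oo)%E].

Definition proper {k} (f : 'cV[R]_k -> \bar R) : Prop :=
  (forall x, -oo < f x)%E /\ dom f !=set0.

Definition closed_fun {k} (f : 'cV[R]_k -> \bar R) : Prop :=
  closed [set z : 'cV[R]_k * R | (f z.1 <= z.2%:E)%E].

(* For functions with values in ]-oo, +oo]; recall that 0 * +oo = 0. *)
Definition convex_fun {k} (f : 'cV[R]_k -> \bar R) : Prop :=
  forall (x y : 'cV[R]_k) (t : R), 0 <= t <= 1 ->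
    (f (t *: x + (1 - t) *: y)%R <= t%:E * f x + (1 - t)%:E * f y)%E.

Definition strongly_convex {k} (mu : R) (f : 'cV[R]_k -> \bar R) : Prop :=
  convex_fun (fun x => f x - (mu / 2 * frob x ^+ 2)%:E)%E.

Definition extend {k} (D : set 'cV[R]_k) (f : 'cV[R]_k -> R) (x : 'cV[R]_k) : \bar R :=
  if x \in D then (f x)%:E else +oo%E.

(* Continuous differentiability relative to D, which need not be open. *)
Definition C1_on {k} (D : set 'cV[R]_k) (f : 'cV[R]_k -> R) : Prop :=
  exists g : 'cV[R]_k -> 'cV[R]_k,
    {within D, continuous g} /\
    forall y, D y -> forall e : R, 0 < e ->
      \forall z \near within D (nbhs y),
        `|f z - f y - dot (g y) (z - y)| <= e * frob (z - y).

Definition is_prox {k} (eta : R) (f : 'cV[R]_k -> \bar R) (x z : 'cV[R]_k) : Prop :=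
  forall w, (f z + (frob (z - x) ^+ 2 / (2 * eta))%:E
             <= f w + (frob (w - x) ^+ 2 / (2 * eta))%:E)%E.

Definition prox {k} (eta : R) (f : 'cV[R]_k -> \bar R) (x : 'cV[R]_k) : 'cV[R]_k :=
  xget 0 [set z | is_prox eta f x z].

End euclidean.

Section problem.
Context {R : realType} {dX : measure_display} {Xi : measurableType dX} {p q n : nat}.

Definition Emx {k l} (law : probability Xi R) (f : Xi -> 'M[R]_(k, l)) : 'M[R]_(k, l) :=
  \matrix_(i, j) fine ('E_law[fun s => f s i j])%E.

Record problem := Problem {
  FF : 'cV[R]_p -> Xi -> 'cV[R]_q;
  law : probability Xi R;
  Kmx : 'M[R]_(q, n);
  psi : 'cV[R]_n -> \bar R;
  reg : 'cV[R]_p -> \bar R }.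

Variables (pb : problem).

Definition JF (x : 'cV[R]_p) (s : Xi) : 'M[R]_(q, p) := jac (FF pb ^~ s) x.

Definition Fmean (x : 'cV[R]_p) : 'cV[R]_q := Emx (law pb) (FF pb x).

Definition phi0 (u : 'cV[R]_q) : \bar R :=
  ereal_sup (range (fun y => (dot ((Kmx pb)^T *m u) y)%:E - psi pb y)%E).

Definition Psi0 (x : 'cV[R]_p) : \bar R := (phi0 (Fmean x) + reg pb x)%E.

Definition Psi0_star : \bar R := ereal_inf (range Psi0).

Record constants := Constants {
  L_F : R; sigma_F : R; sigma_J : R; M_F : R; M_psi : R }.

Variable (cst : constants).

Record standing_assumptions : Prop := StandingAssumptions {
  psi_proper : proper (psi pb);
  psi_closed : closed_fun (psi pb);
  psi_convex : convex_fun (psi pb);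
  reg_proper : proper (reg pb);
  reg_closed : closed_fun (reg pb);
  reg_convex : convex_fun (reg pb);
  FF_differentiable : forall s x, differentiable (FF pb ^~ s) x;
  FF_integrable : forall x i,
    (law pb).-integrable setT (fun s => (FF pb x s i 0)%:E);
  JF_integrable : forall x i j,
    (law pb).-integrable setT (fun s => (JF x s i j)%:E);
  Fmean_differentiable : forall x, differentiable Fmean x;
  jac_Fmean : forall x, jac Fmean x = Emx (law pb) (JF x);
  Psi0_bounded : (-oo < Psi0_star)%E;
  constants_gt0 : [/\ 0 < L_F cst, 0 < sigma_F cst, 0 < sigma_J cst,
                      0 < M_F cst & 0 < M_psi cst];
  JF_lipschitz : forall x y, dom Psi0 x -> dom Psi0 y ->
    ('E_(law pb)[fun s => (frob (JF x s - JF y s) ^+ 2)%R]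
       <= (L_F cst ^+ 2 * frob (x - y) ^+ 2)%:E)%E;
  FF_variance : forall x, dom Psi0 x ->
    ('E_(law pb)[fun s => (frob (FF pb x s - Fmean x) ^+ 2)%R]
       <= (sigma_F cst ^+ 2)%:E)%E;
  JF_variance : forall x, dom Psi0 x ->
    ('E_(law pb)[fun s => (frob (JF x s - jac Fmean x) ^+ 2)%R]
       <= (sigma_J cst ^+ 2)%:E)%E;
  JF_bounded : forall x, dom Psi0 x ->
    ('E_(law pb)[fun s => (frob (JF x s) ^+ 2)%R] <= (M_F cst ^+ 2)%:E)%E;
  psi_dom_bounded : forall y, dom (psi pb) y -> frob y <= M_psi cst }.

(* Only the values of d on dom psi matter. *)
Variable (d : 'cV[R]_n -> R).

Record smoothing_function : Prop := SmoothingFunction {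
  sm_C1 : C1_on (dom (psi pb)) d;
  sm_strongly_convex : strongly_convex 1 (extend (dom (psi pb)) d);
  sm_ge0 : forall y, dom (psi pb) y -> 0 <= d y;
  sm_min0 : exists2 y, dom (psi pb) y & d y = 0;
  sm_bounded : has_ubound (d @` dom (psi pb)) }.

Definition B_psi : R := sup (d @` dom (psi pb)).

Definition smooth_obj (gamma : R) (u : 'cV[R]_q) (y : 'cV[R]_n) : \bar R :=
  ((dot u (Kmx pb *m y))%:E - psi pb y - (gamma * d y)%:E)%E.

Definition phi_smooth (gamma : R) (u : 'cV[R]_q) : R :=
  fine (ereal_sup (range (smooth_obj gamma u))).

Definition ystar (gamma : R) (u : 'cV[R]_q) : 'cV[R]_n :=
  xget 0 [set y | forall z, (smooth_obj gamma u z <= smooth_obj gamma u y)%E].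

Definition Phi (gamma : R) (x : 'cV[R]_p) : R := phi_smooth gamma (Fmean x).

Definition grad_map (gamma eta : R) (x : 'cV[R]_p) : 'cV[R]_p :=
  eta^-1 *: (x - prox eta (reg pb) (x - eta *: grad (Phi gamma) x)).

Definition L_Phi (gamma : R) : R :=
  L_F cst * M_psi cst * spectral (Kmx pb)
  + M_F cst ^+ 2 * spectral (Kmx pb) ^+ 2 / gamma.

Definition P_cst (c0 kappa hkappa : R) : R :=
  Num.sqrt 26 * spectral (Kmx pb) / (3 * Num.sqrt c0) *
  Num.sqrt (kappa * M_F cst ^+ 4 * spectral (Kmx pb) ^+ 2
            + c0 * hkappa * L_F cst ^+ 2 * M_psi cst ^+ 2).

Definition Q_cst (c0 kappa hkappa : R) : R :=
  26 / (9 * c0) * spectral (Kmx pb) ^+ 2 *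
  (kappa * M_F cst ^+ 2 * spectral (Kmx pb) ^+ 2 * sigma_F cst ^+ 2
   + c0 * hkappa * M_psi cst ^+ 2 * sigma_J cst ^+ 2).

Definition Delta_cst (c0 c1 kappa hkappa : R) (x0 : 'cV[R]_p) : R :=
  16 * Num.sqrt c1 * P_cst c0 kappa hkappa
     * (fine (Psi0 x0) - fine Psi0_star + B_psi)
  + 24 * Q_cst c0 kappa hkappa / c1.

End problem.

Arguments problem : clear implicits.
Arguments problem R {dX} Xi p q n.
Arguments constants : clear implicits.

Section algorithm.
Context {R : realType} {dX dO : measure_display}
  {Xi : measurableType dX} {Omega : measurableType dO} {p q n : nat}.

Record batch_sizes := BatchSizes {
  b0 : nat; hb0 : nat; b1 : nat; hb1 : nat; b2 : nat; hb2 : nat }.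

(* batch1 t i is the i-th element of B_t^1, and so on; the prefix h stands for
   the hatted batches, used for the Jacobian estimator. *)
Record samples := Samples {
  batch0 : nat -> Omega -> Xi;
  hbatch0 : nat -> Omega -> Xi;
  batch1 : nat -> nat -> Omega -> Xi;
  hbatch1 : nat -> nat -> Omega -> Xi;
  batch2 : nat -> nat -> Omega -> Xi;
  hbatch2 : nat -> nat -> Omega -> Xi }.

Variables (Pr : probability Omega R) (law : probability Xi R).

Definition iid_batch (m : nat) (X : nat -> Omega -> Xi) : Prop :=
  (forall i, (i < m)%N -> measurable_fun setT (X i) /\
     forall A, measurable A -> Pr (X i @^-1` A) = law A) /\
  (forall A : nat -> set Xi, (forall i, measurable (A i)) ->
     Pr (\bigcap_(i in `I_m) (X i @^-1` A i)) =
     (\big[mule/1]_(i < m) Pr (X i @^-1` A i))%E).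

Definition events (m : nat) (X : nat -> Omega -> Xi) : set (set Omega) :=
  [set E | exists i A, [/\ (i < m)%N, measurable A & E = X i @^-1` A]].

Definition independent (G H : set (set Omega)) : Prop :=
  forall A B, G A -> H B -> Pr (A `&` B) = (Pr A * Pr B)%E.

Variables (bs : batch_sizes) (smp : samples).

Definition iteration_events (t : nat) : set (set Omega) :=
  if t is 0 then events (b0 bs) (batch0 smp) `|` events (hb0 bs) (hbatch0 smp)
  else events (b1 bs) (batch1 smp t) `|` events (hb1 bs) (hbatch1 smp t)
       `|` events (b2 bs) (batch2 smp t) `|` events (hb2 bs) (hbatch2 smp t).

Definition history (t : nat) : set (set Omega) :=
  <<s \bigcup_(s in `I_t) iteration_events s >>.

(* The batches of one iteration are jointly independent of the history, with no
   restriction on their dependence on one another. *)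
Record sampling (T : nat) : Prop := Sampling {
  iid0 : iid_batch (b0 bs) (batch0 smp);
  hiid0 : iid_batch (hb0 bs) (hbatch0 smp);
  iid1 : forall t, (0 < t <= T)%N -> iid_batch (b1 bs) (batch1 smp t);
  hiid1 : forall t, (0 < t <= T)%N -> iid_batch (hb1 bs) (hbatch1 smp t);
  iid2 : forall t, (0 < t <= T)%N -> iid_batch (b2 bs) (batch2 smp t);
  hiid2 : forall t, (0 < t <= T)%N -> iid_batch (hb2 bs) (hbatch2 smp t);
  fresh : forall t, (0 < t <= T)%N ->
    independent <<s iteration_events t >> (history t) }.

(* The hypothesis defining kappa and hkappa ranges over all iterations 1..T. *)
Definition kappa_cst (T : nat) : R :=
  if `[< forall t, (0 < t <= T)%N ->
         independent <<s events (b1 bs) (batch1 smp t) >>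
                     <<s events (b2 bs) (batch2 smp t) >> >]
  then 1 else 2.

Definition hkappa_cst (T : nat) : R :=
  if `[< forall t, (0 < t <= T)%N ->
         independent <<s events (hb1 bs) (hbatch1 smp t) >>
                     <<s events (hb2 bs) (hbatch2 smp t) >> >]
  then 1 else 2.

Record schedule := Schedule {
  gamma_ : nat -> R; beta_ : nat -> R; hbeta_ : nat -> R;
  theta_ : nat -> R; eta_ : nat -> R }.

Record trajectory := Trajectory {
  xs : nat -> Omega -> 'cV[R]_p;
  xhat : nat -> Omega -> 'cV[R]_p;
  Ft : nat -> Omega -> 'cV[R]_q;
  Jt : nat -> Omega -> 'M[R]_(q, p);
  vs : nat -> Omega -> 'cV[R]_p }.

Record generated (pb : problem R Xi p q n) (d : 'cV[R]_n -> R) (sch : schedule)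
    (x0 : 'cV[R]_p) (T : nat) (tr : trajectory) : Prop := Generated {
  gen_x0 : forall w, xs tr 0 w = x0;
  gen_F0 : forall w, Ft tr 0 w =
    (b0 bs)%:R^-1 *: \sum_(i < b0 bs) FF pb x0 (batch0 smp i w);
  gen_J0 : forall w, Jt tr 0 w =
    (hb0 bs)%:R^-1 *: \sum_(i < hb0 bs) JF pb x0 (hbatch0 smp i w);
  gen_F : forall t w, (t < T)%N -> Ft tr t.+1 w =
    beta_ sch t *: Ft tr t w
    + (beta_ sch t / (b1 bs)%:R) *: \sum_(i < b1 bs)
        (FF pb (xs tr t.+1 w) (batch1 smp t.+1 i w)
         - FF pb (xs tr t w) (batch1 smp t.+1 i w))
    + ((1 - beta_ sch t) / (b2 bs)%:R) *: \sum_(i < b2 bs)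
        FF pb (xs tr t.+1 w) (batch2 smp t.+1 i w);
  gen_J : forall t w, (t < T)%N -> Jt tr t.+1 w =
    hbeta_ sch t *: Jt tr t w
    + (hbeta_ sch t / (hb1 bs)%:R) *: \sum_(i < hb1 bs)
        (JF pb (xs tr t.+1 w) (hbatch1 smp t.+1 i w)
         - JF pb (xs tr t w) (hbatch1 smp t.+1 i w))
    + ((1 - hbeta_ sch t) / (hb2 bs)%:R) *: \sum_(i < hb2 bs)
        JF pb (xs tr t.+1 w) (hbatch2 smp t.+1 i w);
  gen_v : forall t w, (t <= T)%N -> vs tr t w =
    (Jt tr t w)^T *m Kmx pb *m ystar pb d (gamma_ sch t) (Ft tr t w);
  gen_xhat : forall t w, (t <= T)%N -> xhat tr t.+1 w =
    prox (eta_ sch t) (reg pb) (xs tr t w - eta_ sch t *: vs tr t w);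
  gen_x : forall t w, (t <= T)%N -> xs tr t.+1 w =
    (1 - theta_ sch t) *: xs tr t w + theta_ sch t *: xhat tr t.+1 w }.

(* The output is xs tr (tau w) w, with tau drawn independently of the samples. *)
Record random_index (pb : problem R Xi p q n) (cst : constants R) (sch : schedule)
    (T : nat) (tau : Omega -> 'I_T.+1) : Prop := RandomIndex {
  tau_measurable : forall t, measurable (tau @^-1` [set t]);
  tau_law : forall t, Pr (tau @^-1` [set t]) =
    (theta_ sch t / L_Phi pb cst (gamma_ sch t)
     / (\sum_(s < T.+1) theta_ sch s / L_Phi pb cst (gamma_ sch s)))%:E;
  tau_independent :
    independent [set tau @^-1` [set t] | t in [set: 'I_T.+1]] (history T.+1) }.

(* Elements of the batches numbered 1 are evaluated at two points. *)
Definition function_evals (T : nat) : nat := (b0 bs + T * (2 * b1 bs + b2 bs))%N.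
Definition jacobian_evals (T : nat) : nat := (hb0 bs + T * (2 * hb1 bs + hb2 bs))%N.

End algorithm.

Arguments samples {dX dO} Xi Omega.
Arguments trajectory R {dO} Omega p q.
Arguments schedule R : clear implicits.

Section parameters.
Context {R : realType}.

(* Batch sizes before rounding to integers; beta and theta are computed from the
   unrounded value of hb0. *)
Definition b1_real (c0 gamma : R) (b : nat) : R := c0 * b%:R / gamma ^+ 2.
Definition hb0_real (c1 : R) (b T : nat) : R :=
  c1 ^+ 2 * (b%:R * T.+1%:R) `^ 3^-1.
Definition b0_real (c0 c1 gamma : R) (b T : nat) : R :=
  c0 * hb0_real c1 b T / gamma ^+ 2.

Definition beta_cst (c1 : R) (b T : nat) : R :=
  1 - b%:R `^ 2^-1 / (hb0_real c1 b T * T.+1%:R) `^ 2^-1.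

(* Here L and P stand for L_Phi and P_cst. *)
Definition theta_cst (c1 L P : R) (b T : nat) : R :=
  L * b%:R `^ (3 / 4) / (P * (hb0_real c1 b T * T.+1%:R) `^ 4^-1).

Definition eta_cst (L theta : R) : R := 2 / (L * (3 + theta)).

Definition iteration_bound (Delta : R) (b : nat) (eps : R) : R :=
  Delta `^ (3 / 2) / (b%:R * eps ^+ 3).

Definition function_bound (c0 c1 Delta gamma eps : R) : R :=
  c0 * c1 ^+ 2 * Delta `^ 2^-1 / (gamma ^+ 2 * eps)
  + 3 * c0 * Delta `^ (3 / 2) / (gamma ^+ 2 * eps ^+ 3).

Definition jacobian_bound (c1 Delta eps : R) : R :=
  c1 ^+ 2 * Delta `^ 2^-1 / eps + 3 * Delta `^ (3 / 2) / eps ^+ 3.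

End parameters.

(* Main.v *)
Require Import Defs.
From HB Require Import structures.
From mathcomp Require Import all_boot all_order all_algebra.
From mathcomp Require Import all_classical all_reals all_analysis.
From mathcomp Require Import measurable_realfun ring lra.

Set Implicit Arguments.
Unset Strict Implicit.
Unset Printing Implicit Defensive.

Import Order.TTheory GRing.Theory Num.Theory.
Import numFieldNormedType.Exports.

Local Open Scope classical_set_scope.
Local Open Scope ring_scope.

(** Write [Phi] for the smoothed objective [phi_gamma o F], [L] for [L_Phi],
    [D_t] for the squared displacement [|xhat_{t+1} - x_t|^2] and [A_t] for a
    weighted sum of the squared errors of the two estimators at step [t].

    The gradient of [Phi] is [L]-Lipschitz on the domain: maximizing a
    [gamma]-strongly concave function makes the dual maximizer Lipschitz with
    constant [|K| / gamma] ([ystar_lipschitz]), while [F] and its Jacobian are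
    Lipschitz and the Jacobian is bounded ([grad_Phi_lipschitz]).  A proximal step
    along the inexact gradient therefore decreases the smoothed objective by
    [theta L D_t] up to [(theta / L) A_t] ([step_decrease]), and the gradient mapping
    satisfies [|G(x_t)|^2 <= 8 L^2 D_t + 4 A_t] ([grad_map_le]).  The decrease is
    summed along each path, where the objective telescopes, and then integrated
    ([mean_pathwise_sum]); smoothing costs at most [gamma B_psi <= B_psi].

    The hybrid estimators make the errors contract.  The error at step [t + 1] is
    [beta] times the old one plus two centered batch averages, which are fresh given
    the past.  Freezing the past by Fubini's theorem and expanding the square
    ([hybrid_moment]) gives
    [E A_{t+1} <= beta^2 E A_t + beta^2 theta^2 C E D_t + (1 - beta)^2 S]
    ([weighted_error_step]).  The drift term needs a mean square Lipschitz bound on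
    the sampled functions themselves, whereas the assumptions bound their Jacobians:
    it comes from a mean value inequality for curves whose speed is merely
    measurable ([increment_le_integral], [FF_mean_square_lipschitz]).

    Descent and recursion combine once the drift is small compared with the
    contraction, [(5/2) theta^2 C beta^2 <= L^2 (1 - beta)], and bound the sum of the
    [8 L^2 E D_t + 4 E A_t] ([potential_sum]).  The random output turns this sum
    into an average ([output_error]).  With [x] the cube root of [b (T + 1)] the
    parameters are [1 - beta = b / (c1 x^2)] and [theta = L b / (P sqrt(c1) x)]; they
    satisfy the smallness condition ([drift_dominated]) and make the initial gap, the
    initial noise and the accumulated noise all of order [x^-2] ([rate_bound]).

    The complexity bounds follow by solving the rate for [T].  Rounding up
    enlarges each batch by at most one sample, and the initial batch is controlled by subadditivity of the cube root ([floor_iterations]). *)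

(** * Euclidean norms of vectors and matrices *)

Section euclidean_norm.
Context {R : realType}.

Lemma le_of_eq (x y : R) : x = y -> x <= y.
Proof. by move=> ->. Qed.

Definition mdot {k l} (A B : 'M[R]_(k, l)) : R :=
  \sum_(i < k) \sum_(j < l) A i j * B i j.

Lemma dotE k (u v : 'cV[R]_k) : dot u v = mdot u v.
Proof. by apply: eq_bigr => i _; rewrite big_ord1. Qed.

Lemma mdotC k l (A B : 'M[R]_(k, l)) : mdot A B = mdot B A.
Proof. by apply: eq_bigr => i _; apply: eq_bigr => j _; rewrite mulrC. Qed.

Lemma mdotDl k l (A B C : 'M[R]_(k, l)) : mdot (A + B) C = mdot A C + mdot B C.
Proof.
rewrite /mdot -big_split; apply: eq_bigr => i _; rewrite -big_split.
by apply: eq_bigr => j _; rewrite mxE mulrDl.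
Qed.

Lemma mdotZl k l c (A B : 'M[R]_(k, l)) : mdot (c *: A) B = c * mdot A B.
Proof.
rewrite /mdot mulr_sumr; apply: eq_bigr => i _; rewrite mulr_sumr.
by apply: eq_bigr => j _; rewrite mxE mulrA.
Qed.

Lemma mdotNl k l (A B : 'M[R]_(k, l)) : mdot (- A) B = - mdot A B.
Proof. by rewrite -scaleN1r mdotZl mulN1r. Qed.

Lemma mdotDr k l (A B C : 'M[R]_(k, l)) : mdot C (A + B) = mdot C A + mdot C B.
Proof. by rewrite mdotC mdotDl !(mdotC _ C). Qed.

Lemma mdotZr k l c (A B : 'M[R]_(k, l)) : mdot A (c *: B) = c * mdot A B.
Proof. by rewrite mdotC mdotZl mdotC. Qed.

Lemma mdotNr k l (A B : 'M[R]_(k, l)) : mdot A (- B) = - mdot A B.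
Proof. by rewrite mdotC mdotNl mdotC. Qed.

Lemma mdotBl k l (A B C : 'M[R]_(k, l)) : mdot (A - B) C = mdot A C - mdot B C.
Proof. by rewrite mdotDl mdotNl. Qed.

Lemma mdotBr k l (A B C : 'M[R]_(k, l)) : mdot C (A - B) = mdot C A - mdot C B.
Proof. by rewrite mdotDr mdotNr. Qed.

Lemma mdot_ge0 k l (A : 'M[R]_(k, l)) : 0 <= mdot A A.
Proof. by do 2 (apply: sumr_ge0 => ? _); rewrite -expr2 sqr_ge0. Qed.

Lemma mdot_eq0 k l (A : 'M[R]_(k, l)) : mdot A A = 0 -> A = 0.
Proof.
have ge0 i j : 0 <= A i j * A i j by rewrite -expr2 sqr_ge0.
move/eqP; rewrite psumr_eq0 => [/allP A0|i _]; last exact: sumr_ge0.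
apply/matrixP => i j; have /A0 /= := mem_index_enum i.
rewrite psumr_eq0 => // /allP /(_ j (mem_index_enum j)) /=.
by rewrite mulf_eq0 orbb mxE => /eqP.
Qed.

Lemma frob_ge0 k l (A : 'M[R]_(k, l)) : 0 <= frob A.
Proof. exact: sqrtr_ge0. Qed.

Lemma frob2 k l (A : 'M[R]_(k, l)) : frob A ^+ 2 = mdot A A.
Proof.
rewrite sqr_sqrtr; last by do 2 (apply: sumr_ge0 => ? _); rewrite sqr_ge0.
by do 2 (apply: eq_bigr => ? _).
Qed.

Lemma frob2_sum k l (A : 'M[R]_(k, l)) :
  frob A ^+ 2 = \sum_(c : 'I_k * 'I_l) A c.1 c.2 ^+ 2.
Proof. by rewrite frob2 /mdot pair_bigA. Qed.

Lemma frob_col2_sum k (u : 'cV[R]_k) : frob u ^+ 2 = \sum_i u i 0 ^+ 2.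
Proof. by rewrite frob2 -dotE. Qed.

Lemma frob0 k l : frob (0 : 'M[R]_(k, l)) = 0.
Proof. by apply/eqP; rewrite -sqrf_eq0 frob2 -(scale0r 0) mdotZl mul0r. Qed.

Lemma frob0_eq0 k l (A : 'M[R]_(k, l)) : frob A = 0 -> A = 0.
Proof. by move=> A0; apply: mdot_eq0; rewrite -frob2 A0 expr0n. Qed.

Lemma frobZ k l c (A : 'M[R]_(k, l)) : frob (c *: A) = `|c| * frob A.
Proof.
apply/eqP; rewrite -(@eqrXn2 _ 2) ?mulr_ge0 ?frob_ge0//.
by rewrite exprMn !frob2 mdotZl mdotZr real_normK ?num_real// expr2 mulrA.
Qed.

Lemma frobN k l (A : 'M[R]_(k, l)) : frob (- A) = frob A.
Proof. by rewrite -scaleN1r frobZ normrN1 mul1r. Qed.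

Lemma frobBC k l (A B : 'M[R]_(k, l)) : frob (A - B) = frob (B - A).
Proof. by rewrite -opprB frobN. Qed.

Lemma mdot_le k l (A B : 'M[R]_(k, l)) : mdot A B <= frob A * frob B.
Proof.
have [/frob0_eq0 ->|B0] := eqVneq (frob B) 0.
  by rewrite -(scale0r 0) mdotZr mul0r mulr_ge0 ?frob_ge0.
have [/frob0_eq0 ->|A0] := eqVneq (frob A) 0.
  by rewrite -(scale0r 0) mdotZl mul0r mulr_ge0 ?frob_ge0.
have a0 : 0 < frob A by rewrite lt_def A0 frob_ge0.
have b0 : 0 < frob B by rewrite lt_def B0 frob_ge0.
have := mdot_ge0 (frob B *: A - frob A *: B).
rewrite mdotBl !mdotBr !(mdotZl, mdotZr) (mdotC B A) -!frob2 => h.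
rewrite -subr_ge0 -(pmulr_rge0 _ (mulr_gt0 a0 b0)) -(pmulr_rge0 _ (@ltr0Sn R 1)).
by apply: le_trans h _; apply: le_of_eq; ring.
Qed.

Lemma mdot_le_norm k l (A B : 'M[R]_(k, l)) : `|mdot A B| <= frob A * frob B.
Proof. by rewrite ler_norml lerNl -mdotNl -{1}(frobN A) !mdot_le. Qed.

Lemma frobD_le k l (A B : 'M[R]_(k, l)) : frob (A + B) <= frob A + frob B.
Proof.
rewrite -(@ler_pXn2r _ 2) ?nnegrE ?addr_ge0 ?frob_ge0// sqrrD !frob2.
rewrite !(mdotDl, mdotDr) (mdotC B A); have := mdot_le A B; lra.
Qed.

Lemma frobB_le k l (A B : 'M[R]_(k, l)) : frob (A - B) <= frob A + frob B.
Proof. by rewrite -(frobN B) frobD_le. Qed.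

Lemma frobDB2 k l (A B : 'M[R]_(k, l)) :
  frob (A - B) ^+ 2 = frob A ^+ 2 - 2 * mdot A B + frob B ^+ 2.
Proof. by rewrite !frob2 !(mdotBl, mdotBr) (mdotC B A); ring. Qed.

Lemma frobDD2 k l (A B : 'M[R]_(k, l)) :
  frob (A + B) ^+ 2 = frob A ^+ 2 + 2 * mdot A B + frob B ^+ 2.
Proof. by rewrite !frob2 !(mdotDl, mdotDr) (mdotC B A); ring. Qed.

Lemma frobD2_le k l (A B : 'M[R]_(k, l)) :
  frob (A + B) ^+ 2 <= 2 * frob A ^+ 2 + 2 * frob B ^+ 2.
Proof.
have := sqr_ge0 (frob (A - B)); rewrite frobDB2 frobDD2; lra.
Qed.

(** The identity that makes half the squared Euclidean norm 1-strongly convex. *)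
Lemma frob2_convex_comb k l t (A B : 'M[R]_(k, l)) :
  frob (t *: A + (1 - t) *: B) ^+ 2 =
  t * frob A ^+ 2 + (1 - t) * frob B ^+ 2 - t * (1 - t) * frob (A - B) ^+ 2.
Proof.
rewrite !frob2 !(mdotBl, mdotBr, mdotDl, mdotDr, mdotZl, mdotZr) (mdotC B A).
by ring.
Qed.

Lemma mdot_mulmx k l (A : 'M[R]_(k, l)) u v :
  mdot u (A *m v) = mdot (A^T *m u) (v : 'cV[R]_l).
Proof.
rewrite -!dotE /dot.
under eq_bigr => i _ do rewrite mxE mulr_sumr.
rewrite exchange_big; apply: eq_bigr => j _ /=; rewrite [in RHS]mxE mulr_suml.
by apply: eq_bigr => i _; rewrite mxE; ring.
Qed.

(** The Cauchy-Schwarz inequality for every entry of the product; the double sum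
    of the bounds factors. *)
Lemma frob_mulmx k l m (A : 'M[R]_(k, l)) (B : 'M[R]_(l, m)) :
  frob (A *m B) <= frob A * frob B.
Proof.
rewrite -(@ler_pXn2r _ 2) ?nnegrE ?mulr_ge0 ?frob_ge0// exprMn frob2.
have le i j : (A *m B) i j ^+ 2 <=
    (\sum_s A i s ^+ 2) * (\sum_s B s j ^+ 2).
  have -> : (A *m B) i j = mdot ((row i A)^T) (col j B).
    by rewrite -dotE mxE; apply: eq_bigr => s _; rewrite !mxE.
  rewrite -real_normK ?num_real//.
  apply: (le_trans (y := (frob (row i A)^T * frob (col j B)) ^+ 2)).
    by rewrite ler_pXn2r ?nnegrE ?mulr_ge0 ?frob_ge0 // mdot_le_norm.
  rewrite exprMn !frob_col2_sum; apply: le_of_eq; congr (_ * _).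
    by apply: eq_bigr => s _; rewrite !mxE.
  by apply: eq_bigr => s _; rewrite !mxE.
apply: (le_trans (y := \sum_i \sum_j (\sum_s A i s ^+ 2) * (\sum_s B s j ^+ 2))).
  by apply: ler_sum => i _; apply: ler_sum => j _; rewrite -expr2.
under eq_bigr => i _ do rewrite -mulr_sumr.
rewrite -mulr_suml !frob2 /mdot; apply: le_of_eq; congr (_ * _).
rewrite exchange_big /=.
by do 2 (apply: eq_bigr => ? _).
Qed.

Lemma frob_tr k l (A : 'M[R]_(k, l)) : frob A^T = frob A.
Proof.
rewrite /frob exchange_big; congr Num.sqrt.
by do 2 (apply: eq_bigr => ? _); rewrite mxE.
Qed.

Lemma spectral_has_sup k l (A : 'M[R]_(k, l)) :
  has_sup [set frob (A *m y) | y in [set y : 'cV[R]_l | frob y <= 1]].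
Proof.
split; first by exists (frob (A *m (0 : 'cV[R]_l))), 0; rewrite /= ?frob0 ?ler01.
exists (frob A) => _ [y y1 <-].
by rewrite (le_trans (frob_mulmx _ _))// ler_piMr ?frob_ge0.
Qed.

Lemma spectral_ge0 k l (A : 'M[R]_(k, l)) : 0 <= spectral A.
Proof.
apply: (le_trans (frob_ge0 (A *m (0 : 'cV[R]_l)))); apply: sup_upper_bound.
  exact: spectral_has_sup.
by exists 0; rewrite //= frob0 ler01.
Qed.

Lemma frob_spectral k l (A : 'M[R]_(k, l)) (y : 'cV[R]_l) :
  frob (A *m y) <= spectral A * frob y.
Proof.
have [/frob0_eq0 ->|y0] := eqVneq (frob y) 0.
  by rewrite mulmx0 !frob0 mulr0.
have {}y0 : 0 < frob y by rewrite lt_def y0 frob_ge0.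
rewrite -ler_pdivrMr//.
have -> : frob (A *m y) / frob y = frob (A *m ((frob y)^-1 *: y)).
  by rewrite -scalemxAr frobZ ger0_norm ?invr_ge0 ?frob_ge0// mulrC.
apply: sup_upper_bound; first exact: spectral_has_sup.
exists ((frob y)^-1 *: y) => //=.
by rewrite frobZ ger0_norm ?invr_ge0 ?frob_ge0// mulVf// gt_eqF.
Qed.

Lemma frob_spectral_tr k l (A : 'M[R]_(k, l)) (u : 'cV[R]_k) :
  frob (A^T *m u) <= spectral A * frob u.
Proof.
have [->|u0] := eqVneq (frob (A^T *m u)) 0.
  by rewrite mulr_ge0 ?frob_ge0 ?spectral_ge0.
have {}u0 : 0 < frob (A^T *m u) by rewrite lt_def u0 frob_ge0.
rewrite -(ler_pM2r u0) -expr2 frob2 -mdot_mulmx (le_trans (mdot_le _ _))//.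
by rewrite mulrC mulrAC ler_wpM2r ?frob_ge0 ?frob_spectral.
Qed.

Lemma entry_le_frob k l (A : 'M[R]_(k, l)) i j : `|A i j| <= frob A.
Proof.
rewrite -(@ler_pXn2r _ 2) ?nnegrE ?frob_ge0 ?normr_ge0// frob2_sum.
rewrite (bigD1 (i, j)) //= real_normK ?num_real// lerDl.
by apply: sumr_ge0 => *; exact: sqr_ge0.
Qed.

(** The topology of matrices is that of the sup norm; the two bounds below make the
    Euclidean norm define the same topology. *)
Lemma norm_le_frob k l (A : 'M[R]_(k, l)) : `|A| <= frob A.
Proof.
rewrite [`|A|]mx_normrE; apply: bigmax_le => [|c _]; first exact: frob_ge0.
exact: entry_le_frob.
Qed.

Lemma entry_le_norm k l (A : 'M[R]_(k, l)) i j : `|A i j| <= `|A|.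
Proof.
by rewrite [`|A|]mx_normrE; apply: (le_bigmax _ (fun c => `|A c.1 c.2|) (i, j)).
Qed.

(** The summand 1 keeps the constant positive when a dimension is 0. *)
Definition mx_card k l : R := (k * l)%:R + 1.

Lemma mx_card_gt0 k l : 0 < mx_card k l.
Proof. by rewrite /mx_card ltr_wpDl. Qed.

Lemma frob_le_norm k l (A : 'M[R]_(k, l)) : frob A <= mx_card k l * `|A|.
Proof.
rewrite -(@ler_pXn2r _ 2) ?nnegrE ?frob_ge0 ?mulr_ge0 ?(ltW (mx_card_gt0 _ _))//.
rewrite frob2_sum.
apply: (le_trans (y := \sum_(c : 'I_k * 'I_l) `|A| ^+ 2)).
  apply: ler_sum => c _; rewrite -(real_normK (num_real (A _ _))).
  by rewrite ler_pXn2r ?nnegrE// entry_le_norm.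
rewrite sumr_const card_prod !card_ord exprMn -mulr_natl ler_wpM2r ?sqr_ge0//.
rewrite /mx_card; have : 0 <= (k * l)%:R :> R by [].
by set x := _%:R; nra.
Qed.

End euclidean_norm.

(** * Minimizers of closed strongly convex functions *)

Section strongly_convex_minimization.
Context {R : realType} {k : nat}.
Implicit Types (h : 'cV[R]_k -> \bar R) (g : 'cV[R]_k -> R) (x y z w : 'cV[R]_k).

(** Closedness of the epigraph in terms of the Euclidean norm, in the form of a
    lower semicontinuity statement that can be applied to approximate points. *)
Definition epi_closed h := forall x (r : R),
  (forall e, 0 < e -> exists y, frob (y - x) < e /\ (h y <= (r + e)%:E)%E) ->
  (h x <= r%:E)%E.

Lemma closed_fun_epi h : closed_fun h -> epi_closed h.
Proof.
move=> clh x r near_x; apply: (clh (x, r)) => B /nbhs_ballP[e /= e0 eB].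
have e20 : 0 < e / 2 by rewrite divr_gt0.
have [y [yx hy]] := near_x _ e20.
exists (y, r + e / 2); split=> //=; apply: eB; split=> /=.
  rewrite -ball_normE /= (le_lt_trans (norm_le_frob _))// frobBC.
  by rewrite (lt_trans yx)// ltr_pdivrMr// ltr_pMr// ltr1n.
rewrite -ball_normE /= opprD addNKr normrN gtr0_norm//.
by rewrite ltr_pdivrMr// ltr_pMr// ltr1n.
Qed.

Lemma fine_of_dom h x : (forall x, -oo < h x)%E -> dom h x ->
  h x = (fine (h x))%:E.
Proof. by move=> hNy hx; rewrite fineK// fin_numElt hNy. Qed.

Lemma dom_of_le h x (a : R) : (h x <= a%:E)%E -> dom h x.
Proof. by move=> /le_lt_trans; apply; rewrite ltry. Qed.

Lemma convex_fun_dom h x y t : (forall x, -oo < h x)%E -> convex_fun h ->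
  dom h x -> dom h y -> 0 <= t <= 1 ->
  dom h (t *: x + (1 - t) *: y) /\
  fine (h (t *: x + (1 - t) *: y)) <= t * fine (h x) + (1 - t) * fine (h y).
Proof.
move=> hNy hc hx hy t01; have := hc x y t t01.
rewrite (fine_of_dom hNy hx) (fine_of_dom hNy hy) -!EFinM -EFinD => le.
have hd := dom_of_le le; split=> //.
by rewrite -lee_fin -(fine_of_dom hNy hd).
Qed.

(** A closed convex function is bounded below near a point of its domain by
    semicontinuity, and convexity turns this into a bound that is linear in the
    distance to that point. *)
Lemma closed_convex_minorant h : Defs.proper h -> epi_closed h -> convex_fun h ->
  exists z (c C : R), 0 <= C /\
    forall y, dom h y -> c - C * frob (y - z) <= fine (h y).
Proof.
move=> [hNy [z hz]] hcl hc.
have [e e0 he] : exists2 e, 0 < e &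
    forall y, frob (y - z) < e -> dom h y -> fine (h z) - 1 < fine (h y).
  apply: contrapT => /forall2NP noe.
  suff : (h z <= (fine (h z) - 1)%:E)%E.
    by rewrite [X in (X <= _)%E](fine_of_dom hNy hz) lee_fin; lra.
  apply: hcl => e e0; have [//|/existsNP[y]] := noe e.
  move=> /not_implyP[yz] /not_implyP[hy] /negP; rewrite -leNgt => le.
  exists y; split=> //; rewrite (fine_of_dom hNy hy) lee_fin; lra.
exists z, (fine (h z) - 1), (2 / e); split; first by rewrite divr_ge0// ltW.
move=> y hy; have s0 := frob_ge0 (y - z).
have [ys|ys] := ltP (frob (y - z)) e.
  apply: le_trans (ltW (he _ ys hy)).
  by rewrite gerBl mulr_ge0// divr_ge0// ltW.
have {}s0 : 0 < frob (y - z) by lra.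
set s := frob (y - z) in s0 ys *.
(* The point of the segment at parameter l lies at distance e / 2 from z. *)
pose l := e / (2 * s).
have l0 : 0 < l by rewrite /l divr_gt0// mulr_gt0.
have l1 : l <= 1 by rewrite /l ler_pdivrMr ?mulr_gt0//; lra.
have l01 : 0 <= l <= 1 by rewrite ltW.
have [hd hl] := convex_fun_dom hNy hc hy hz l01.
have : frob (l *: y + (1 - l) *: z - z) < e.
  have -> : l *: y + (1 - l) *: z - z = l *: (y - z).
    by apply/matrixP => i j; rewrite !mxE; ring.
  rewrite frobZ gtr0_norm// -/s.
  have -> : l * s = e / 2 by rewrite /l; field; rewrite gt_eqF.
  lra.
move=> /he /(_ hd); set a := fine (h y) in hl *; set b := fine (h z) in hl *.
move=> lt; have {}lt : - 1 < l * (a - b) by lra.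
have -> : b - 1 - 2 / e * s = b - 1 - l^-1.
  by rewrite /l; field; rewrite !gt_eqF.
suff : - l^-1 < a - b by lra.
by rewrite -div1r -mulNr ltr_pdivrMr// mulrC.
Qed.

Lemma near_zero_bound (a b c : R) : 0 <= c ->
  (forall t, 0 < t < 1 -> a <= b + t * c) -> a <= b.
Proof.
move=> c0 h; apply/ler_addgt0Pr => e e0.
(* t * c <= e, and the definition also covers c = 0. *)
pose t := e / (e + c + 1).
have D0 : 0 < e + c + 1 by lra.
have t0 : 0 < t by rewrite divr_gt0.
have t1 : t < 1 by rewrite /t ltr_pdivrMr//; lra.
apply: (le_trans (h t _)); first by rewrite t0.
by rewrite lerD2l /t mulrAC ler_pdivrMr// ler_pM2l//; lra.
Qed.

Variables (h : 'cV[R]_k -> \bar R) (g : 'cV[R]_k -> R) (mu : R).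
Hypotheses (mu0 : 0 < mu) (hprop : Defs.proper h) (hcl : epi_closed h)
  (hconv : convex_fun h).
Hypothesis gsc : forall x y t, dom h x -> dom h y -> 0 <= t <= 1 ->
  g (t *: x + (1 - t) *: y) <=
  t * g x + (1 - t) * g y - mu / 2 * (t * (1 - t)) * frob (x - y) ^+ 2.
Hypothesis glsc : forall x e, dom h x -> 0 < e -> exists2 e', 0 < e' &
  forall y, dom h y -> frob (y - x) < e' -> g x - e <= g y.
Hypothesis glb : forall x, exists c e, 0 < e /\
  forall y, dom h y -> frob (y - x) < e -> c <= g y.
Hypothesis fbd : exists m, forall y, dom h y -> m <= fine (h y) + g y.

Let hNy x : (-oo < h x)%E. Proof. by case: hprop => + _; exact. Qed.

Let f x := fine (h x) + g x.

(** [g] is controlled only on the domain of [h], so the limit point is first placed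
    in that domain, with the local lower bound on [g]. *)
Let f_closed x (m : R) :
  (forall e, 0 < e -> exists y, [/\ frob (y - x) < e, dom h y & f y <= m + e]) ->
  dom h x /\ f x <= m.
Proof.
move=> near_x.
have hx : dom h x.
  have [c [e [e0 gc]]] := glb x.
  apply: (@dom_of_le _ _ (m + 1 - c)); apply: hcl => e1 e10.
  have me0 : 0 < Num.min 1 (Num.min e e1) by rewrite !lt_min ltr01 e0.
  have [y [ye hy fy]] := near_x _ me0; exists y.
  move: ye; rewrite !lt_min => /and3P[_ ye ye1]; split=> //.
  rewrite (fine_of_dom hNy hy) lee_fin; have := gc _ hy ye.
  have : Num.min 1 (Num.min e e1) <= 1 by rewrite ge_min lexx.
  by move: fy; rewrite /f; lra.
split=> //; rewrite /f; suff : (h x <= (m - g x)%:E)%E.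
  by rewrite (fine_of_dom hNy hx) lee_fin /= ; lra.
apply: hcl => e e0; have e20 : 0 < e / 2 by lra.
have [e' e'0 ge] := glsc hx e20.
have me0 : 0 < Num.min (e / 2) e' by rewrite !lt_min e20.
have [y [ye hy fy]] := near_x _ me0; exists y.
move: ye; rewrite lt_min => /andP[ye ye']; split; first by lra.
rewrite (fine_of_dom hNy hy) lee_fin; have := ge _ hy ye'.
have : Num.min (e / 2) e' <= e / 2 by rewrite ge_min lexx.
by move: fy; rewrite /f; lra.
Qed.

Let f_sc x y t : dom h x -> dom h y -> 0 <= t <= 1 ->
  dom h (t *: x + (1 - t) *: y) /\
  f (t *: x + (1 - t) *: y) <=
  t * f x + (1 - t) * f y - mu / 2 * (t * (1 - t)) * frob (x - y) ^+ 2.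
Proof.
move=> hx hy t01; have [hd hl] := convex_fun_dom hNy hconv hx hy t01.
split=> //; have := gsc hx hy t01; rewrite /f; move: hl; lra.
Qed.

(** By strong convexity a minimizing sequence is Cauchy, and its limit is a
    minimizer by closedness; comparing the minimizer with points of a segment gives
    the quadratic growth in the conclusion. *)
Lemma strong_minimizer : exists2 z, dom h z & forall w, dom h w ->
  fine (h z) + g z + mu / 2 * frob (w - z) ^+ 2 <= fine (h w) + g w.
Proof.
pose S := [set f w | w in dom h].
have Slb : has_lbound S by case: fbd => m hm; exists m => _ [w hw <-]; exact: hm.
have S0 : S !=set0 by case: hprop => _ [x hx]; exists (f x), x.
have Sinf : has_inf S by split.
set m := inf S.
have mle w : dom h w -> m <= f w by move=> hw; apply: ge_inf => //; exists w.
have minseq i : exists y, dom h y /\ f y < m + i.+1%:R^-1.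
  have [|_ [y hy <-] lt] := @inf_adherent _ S i.+1%:R^-1 _ Sinf; first by [].
  by exists y.
have {minseq}[u hu] := choice minseq.
have dist i j : frob (u i - u j) ^+ 2 <= 4 / mu * (i.+1%:R^-1 + j.+1%:R^-1).
  have [hui fi] := hu i; have [huj fj] := hu j.
  have h12 : 0 <= (2^-1 : R) <= 1 by apply/andP; lra.
  have [hd] := f_sc hui huj h12; have := mle _ hd.
  set a := f (u i) in fi *; set b := f (u j) in fj *.
  set D := frob _ ^+ 2; set A := _^-1 in fi *; set B := (j.+1)%:R^-1 in fj *.
  move=> l1 l2; have : mu * D <= 4 * (A + B) by lra.
  by rewrite mulrAC ler_pdivlMr// mulrC.
have cu : cvg (u i @[i --> \oo]).
  apply/cauchy_cvgP; apply: cauchy_exP => e e0.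
  have [N _ hN] : \forall i \near \oo, 8 / mu * i.+1%:R^-1 < e ^+ 2.
    have e20 : 0 < e ^+ 2 * mu / 8 by rewrite divr_gt0// mulr_gt0// exprn_gt0.
    near=> i.
    have : i.+1%:R^-1 < e ^+ 2 * mu / 8.
      by near: i; exact: near_infty_natSinv_lt (PosNum e20).
    set x := _^-1; move: x => x lt; rewrite mulrAC ltr_pdivrMr//.
    by move: lt; rewrite ltr_pdivlMr// mulrC.
  exists (u N), N => //= i /= Ni; rewrite -ball_normE /=.
  apply: (le_lt_trans (norm_le_frob _)).
  rewrite -(@ltr_pXn2r _ 2) ?nnegrE ?frob_ge0 ?(ltW e0)//.
  apply: le_lt_trans (hN N (leqnn N)).
  apply: (le_trans (dist _ _)).
  have le : i.+1%:R^-1 <= N.+1%:R^-1 :> R by rewrite lef_pV2 ?posrE// ler_nat ltnS.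
  have c0 : 0 < 4 / mu by rewrite divr_gt0.
  have : 4 / mu * (N.+1%:R^-1 + i.+1%:R^-1) <= 4 / mu * (2 * N.+1%:R^-1).
    by rewrite ler_pM2l// mulr_natl mulr2n lerD2l.
  move=> /le_trans; apply; apply: le_of_eq; rewrite mulrA; congr (_ * _).
  by field; rewrite gt_eqF.
pose z := lim (u i @[i --> \oo]).
have [hz fz] : dom h z /\ f z <= m.
  apply: f_closed => e e0.
  have C0 := @mx_card_gt0 R k 1.
  have eC0 : 0 < e / mx_card k 1 by rewrite divr_gt0.
  have [i [ui1 ui2]] : exists i, i.+1%:R^-1 < e /\ `|z - u i| < e / mx_card k 1.
    near \oo => i; exists i; split.
      by near: i; exact: near_infty_natSinv_lt (PosNum e0).
    by near: i; exact: cvgr_dist_lt.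
  have [hui fi] := hu i; exists (u i); split=> //.
    by rewrite frobBC (le_lt_trans (frob_le_norm _))// mulrC -ltr_pdivlMr.
  by rewrite (le_trans (ltW fi))// lerD2l ltW.
exists z => // w hw; rewrite -/(f z) -/(f w).
have mz : f z = m by apply/le_anti; rewrite fz mle.
apply: (@near_zero_bound _ _ (mu / 2 * frob (w - z) ^+ 2)).
  by rewrite mulr_ge0 ?sqr_ge0// divr_ge0// ltW.
move=> t /andP[t0 t1]; have t01 : 0 <= t <= 1 by rewrite !ltW.
have [hd] := f_sc hw hz t01; have := mle _ hd; rewrite -mz.
set D := frob _ ^+ 2; set E := mu / 2 * D.
have -> : mu / 2 * (t * (1 - t)) * D = t * (1 - t) * E by rewrite /E; ring.
move=> l1 l2; have : t * (f z + E) <= t * (f w + t * E) by lra.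
by rewrite ler_pM2l.
Unshelve. all: by end_near. Qed.

End strongly_convex_minimization.

(** * Proximal operator *)

Section proximal_operator.
Context {R : realType} {k : nat}.
Variables (f : 'cV[R]_k -> \bar R) (eta : R).
Hypotheses (fprop : Defs.proper f) (fcl : closed_fun f) (fconv : convex_fun f)
  (eta0 : 0 < eta).

Let fNy x : (-oo < f x)%E. Proof. by case: fprop => + _; exact. Qed.

Let eta20 : 0 < 2 * eta. Proof. by rewrite mulr_gt0. Qed.

(** The objective of the proximal problem is [eta^-1]-strongly convex, so that it
    has a minimizer, and the quadratic growth shows that it is the only one, hence
    the one selected by [prox]. *)
Lemma proxP x : let z := prox eta f x in dom f z /\ forall w, dom f w ->
  fine (f z) + frob (z - x) ^+ 2 / (2 * eta) + frob (w - z) ^+ 2 / (2 * eta) <=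
  fine (f w) + frob (w - x) ^+ 2 / (2 * eta).
Proof.
pose g := fun w => frob (w - x) ^+ 2 / (2 * eta).
have [||||||||z0 hz0 min0] := @strong_minimizer R k f g eta^-1.
- by rewrite invr_gt0.
- exact: fprop.
- exact: closed_fun_epi.
- exact: fconv.
- move=> y w t _ _ _; apply: le_of_eq; rewrite /g.
  have -> : t *: y + (1 - t) *: w - x = t *: (y - x) + (1 - t) *: (w - x).
    by apply/matrixP => i j; rewrite !mxE; ring.
  have -> : y - w = (y - x) - (w - x).
    by apply/matrixP => i j; rewrite !mxE; ring.
  by rewrite frob2_convex_comb; field; rewrite gt_eqF.
- move=> y e _ e0; rewrite /g.
  pose C := frob (y - x) / eta + 1.
  have C0 : 0 < C by rewrite /C ltr_wpDl// divr_ge0 ?frob_ge0 ?ltW.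
  exists (e / C) => [|w _ wy]; first by rewrite divr_gt0.
  have -> : w - x = (y - x) + (w - y).
    by apply/matrixP => i j; rewrite !mxE; ring.
  rewrite frobDD2; have := mdot_le_norm (y - x) (w - y).
  move: wy; rewrite ltr_pdivlMr// ler_norml => wy /andP[le _].
  have le2 : - (frob (y - x) * frob (w - y)) / eta <= mdot (y - x) (w - y) / eta.
    by rewrite ler_pM2r ?invr_gt0.
  have ge0 : 0 <= frob (w - y) ^+ 2 / (2 * eta).
    by rewrite divr_ge0 ?sqr_ge0// ltW.
  have -> : (frob (y - x) ^+ 2 + 2 * mdot (y - x) (w - y) + frob (w - y) ^+ 2)
    / (2 * eta) = frob (y - x) ^+ 2 / (2 * eta) + mdot (y - x) (w - y) / eta +
    frob (w - y) ^+ 2 / (2 * eta) by field; rewrite gt_eqF.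
  suff : - e <= - (frob (y - x) * frob (w - y)) / eta by lra.
  have -> : - (frob (y - x) * frob (w - y)) / eta =
    - (frob (w - y) * (frob (y - x) / eta)) by field; rewrite gt_eqF.
  rewrite lerN2 (le_trans _ (ltW wy))// ler_wpM2l ?frob_ge0//.
  by rewrite /C lerDl.
- move=> y; exists 0, 1; split=> // w _ _.
  by rewrite /g divr_ge0 ?sqr_ge0// ltW.
- have [z [c [C [C0 minor]]]] :=
    closed_convex_minorant fprop (closed_fun_epi fcl) fconv.
  (* Minimum over s of - C * s + s ^+ 2 / (2 * eta), by completing the square. *)
  exists (c - C * frob (x - z) - eta * C ^+ 2 / 2) => w hw.
  apply: (le_trans _ (lerD (minor _ hw) (lexx _))); rewrite /g.
  have tri : C * frob (w - z) <= C * (frob (w - x) + frob (x - z)).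
    rewrite ler_wpM2l//; have -> : w - z = (w - x) + (x - z).
      by apply/matrixP => i j; rewrite !mxE; ring.
    exact: frobD_le.
  have sq : 0 <= (frob (w - x) - eta * C) ^+ 2 / (2 * eta).
    by rewrite divr_ge0 ?sqr_ge0// ltW.
  have sqE : (frob (w - x) - eta * C) ^+ 2 / (2 * eta) =
    frob (w - x) ^+ 2 / (2 * eta) - C * frob (w - x) + eta * C ^+ 2 / 2.
    by field; rewrite gt_eqF.
  by move: tri sq; rewrite sqE mulrDr; lra.
have minE w : dom f w -> fine (f z0) + frob (z0 - x) ^+ 2 / (2 * eta) +
    frob (w - z0) ^+ 2 / (2 * eta) <= fine (f w) + frob (w - x) ^+ 2 / (2 * eta).
  move=> /min0; have -> // : eta^-1 / 2 * frob (w - z0) ^+ 2 =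
    frob (w - z0) ^+ 2 / (2 * eta) by field; rewrite gt_eqF.
have prox0 : is_prox eta f x z0.
  move=> w; have [hw|] := pselect (dom f w); last first.
    move=> /negP; rewrite -leNgt leye_eq => /eqP ->.
    by rewrite addye// leey.
  rewrite (fine_of_dom fNy hw) (fine_of_dom fNy hz0) -!EFinD lee_fin.
  have := minE _ hw; have : 0 <= frob (w - z0) ^+ 2 / (2 * eta).
    by rewrite divr_ge0 ?sqr_ge0// ltW.
  lra.
suff -> : prox eta f x = z0 by split.
have proxz : is_prox eta f x (prox eta f x).
  exact: (xgetPex 0 (P := [set z | is_prox eta f x z]) (ex_intro _ z0 prox0)).
have := proxz z0; rewrite (fine_of_dom fNy hz0) -EFinD.
set z := prox eta f x in proxz *; move=> le.
have hz : dom f z.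
  rewrite /dom /= ltNge leye_eq; apply/negP => /eqP zy.
  by move: le; rewrite zy addye.
move: le; rewrite (fine_of_dom fNy hz) -EFinD lee_fin => le.
have := minE _ hz => le'.
have : frob (z - z0) ^+ 2 / (2 * eta) <= 0 by lra.
rewrite pmulr_lle0 ?invr_gt0// => z00.
have /eqP : frob (z - z0) ^+ 2 = 0 by apply/le_anti; rewrite z00 sqr_ge0.
by rewrite sqrf_eq0 => /eqP /frob0_eq0 /subr0_eq.
Qed.

Lemma prox_dom x : dom f (prox eta f x). Proof. by case: (proxP x). Qed.

(** The three-point inequality behind the descent of a proximal gradient step. *)
Lemma prox_step x v (z := prox eta f (x - eta *: v)) : dom f x ->
  fine (f z) + mdot v (z - x) + frob (z - x) ^+ 2 / eta <= fine (f x).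
Proof.
move=> hx; have [hz /(_ _ hx)] := proxP (x - eta *: v); rewrite -/z.
have -> : z - (x - eta *: v) = (z - x) + eta *: v.
  by apply/matrixP => i j; rewrite !mxE; ring.
have -> : x - (x - eta *: v) = eta *: v.
  by apply/matrixP => i j; rewrite !mxE; ring.
rewrite (frobBC x z) frobDD2 mdotZr (mdotC (z - x)).
have -> : (frob (z - x) ^+ 2 + 2 * (eta * mdot v (z - x)) +
  frob (eta *: v) ^+ 2) / (2 * eta) = frob (z - x) ^+ 2 / (2 * eta) +
  mdot v (z - x) + frob (eta *: v) ^+ 2 / (2 * eta) by field; rewrite gt_eqF.
have -> : frob (z - x) ^+ 2 / eta =
  frob (z - x) ^+ 2 / (2 * eta) + frob (z - x) ^+ 2 / (2 * eta).
  by field; rewrite gt_eqF.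
lra.
Qed.

(** Each of the two minimizers is compared with the other one; the sum of the two
    growth inequalities is the firm nonexpansiveness of the operator. *)
Lemma prox_nonexpansive x y : frob (prox eta f x - prox eta f y) <= frob (x - y).
Proof.
have [ha ma] := proxP x; have [hb mb] := proxP y.
move: (ma _ hb) (mb _ ha) => {ha ma hb mb}.
move: (prox eta f x) (prox eta f y) => a b; rewrite (frobBC b a) => la lb.
have {la lb} : frob (a - b) ^+ 2 / (2 * eta) + frob (a - b) ^+ 2 / (2 * eta)
  + frob (a - x) ^+ 2 / (2 * eta) + frob (b - y) ^+ 2 / (2 * eta) <=
  frob (b - x) ^+ 2 / (2 * eta) + frob (a - y) ^+ 2 / (2 * eta) by lra.
rewrite -!(mulrDl _ _ (2 * eta)^-1) ler_pM2r ?invr_gt0// => le.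
have : frob (a - b) ^+ 2 <= mdot (x - y) (a - b).
  move: le; rewrite !frob2 !(mdotBl, mdotBr).
  rewrite (mdotC b a) (mdotC x a) (mdotC y b) (mdotC x b) (mdotC y a); lra.
move=> /le_trans /(_ (mdot_le _ _)); rewrite expr2.
have [->|ab0] := eqVneq (frob (a - b)) 0; first by rewrite frob_ge0.
by rewrite ler_pM2r// lt_def ab0 frob_ge0.
Qed.

End proximal_operator.

(** * Smoothed conjugate and its maximizer *)

Section smoothed_conjugate.
Context {R : realType} {dX : measure_display} {Xi : measurableType dX}.
Context {p q n : nat}.
Variables (pb : problem R Xi p q n) (cs : constants R) (d : 'cV[R]_n -> R).
Hypotheses (Hpb : standing_assumptions pb cs) (Hd : smoothing_function pb d).
Variable gamma : R.
Hypothesis gamma0 : 0 < gamma.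

Let psiNy x : (-oo < psi pb x)%E.
Proof. by case: (psi_proper Hpb) => + _; exact. Qed.

Lemma psi_fine y : dom (psi pb) y -> psi pb y = (fine (psi pb y))%:E.
Proof. exact: fine_of_dom. Qed.

Lemma sm_strongly_convex_fine y z t : dom (psi pb) y -> dom (psi pb) z ->
  0 <= t <= 1 -> d (t *: y + (1 - t) *: z) <=
    t * d y + (1 - t) * d z - 1 / 2 * (t * (1 - t)) * frob (y - z) ^+ 2.
Proof.
move=> hy hz t01.
have [hyz _] := convex_fun_dom psiNy (psi_convex Hpb) hy hz t01.
have := sm_strongly_convex Hd y z t01.
rewrite /extend !mem_set// -!EFinB -!EFinM -!EFinD lee_fin frob2_convex_comb.
lra.
Qed.

Lemma mdot_K_le u y : dom (psi pb) y ->
  `|dot u (Kmx pb *m y)| <= spectral (Kmx pb) * frob u * M_psi cs.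
Proof.
move=> hy; rewrite dotE mdot_mulmx (le_trans (mdot_le_norm _ _))//.
by rewrite ler_pM ?frob_ge0 ?frob_spectral_tr ?(psi_dom_bounded Hpb).
Qed.

Definition smooth_val u y := dot u (Kmx pb *m y) - fine (psi pb y) - gamma * d y.

Lemma smooth_obj_val u y : dom (psi pb) y ->
  smooth_obj pb d gamma u y = (smooth_val u y)%:E.
Proof. by move=> hy; rewrite /smooth_obj (psi_fine hy). Qed.

Lemma smooth_obj_notin u y : ~ dom (psi pb) y ->
  smooth_obj pb d gamma u y = -oo%E.
Proof.
move=> /negP; rewrite -leNgt leye_eq => /eqP psiy.
by rewrite /smooth_obj psiy.
Qed.

(** The penalty makes the problem [gamma]-strongly concave, so that the maximizer
    exists, is unique and is the one selected by [ystar]. *)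
Lemma ystarP u : let y := ystar pb d gamma u in dom (psi pb) y /\
  forall z, dom (psi pb) z ->
    smooth_val u z + gamma / 2 * frob (z - y) ^+ 2 <= smooth_val u y.
Proof.
pose g := fun y => gamma * d y - dot u (Kmx pb *m y).
have [||||||||y0 hy0 min0] := @strong_minimizer R n (psi pb) g gamma.
- exact: gamma0.
- exact: (psi_proper Hpb).
- exact: closed_fun_epi (psi_closed Hpb).
- exact: (psi_convex Hpb).
- move=> y z t hy hz t01; rewrite /g.
  have := sm_strongly_convex_fine hy hz t01.
  rewrite -(ler_pM2l gamma0) !dotE mulmxDr -!scalemxAr mdotDr !mdotZr; lra.
- move=> y e hy e0; rewrite /g.
  have [gr [_ taylor]] := sm_C1 Hd.
  have /nbhs_ballP[e1 /= e10 near1] := taylor y hy 1 ltr01.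
  pose C := gamma * (frob (gr y) + 1) + frob ((Kmx pb)^T *m u).
  have C0 : 0 < C.
    by rewrite /C ltr_wpDr ?frob_ge0// mulr_gt0// ltr_wpDl ?frob_ge0.
  exists (Num.min e1 (e / C)) => [|z hz]; first by rewrite lt_min e10 divr_gt0.
  rewrite lt_min => /andP[zy1]; rewrite ltr_pdivlMr// => zyC.
  have := near1 z; rewrite -ball_normE /= => /(_ _ hz) near_z.
  have {near_z} : `|d z - d y - dot (gr y) (z - y)| <= 1 * frob (z - y).
    by apply: near_z; rewrite (le_lt_trans (norm_le_frob _))// frobBC.
  rewrite ler_norml => /andP[le _].
  have lin : dot u (Kmx pb *m z) = dot u (Kmx pb *m y)
      + mdot ((Kmx pb)^T *m u) (z - y).
    by rewrite !dotE !mdot_mulmx mdotBr addrC subrK.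
  have := mdot_le_norm (gr y) (z - y); have := mdot_le ((Kmx pb)^T *m u) (z - y).
  rewrite lin !dotE ler_norml; move: le; rewrite dotE mul1r => le l1 /andP[l2 _].
  have : gamma * (d y - d z) <= gamma * ((frob (gr y) + 1) * frob (z - y)).
    by rewrite ler_pM2l//; lra.
  by move: zyC; rewrite /C; lra.
- move=> y; exists (- (spectral (Kmx pb) * frob u * M_psi cs)), 1.
  split=> // z hz _; have := mdot_K_le u hz; rewrite ler_norml => /andP[_ le].
  have := mulr_ge0 (ltW gamma0) (sm_ge0 Hd hz); rewrite /g; lra.
- have [z [c [C [C0 minor]]]] := closed_convex_minorant (psi_proper Hpb)
    (closed_fun_epi (psi_closed Hpb)) (psi_convex Hpb).
  exists (c - C * (M_psi cs + frob z)
          - spectral (Kmx pb) * frob u * M_psi cs) => w hw.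
  have := mdot_K_le u hw; rewrite ler_norml => /andP[_ le].
  have := mulr_ge0 (ltW gamma0) (sm_ge0 Hd hw); have := minor _ hw.
  have : C * frob (w - z) <= C * (M_psi cs + frob z).
    rewrite ler_wpM2l// (le_trans (frobB_le _ _))// lerD2r.
    exact: (psi_dom_bounded Hpb).
  rewrite /g; lra.
have maxE z : dom (psi pb) z ->
    smooth_val u z + gamma / 2 * frob (z - y0) ^+ 2 <= smooth_val u y0.
  by move=> /min0; rewrite /g /smooth_val; lra.
suff -> : ystar pb d gamma u = y0 by split.
pose S := [set y | forall z,
  (smooth_obj pb d gamma u z <= smooth_obj pb d gamma u y)%E].
have Sy : S (ystar pb d gamma u).
  apply: (xgetPex 0 (P := S)); exists y0 => z; rewrite (smooth_obj_val _ hy0).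
  have [hz|/smooth_obj_notin ->] := pselect (dom (psi pb) z).
    rewrite smooth_obj_val// lee_fin; have := maxE _ hz.
    have := mulr_ge0 (ltW gamma0) (sqr_ge0 (frob (z - y0))); lra.
  exact: leNye.
have := Sy y0; set y := ystar _ _ _ _; rewrite smooth_obj_val//.
have [hy|/smooth_obj_notin -> //] := pselect (dom (psi pb) y).
rewrite smooth_obj_val// lee_fin => le; have := maxE _ hy => le'.
have : gamma * frob (y - y0) ^+ 2 <= 0 by lra.
rewrite pmulr_rle0// => yy.
have /eqP : frob (y - y0) ^+ 2 = 0 by apply/le_anti; rewrite yy sqr_ge0.
by rewrite sqrf_eq0 => /eqP /frob0_eq0 /subr0_eq.
Qed.

Lemma ystar_dom u : dom (psi pb) (ystar pb d gamma u).
Proof. by case: (ystarP u). Qed.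

Lemma ystar_bounded u : frob (ystar pb d gamma u) <= M_psi cs.
Proof. exact: psi_dom_bounded Hpb _ (ystar_dom u). Qed.

Lemma K_ystar_bounded u :
  frob (Kmx pb *m ystar pb d gamma u) <= spectral (Kmx pb) * M_psi cs.
Proof.
rewrite (le_trans (frob_spectral _ _))// ler_wpM2l ?spectral_ge0//.
exact: ystar_bounded.
Qed.

Lemma phi_smoothE u :
  phi_smooth pb d gamma u = smooth_val u (ystar pb d gamma u).
Proof.
have [hy max] := ystarP u; rewrite /phi_smooth.
suff -> : ereal_sup (range (smooth_obj pb d gamma u)) =
    (smooth_val u (ystar pb d gamma u))%:E by [].
apply/le_anti/andP; split.
  apply: ge_ereal_sup => _ [z _ <-].
  have [hz|/smooth_obj_notin -> //] := pselect (dom (psi pb) z).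
  rewrite smooth_obj_val// lee_fin; have := max _ hz.
  have := mulr_ge0 (ltW gamma0) (sqr_ge0 (frob (z - ystar pb d gamma u))); lra.
  exact: leNye.
by apply: ereal_sup_ubound; exists (ystar pb d gamma u); rewrite // smooth_obj_val.
Qed.

Lemma smooth_val_le u z : dom (psi pb) z ->
  smooth_val u z <= phi_smooth pb d gamma u.
Proof.
move=> hz; rewrite phi_smoothE; have [_ /(_ _ hz)] := ystarP u.
have := mulr_ge0 (ltW gamma0) (sqr_ge0 (frob (z - ystar pb d gamma u))); lra.
Qed.

(** The quadratic growth at the two maximizers, added up, bounds
    [gamma * |a - b|^2] by a pairing of [u - v] with [K (a - b)]. *)
Lemma ystar_lipschitz u v : frob (ystar pb d gamma u - ystar pb d gamma v) <=
  spectral (Kmx pb) / gamma * frob (u - v).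
Proof.
have [ha ma] := ystarP u; have [hb mb] := ystarP v.
move: (ma _ hb) (mb _ ha) => {ha ma hb mb}.
move: (ystar _ _ _ u) (ystar _ _ _ v) => a b; rewrite (frobBC b a) => la lb.
have : gamma * frob (a - b) ^+ 2 <= mdot (u - v) (Kmx pb *m (a - b)).
  move: la lb; rewrite /smooth_val !dotE mulmxBr mdotBl !mdotBr; lra.
move=> /le_trans /(_ (mdot_le _ _)) /le_trans.
move=> /(_ _ (ler_wpM2l (frob_ge0 _) (frob_spectral _ _))).
have [->|ab0] := eqVneq (frob (a - b)) 0.
  by rewrite mulr_ge0 ?frob_ge0// divr_ge0 ?spectral_ge0// ltW.
have {}ab0 : 0 < frob (a - b) by rewrite lt_def ab0 frob_ge0.
rewrite expr2 !mulrA ler_pM2r// => le.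
by rewrite mulrAC ler_pdivlMr// mulrC (le_trans le)// mulrC.
Qed.

(** Danskin's formula, quantitatively: comparing the maximizers at two points
    bounds the increment of the smoothed conjugate between its two linearizations. *)
Lemma phi_smooth_taylor u v :
  `|phi_smooth pb d gamma v - phi_smooth pb d gamma u
    - mdot (Kmx pb *m ystar pb d gamma u) (v - u)|
  <= spectral (Kmx pb) ^+ 2 / gamma * frob (v - u) ^+ 2.
Proof.
have l1 := smooth_val_le v (ystar_dom u).
have l2 := smooth_val_le u (ystar_dom v).
have lin w y : smooth_val w y = mdot w (Kmx pb *m y) - fine (psi pb y)
  - gamma * d y by rewrite /smooth_val dotE.
have : mdot (Kmx pb *m (ystar pb d gamma v - ystar pb d gamma u)) (v - u)
    <= spectral (Kmx pb) ^+ 2 / gamma * frob (v - u) ^+ 2.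
  rewrite (le_trans (mdot_le _ _))// (expr2 (frob _)) mulrA.
  rewrite ler_wpM2r ?frob_ge0// (le_trans (frob_spectral _ _))//.
  by rewrite expr2 -2!mulrA ler_wpM2l ?spectral_ge0// mulrA ystar_lipschitz.
rewrite mulmxBr mdotBl; set A := Kmx pb *m _; set B := Kmx pb *m _.
rewrite ler_norml; set C := _ * _ ^+ 2 => le.
move: l1 l2; rewrite !phi_smoothE !lin -/A -/B.
have C0 : 0 <= C by rewrite /C mulr_ge0 ?sqr_ge0// divr_ge0 ?sqr_ge0// ltW.
move: le; rewrite !mdotBr (mdotC A) (mdotC A) (mdotC B) (mdotC B); lra.
Qed.

End smoothed_conjugate.

(** * Differentials of functions of column vectors *)

Section differentials.
Context {R : realType}.

(** The topology of matrices comes from the sup norm, the estimates from the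
    Euclidean norm. *)
Lemma frob_lipschitz_continuous k l (V : normedModType R) (C : R)
    (f : 'M[R]_(k, l) -> V) : 0 <= C ->
  (forall x y, `|f x - f y| <= C * frob (x - y)) -> continuous f.
Proof.
move=> C0 fC x A /nbhs_ballP[e /= e0 eA].
have M0 := @mx_card_gt0 R k l.
have D0 : 0 < C * mx_card k l + 1 by rewrite ltr_wpDl// mulr_ge0// ltW.
apply/nbhs_ballP; exists (e / (C * mx_card k l + 1)); first by rewrite /= divr_gt0.
move=> y; rewrite -ball_normE /= ltr_pdivlMr// => lt; apply: eA.
rewrite -ball_normE /= (le_lt_trans (fC x y))//; apply: le_lt_trans lt.
rewrite mulrDr mulr1 ler_wpDr// [leRHS]mulrC -mulrA.
by rewrite ler_wpM2l// frob_le_norm.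
Qed.

(** A name for the partial application, to carry its linear structure. *)
Definition mdotl k (a : 'cV[R]_k) : 'cV[R]_k -> R := mdot a.

Fact mdotl_linear k (a : 'cV[R]_k) : linear (mdotl a).
Proof. by move=> c x y; rewrite /mdotl mdotDr mdotZr. Qed.

HB.instance Definition _ k (a : 'cV[R]_k) :=
  GRing.isLinear.Build R 'cV[R]_k R *%R (mdotl a) (mdotl_linear a).

Lemma mdotl_continuous k (a : 'cV[R]_k) : continuous (mdotl a).
Proof.
apply: (@frob_lipschitz_continuous _ _ _ (frob a)); first exact: frob_ge0.
by move=> x y; rewrite /mdotl -mdotBr mdot_le_norm.
Qed.

Lemma cV_delta_sum k (v : 'cV[R]_k) : v = \sum_j v j 0 *: delta_mx j 0.
Proof.
by rewrite [LHS]matrix_sum_delta; apply: eq_bigr => i _; rewrite big_ord1.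
Qed.

Lemma diff_jacE k l (f : 'cV[R]_k -> 'cV[R]_l) x h : 'd f x h = jac f x *m h.
Proof.
rewrite [in LHS](cV_delta_sum h) linear_sum; apply/matrixP => i j.
rewrite summxE mxE; apply: eq_bigr => s _.
by rewrite linearZ !mxE mulrC ord1.
Qed.

Lemma diff_gradE k (f : 'cV[R]_k -> R) x h : 'd f x h = mdot (grad f x) h.
Proof.
rewrite [in LHS](cV_delta_sum h) linear_sum -dotE; apply: eq_bigr => s _.
by rewrite linearZ mxE /= mulrC.
Qed.

Lemma jac_taylor k l (f : 'cV[R]_k -> 'cV[R]_l) x e :
  differentiable f x -> 0 < e -> exists2 r, 0 < r & forall h, frob h < r ->
    frob (f (x + h) - f x - jac f x *m h) <= e * frob h.
Proof.
move=> /diff_locally/eqaddoP fdiff e0.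
have M0 := @mx_card_gt0 R l 1.
have /nbhs_ballP[r /= r0 hr] := fdiff _ (divr_gt0 e0 M0).
exists r => // h hlt.
apply: (le_trans (frob_le_norm _)).
have := hr h; rewrite -ball_normE /= sub0r normrN.
move=> /(_ (le_lt_trans (norm_le_frob _) hlt)).
rewrite !fctE /= diff_jacE opprD addrA [h + x]addrC => le.
rewrite mulrC -ler_pdivlMr// (le_trans le)// mulrAC ler_wpM2r ?invr_ge0 ?(ltW M0)//.
by rewrite ler_wpM2l ?(ltW e0)// norm_le_frob.
Qed.

Lemma is_derive_segment k (f : 'cV[R]_k -> R) x v (t : R) :
  differentiable f (x + t *: v) ->
  is_derive t 1 (fun s => f (x + s *: v)) (mdot (grad f (x + t *: v)) v).
Proof.
move=> fdiff.
have ldiff : is_diff t (fun s : R => x + s *: v) (fun s => s *: v).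
  have -> : (fun s : R => s *: v) = 0 + ( *:%R ^~ v).
    by apply/funext => s; rewrite fctE /= add0r.
  have -> : (fun s : R => x + s *: v) = cst x + ( *:%R ^~ v) by apply/funext.
  exact: is_diffD.
have fl : differentiable (f \o (fun s : R => x + s *: v)) t.
  by apply: differentiable_comp => //; exact: ex_diff.
apply: DeriveDef; first exact/derivable1_diffP.
rewrite deriveE//.
have -> : 'd (fun s => f (x + s *: v)) t =
  'd f (x + t *: v) \o 'd (fun s : R => x + s *: v) t :> (R -> R).
  by apply: diff_comp => //; exact: ex_diff.
by rewrite /= diff_val /= scale1r diff_gradE.
Qed.

(** The descent inequality.  It is stated for one segment because the gradient of
    the smoothed objective is Lipschitz only on the domain, which is convex.  The
    mean value theorem applies to [f] minus the quadratic upper bound. *)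
Lemma descent_segment k (f : 'cV[R]_k -> R) (x v : 'cV[R]_k) (L : R) :
  (forall y, differentiable f y) ->
  (forall t, 0 <= t <= 1 ->
     mdot (grad f (x + t *: v) - grad f x) v <= L * t * frob v ^+ 2) ->
  f (x + v) <= f x + mdot (grad f x) v + L / 2 * frob v ^+ 2.
Proof.
move=> fdiff fL.
pose a := mdot (grad f x) v; pose c := L / 2 * frob v ^+ 2.
pose g (s : R) : R := f (x + s *: v) - s * a - c * s ^+ 2.
pose dg (t : R) : R := mdot (grad f (x + t *: v)) v - a - c * (2 * t).
have gd (t : R) : is_derive t 1 g (dg t).
  have h1 := is_derive_segment (fdiff (x + t *: v)).
  apply: is_derive_eq; rewrite /dg /GRing.scale /=.
  by congr (_ - _ - _); ring.
have cg : {within `[0, 1], continuous g}.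
  apply: continuous_subspaceT => t; apply: differentiable_continuous.
  by apply/derivable1_diffP; apply: ex_derive.
have [t t01 gE] := MVT_segment ler01 (fun t _ => gd t) cg.
have dgt : dg t <= 0.
  move: t01; rewrite in_itv /= => t01; have := fL _ t01.
  rewrite mdotBl lerBlDr => le; rewrite /dg subr_le0 lerBlDr (le_trans le)//.
  by rewrite lerD2r /c; apply: le_of_eq; field.
have g1 : g 1 = f (x + v) - a - c by rewrite /g scale1r mul1r expr1n mulr1.
have g0 : g 0 = f x by rewrite /g scale0r addr0 mul0r expr0n mulr0 !subr0.
have : g 1 - g 0 <= 0 by rewrite gE subr0 mulr1.
rewrite g1 g0 subr_le0 !lerBlDr.
by rewrite addrAC.
Qed.

End differentials.

Section smoothed_objective.
Context {R : realType} {dX : measure_display} {Xi : measurableType dX}.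
Context {p q n : nat}.
Variables (pb : problem R Xi p q n) (cs : constants R) (d : 'cV[R]_n -> R).
Hypotheses (Hpb : standing_assumptions pb cs) (Hd : smoothing_function pb d).
Variable gamma : R.
Hypothesis gamma0 : 0 < gamma.

(** The quadratic bound of [phi_smooth_taylor] is an o of the increment. *)
Lemma phi_smooth_is_diff u : is_diff u (phi_smooth pb d gamma)
  (mdotl (Kmx pb *m ystar pb d gamma u)).
Proof.
have tay : phi_smooth pb d gamma \o shift u =
    cst (phi_smooth pb d gamma u) + mdotl (Kmx pb *m ystar pb d gamma u) +o_ 0 id.
  apply/eqaddoP => e e0.
  pose C := spectral (Kmx pb) ^+ 2 / gamma * mx_card q 1 ^+ 2.
  have C0 : 0 <= C by rewrite mulr_ge0 ?sqr_ge0// divr_ge0 ?sqr_ge0// ltW.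
  near=> h; rewrite !fctE /= opprD addrA.
  have := phi_smooth_taylor Hpb Hd gamma0 u (h + u).
  rewrite addrK => /le_trans; apply.
  apply: (le_trans (y := C * `|h| ^+ 2)).
    rewrite /C -[leRHS]mulrA ler_wpM2l ?divr_ge0 ?sqr_ge0// ?(ltW gamma0)//.
    rewrite -exprMn ler_pXn2r ?nnegrE ?frob_ge0 ?frob_le_norm//.
    by rewrite mulr_ge0// ltW ?mx_card_gt0.
  rewrite expr2 mulrA ler_wpM2r//.
  have hlt : `|h| < e / (C + 1).
    near: h; apply/nbhs_ballP; exists (e / (C + 1)) => /=.
      by rewrite divr_gt0// ltr_wpDl.
    by move=> h; rewrite -ball_normE /= sub0r normrN.
  move: hlt; rewrite ltr_pdivlMr ?ltr_wpDl// => hlt.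
  by rewrite mulrC (le_trans _ (ltW hlt))// ler_wpM2l// lerDl.
have dE := diff_unique (@mdotl_continuous _ _ _) tay.
apply: DiffDef => //; apply/diff_locallyP; rewrite dE; split=> //.
exact: mdotl_continuous.
Unshelve. all: by end_near. Qed.

Lemma Phi_differentiable x : differentiable (Phi pb d gamma) x.
Proof.
apply: differentiable_comp; first exact: (Fmean_differentiable Hpb).
exact: (@ex_diff _ _ _ _ _ _ _ (phi_smooth_is_diff _)).
Qed.

Lemma grad_PhiE x : grad (Phi pb d gamma) x =
  (jac (Fmean pb) x)^T *m (Kmx pb *m ystar pb d gamma (Fmean pb x)).
Proof.
apply/matrixP => j j0; rewrite {j0}ord1 mxE.
have -> : 'd (Phi pb d gamma) x = mdotl (Kmx pb *m ystar pb d gamma (Fmean pb x))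
    \o 'd (Fmean pb) x :> (_ -> R).
  have phd := phi_smooth_is_diff (Fmean pb x).
  rewrite -(@diff_val _ _ _ _ _ _ _ phd); apply: diff_comp.
    exact: (Fmean_differentiable Hpb).
  exact: (@ex_diff _ _ _ _ _ _ _ phd).
rewrite /= /mdotl -dotE mxE; apply: eq_bigr => i _.
by rewrite !mxE mulrC.
Qed.

End smoothed_objective.

(** * Measurability of compositions and independence *)

Section caratheodory_functions.
Context {R : realType} {d : measure_display} {T : measurableType d}.

Definition measurable_mx k l (x : T -> 'M[R]_(k, l)) :=
  forall i j, measurable_fun setT (fun w => x w i j).

Definition grid_index k (m : nat) (z : 'cV[R]_k) : 'cV[int]_k :=
  \col_i Num.floor (m.+1%:R * z i 0).

Definition grid_point k (m : nat) (c : 'cV[int]_k) : 'cV[R]_k :=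
  \col_i ((c i 0)%:~R / m.+1%:R).

Lemma grid_dist k m (z : 'cV[R]_k) :
  `|z - grid_point m (grid_index m z)| <= m.+1%:R^-1.
Proof.
have m0 : 0 < m.+1%:R^-1 :> R by [].
rewrite [leLHS]mx_normrE; apply: bigmax_le => [|[i j] _]; first exact: ltW.
rewrite !mxE /= (ord1 j).
have -> : z i 0 - (Num.floor (m.+1%:R * z i 0))%:~R / m.+1%:R =
    (m.+1%:R * z i 0 - (Num.floor (m.+1%:R * z i 0))%:~R) / m.+1%:R.
  by rewrite mulrBl mulrAC divff ?mul1r.
rewrite normrM (gtr0_norm m0) ler_piMl ?(ltW m0)//.
have := floor_itv (m.+1%:R * z i 0); set y := m.+1%:R * _.
by rewrite intrD ler_norml => /andP[l1 l2]; apply/andP; split; lra.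
Qed.

(** A function that is continuous in one variable and measurable in the other is
    the limit of its values at grid points, along which the composite takes
    countably many branches. *)
Lemma measurable_comp_continuous k (x : T -> 'cV[R]_k) (f : 'cV[R]_k -> T -> R) :
  measurable_mx x -> (forall z, measurable_fun setT (f z)) ->
  (forall w, continuous (f ^~ w)) ->
  measurable_fun setT (fun w => f (x w) w).
Proof.
move=> mx mf cf.
apply: (@measurable_fun_cvg _ _ _ _
  (fun m w => f (grid_point m (grid_index m (x w))) w)) => [m _ Y mY|w _].
  rewrite setTI.
  rewrite [X in measurable X](_ : _ = \bigcup_(c : 'cV[int]_k)
    ((fun w => grid_index m (x w)) @^-1` [set c] `&`
      f (grid_point m c) @^-1` Y)); last first.
    apply/seteqP; split=> [w /= Yw|w [c _] [/= <-]//].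
    by exists (grid_index m (x w)).
  apply: countable_bigcupT_measurable => [|c]; first exact: countableP.
  apply: measurableI; last by rewrite -[X in measurable X]setTI; exact: mf.
  rewrite [X in measurable X](_ : _ = \bigcap_(i in [set: 'I_k])
    ((fun w => m.+1%:R * x w i 0) @^-1` `[(c i 0)%:~R, (c i 0 + 1)%:~R[));
    last first.
    apply/seteqP; split=> [w /= <- i _|w /= h].
      by rewrite /= mxE in_itv /= floor_itv.
    apply/matrixP => i j; rewrite (ord1 j) mxE; apply/floor_def.
    by have := h i I; rewrite /= in_itv.
  apply: fin_bigcap_measurable => [|i _]; first exact: finite_finset.
  rewrite -[X in measurable X]setTI.
  have : measurable_fun setT (fun w => m.+1%:R * x w i 0).
    by apply: measurable_funM => //; exact: mx.
  by apply => //; exact: measurable_itv.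
apply: (@cvg_comp _ _ _ (fun m => grid_point m (grid_index m (x w))) (f ^~ w)).
  2: exact: cf.
move=> A /nbhs_ballP[e /= e0 eA].
near=> m; apply: eA; rewrite -ball_normE /=.
apply: (le_lt_trans (grid_dist _ _)).
by near: m; exact: near_infty_natSinv_lt (PosNum e0).
Unshelve. all: by end_near. Qed.

End caratheodory_functions.

Section independence.
Context {R : realType} {d d1 d2 : measure_display}.
Context {T : measurableType d} {U : measurableType d1} {V : measurableType d2}.
Variables (P : probability T R) (X : T -> U) (Y : T -> V).
Hypotheses (mX : measurable_fun setT X) (mY : measurable_fun setT Y).
Hypothesis indep : forall A B, measurable A -> measurable B ->
  P (X @^-1` A `&` Y @^-1` B) = (P (X @^-1` A) * P (Y @^-1` B))%E.

Let X' : {mfun T >-> U} := mfun_Sub (mem_set mX).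
Let Y' : {mfun T >-> V} := mfun_Sub (mem_set mY).
Let PX : probability U R := distribution P X'.
Let PY : probability V R := distribution P Y'.
Let XY w := (X w, Y w).
Let mXY : measurable_fun setT XY. Proof. exact: measurable_fun_pair. Qed.
Let XY' : {mfun T >-> (U * V)%type} := mfun_Sub (mem_set mXY).

Let law_pair A : measurable A -> pushforward P XY A = (PX \x PY)%E A.
Proof.
move=> mA; symmetry.
by apply: (product_measure_unique (m' := distribution P XY')) => // *; exact: indep.
Qed.

(** The law of an independent pair is the product of the laws, which turns an
    expectation into an iterated one with the first component frozen. *)
Lemma ge0_integral_indep (G : U * V -> \bar R) :
  measurable_fun setT G -> (forall z, 0 <= G z)%E ->
  (\int[P]_w G (X w, Y w) = \int[P]_w \int[P]_w' G (X w, Y w'))%E.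
Proof.
move=> mG G0.
transitivity (\int[distribution P XY']_z G z)%E.
  by rewrite /distribution ge0_integral_pushforward.
transitivity (\int[PX \x PY]_z G z)%E.
  by apply: eq_measure_integral => A mA _; exact: law_pair.
rewrite fubini_tonelli1// /fubini_F /PX /distribution ge0_integral_pushforward//=.
- apply: eq_integral => w _ /=.
  rewrite /PY /distribution ge0_integral_pushforward//.
  exact: measurableT_comp.
- exact: measurable_fun_fubini_tonelli_F.
- by move=> x _; exact: integral_ge0.
Qed.

Lemma integral_indep_mul0 (g : U -> R) (h : V -> R) :
  measurable_fun setT g -> measurable_fun setT h ->
  P.-integrable setT (EFin \o (g \o X)) ->
  P.-integrable setT (fun w => (g (X w) * h (Y w))%:E) ->
  (\int[P]_w (g (X w))%:E = 0)%E ->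
  (\int[P]_w (g (X w) * h (Y w))%:E = 0)%E.
Proof.
move=> mg mh ig igh g0.
pose G (z : U * V) := (g z.1 * h z.2)%:E.
have mG : measurable_fun setT G.
  apply/measurable_EFinP; apply: measurable_funM.
    by apply: measurableT_comp => //; exact: measurable_fst.
  by apply: measurableT_comp => //; exact: measurable_snd.
have iG : (PX \x PY)%E.-integrable setT G.
  apply/integrableP; split=> //.
  have -> : (\int[PX \x PY]_z `|G z| = \int[distribution P XY']_z `|G z|)%E.
    by apply: eq_measure_integral => A mA _; apply: esym; exact: law_pair.
  rewrite /distribution ge0_integral_pushforward//; last exact: measurableT_comp.
  by case/integrableP: igh.
transitivity (\int[distribution P XY']_z G z)%E.
  by rewrite /distribution integral_pushforward.
transitivity (\int[PX \x PY]_z G z)%E.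
  by apply: eq_measure_integral => A mA _; exact: law_pair.
rewrite -integral21_prod_meas1//; apply: integral0_eq => y _.
rewrite /fubini_G /G /=; under eq_integral do rewrite mulrC EFinM.
rewrite integralZl//; last first.
  by apply: integrable_pushforward => //; apply/measurable_EFinP.
rewrite /PX /distribution integral_pushforward//; last by apply/measurable_EFinP.
by rewrite [X in (_ * X)%E](_ : _ = 0%E) ?mule0.
Qed.

End independence.

(** * Second moments of mini-batch averages *)

Section square_integrable.
Context {R : realType} {d : measure_display} {T : measurableType d}.
Variable P : probability T R.
Implicit Types f g : T -> R.

Lemma integrable_add f g : P.-integrable setT (EFin \o f) ->
  P.-integrable setT (EFin \o g) ->
  P.-integrable setT (EFin \o (fun w => f w + g w)).
Proof. by move=> i_f ig; exact: (integrableD measurableT i_f ig). Qed.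

Lemma integrable_scale f c : P.-integrable setT (EFin \o f) ->
  P.-integrable setT (EFin \o (fun w => c * f w)).
Proof. by move=> i_f; exact: (integrableZl measurableT c i_f). Qed.

(** Square integrability in real form, which keeps the algebra of second moments
    out of the extended reals. *)
Definition sqint f := measurable_fun setT f /\
  P.-integrable setT (EFin \o (fun w => f w ^+ 2)).

Lemma sqint_mul f g : sqint f -> sqint g ->
  P.-integrable setT (EFin \o (fun w => f w * g w)).
Proof.
move=> [mf i_f] [mg ig].
apply: (@le_integrable _ _ _ _ _ measurableT _
  (EFin \o (fun w => f w ^+ 2 + g w ^+ 2))) => //.
- by apply/measurable_EFinP; exact: measurable_funM.
- move=> w _; rewrite /= lee_fin [leRHS]ger0_norm ?addr_ge0 ?sqr_ge0// ler_norml.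
  have := sqr_ge0 (f w - g w); have := sqr_ge0 (f w + g w).
  have := sqr_ge0 (f w); have := sqr_ge0 (g w).
  rewrite sqrrB sqrrD; move: (f w ^+ 2) (g w ^+ 2) (f w * g w) => a b c.
  by move=> ? ? ? ?; apply/andP; split; lra.
- exact: integrable_add.
Qed.

Lemma integrable_cst_prob (c : R) : P.-integrable setT (EFin \o (fun=> c)).
Proof. exact: finite_measure_integrable_cst. Qed.

Lemma sqint_cst c : sqint (fun=> c).
Proof. by split; [exact: measurable_cst|exact: integrable_cst_prob]. Qed.

Lemma sqint_integrable f : sqint f -> P.-integrable setT (EFin \o f).
Proof.
move=> /sqint_mul/(_ (sqint_cst 1)).
by under eq_fun do rewrite mulr1.
Qed.

Lemma sqintD f g : sqint f -> sqint g -> sqint (fun w => f w + g w).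
Proof.
move=> sf sg; have ifg := sqint_mul sf sg; case: sf sg => [mf i_f] [mg ig].
split; first exact: measurable_funD.
under [X in EFin \o X]eq_fun do rewrite sqrrD -mulr_natl.
by apply: integrable_add => //; apply: integrable_add => //; exact: integrable_scale.
Qed.

Lemma sqintZ f c : sqint f -> sqint (fun w => c * f w).
Proof.
move=> [mf i_f]; split; first exact: measurable_funM.
by under [X in EFin \o X]eq_fun do rewrite exprMn; exact: integrable_scale.
Qed.

Lemma sqint_subcst f c : sqint f -> sqint (fun w => f w - c).
Proof. by move=> sf; apply: sqintD => //; exact: sqint_cst. Qed.

Lemma sqint_le f (c : R) : measurable_fun setT f ->
  (\int[P]_w (f w ^+ 2)%:E <= c%:E)%E -> sqint f.
Proof.
move=> mf le; split=> //; apply/integrableP; split.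
  by apply/measurable_EFinP; exact: measurable_funX.
under eq_integral do rewrite /= ger0_norm ?sqr_ge0//.
by rewrite (le_lt_trans le)// ltry.
Qed.

Lemma EFin_Rintegral f : P.-integrable setT (EFin \o f) ->
  (\int[P]_w f w)%:E = (\int[P]_w (f w)%:E)%E.
Proof. by move=> i_f; rewrite fineK//; exact: integrable_fin_num. Qed.

Lemma Rintegral_cst1 (c : R) : \int[P]_w c = c.
Proof.
by rewrite Rintegral_cst// [X in fine X](_ : _ = 1%E) ?mulr1//; exact: probability_setT.
Qed.

Lemma integrable_sumr (I : Type) (r : seq I) (F : I -> T -> R) :
  (forall i, P.-integrable setT (EFin \o F i)) ->
  P.-integrable setT (EFin \o (fun w => \sum_(i <- r) F i w)).
Proof.
move=> iF; elim: r => [|i r IH].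
  by under [X in EFin \o X]eq_fun do rewrite big_nil; exact: integrable_cst_prob.
by under [X in EFin \o X]eq_fun do rewrite big_cons; exact: integrable_add.
Qed.

Lemma Rintegral_sum (I : Type) (r : seq I) (F : I -> T -> R) :
  (forall i, P.-integrable setT (EFin \o F i)) ->
  \int[P]_w (\sum_(i <- r) F i w) = \sum_(i <- r) \int[P]_w F i w.
Proof.
move=> iF; elim: r => [|i r IH].
  by under eq_Rintegral do rewrite big_nil; rewrite big_nil Rintegral_cst1.
under eq_Rintegral do rewrite big_cons; rewrite big_cons RintegralD// ?IH//.
exact: integrable_sumr.
Qed.

Lemma Rintegral_sqr_ge0 f : 0 <= \int[P]_w (f w ^+ 2).
Proof. by apply: Rintegral_ge0 => w _; exact: sqr_ge0. Qed.

Lemma Rintegral_sqrD f g : sqint f -> sqint g ->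
  \int[P]_w ((f w + g w) ^+ 2) =
  \int[P]_w (f w ^+ 2) + 2 * \int[P]_w (f w * g w) + \int[P]_w (g w ^+ 2).
Proof.
move=> sf sg; have ifg := sqint_mul sf sg; case: (sf) (sg) => [_ i_f] [_ ig].
under eq_Rintegral do rewrite sqrrD -mulr_natl.
rewrite RintegralD//; last by apply: integrable_add => //; exact: integrable_scale.
by rewrite RintegralD// ?RintegralZl//; exact: integrable_scale.
Qed.

Lemma Rintegral_sqrZ f c : sqint f ->
  \int[P]_w ((c * f w) ^+ 2) = c ^+ 2 * \int[P]_w (f w ^+ 2).
Proof.
by move=> [_ i_f]; under eq_Rintegral do rewrite exprMn; rewrite RintegralZl.
Qed.

Lemma variance_le f : sqint f ->
  \int[P]_w ((f w - \int[P]_w f w) ^+ 2) <= \int[P]_w (f w ^+ 2).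
Proof.
move=> sf; rewrite Rintegral_sqrD//; last exact: sqint_cst.
set m := \int[P]_w f w; rewrite Rintegral_cst1.
under [X in 2 * X]eq_Rintegral do rewrite mulrC.
rewrite RintegralZl//; last exact: sqint_integrable.
rewrite -/m; have := sqr_ge0 m; rewrite expr2 sqrrN; lra.
Qed.

Lemma Rintegral_jensen f : sqint f ->
  (\int[P]_w f w) ^+ 2 <= \int[P]_w (f w ^+ 2).
Proof.
move=> sf; have := Rintegral_sqr_ge0 (fun w => f w - \int[P]_w f w).
rewrite Rintegral_sqrD//; last exact: sqint_cst.
set m := \int[P]_w f w; rewrite Rintegral_cst1.
under [X in 2 * X]eq_Rintegral do rewrite mulrC.
rewrite RintegralZl//; last exact: sqint_integrable.
rewrite -/m; have := sqr_ge0 m; rewrite expr2 sqrrN; lra.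
Qed.

(** Expanding the square of the sum, the cross terms vanish. *)
Lemma Rintegral_sqr_uncorrelated m (F : nat -> T -> R) :
  (forall i, (i < m)%N -> sqint (F i)) ->
  (forall i j, (i < m)%N -> (j < m)%N -> i != j -> \int[P]_w (F i w * F j w) = 0) ->
  sqint (fun w => \sum_(i < m) F i w) /\
  \int[P]_w ((\sum_(i < m) F i w) ^+ 2) = \sum_(i < m) \int[P]_w (F i w ^+ 2).
Proof.
elim: m => [|m IH] sF unc.
  split; first by under eq_fun do rewrite big_ord0; exact: sqint_cst.
  under eq_Rintegral do rewrite big_ord0 expr0n.
  by rewrite big_ord0 Rintegral_cst1.
have [|i j im jm ij|sS IHE] := IH.
- by move=> i im; apply: sF; rewrite ltnS ltnW.
- by apply: unc => //; rewrite ltnS ltnW.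
have sm := sF _ (ltnSn m).
split; first by under eq_fun do rewrite big_ord_recr; exact: sqintD.
under eq_Rintegral do rewrite big_ord_recr; rewrite big_ord_recr Rintegral_sqrD//.
rewrite IHE (_ : \int[P]_w (_ * _) = 0) ?mulr0 ?addr0//.
under eq_Rintegral do rewrite mulr_suml.
rewrite Rintegral_sum => [|i].
  rewrite big1// => i _; apply: (unc _ _ (leqW (ltn_ord i)) (ltnSn m)).
  by rewrite ltn_eqF.
by apply: sqint_mul => //; exact: (sF _ (leqW (ltn_ord i))).
Qed.

End square_integrable.

Section batches.
Context {R : realType} {dX dO : measure_display}.
Context {Xi : measurableType dX} {Omega : measurableType dO}.
Variables (Pr : probability Omega R) (law : probability Xi R).

Definition has_law (X : Omega -> Xi) := measurable_fun setT X /\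
  forall A, measurable A -> Pr (X @^-1` A) = law A.

Definition pair_indep (X Y : Omega -> Xi) := forall A B, measurable A ->
  measurable B -> Pr (X @^-1` A `&` Y @^-1` B) = (Pr (X @^-1` A) * Pr (Y @^-1` B))%E.

Lemma iid_has_law m X i : iid_batch Pr law m X -> (i < m)%N -> has_law (X i).
Proof. by move=> [h _] /h. Qed.

(** Pairwise independence is the product rule with trivial events at all other
    indices. *)
Lemma iid_pair_indep m X i j : iid_batch Pr law m X -> (i < m)%N -> (j < m)%N ->
  i != j -> pair_indep (X i) (X j).
Proof.
move=> [hX hprod] im jm ij A B mA mB.
pose F k := if k == i then A else if k == j then B else setT.
have mF k : measurable (F k) by rewrite /F; case: eqP => // _; case: eqP.
have Fi : F i = A by rewrite /F eqxx.
have Fj : F j = B by rewrite /F eq_sym (negbTE ij) eqxx.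
have := hprod F mF.
have -> : \bigcap_(k in `I_m) (X k @^-1` F k) = X i @^-1` A `&` X j @^-1` B.
  apply/seteqP; split=> [w h|w [hA hB] k km].
    by split; [rewrite -Fi; exact: h|rewrite -Fj; exact: h].
  by rewrite /F /=; case: eqP => [->//|_]; case: eqP => [->|].
move=> ->; rewrite (bigD1 (Ordinal im))//= (bigD1 (Ordinal jm))/=; last first.
  by apply/eqP => -[] /esym/eqP; rewrite (negbTE ij).
rewrite big1 => [|k /andP[ki kj]].
  by rewrite mule1 Fi Fj.
rewrite /F ifN; last by apply: contra ki => /eqP ki; apply/eqP/val_inj.
rewrite ifN; last by apply: contra kj => /eqP kj; apply/eqP/val_inj.
by rewrite preimage_setT probability_setT.
Qed.

Section one_sample.
Variables (X : Omega -> Xi).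
Hypothesis (lX : has_law X).

Let mX : measurable_fun setT X. Proof. by case: lX. Qed.
Let X' : {mfun Omega >-> Xi} := mfun_Sub (mem_set mX).

Let law_distribution A : measurable A -> distribution Pr X' A = law A.
Proof. by case: lX => _ + mA; apply. Qed.

Lemma ge0_integral_law (f : Xi -> \bar R) : measurable_fun setT f ->
  (forall s, 0 <= f s)%E -> (\int[Pr]_w f (X w) = \int[law]_s f s)%E.
Proof.
move=> mf f0.
transitivity (\int[distribution Pr X']_s f s)%E.
  by rewrite /distribution ge0_integral_pushforward.
by apply: eq_measure_integral => A mA _; exact: law_distribution.
Qed.

Lemma integrable_law (f : Xi -> R) : law.-integrable setT (EFin \o f) ->
  Pr.-integrable setT (EFin \o (f \o X)).
Proof.
move=> /integrableP[mf fy]; apply/integrableP; split.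
  exact: measurableT_comp mf mX.
rewrite (ge0_integral_law (f := fun s => `|(EFin \o f) s|%E))//.
exact: measurableT_comp.
Qed.

Lemma Rintegral_law (f : Xi -> R) : law.-integrable setT (EFin \o f) ->
  \int[Pr]_w f (X w) = \int[law]_s f s.
Proof.
move=> i_f; have i_fX := integrable_law i_f; congr fine.
transitivity (\int[distribution Pr X']_s (f s)%:E)%E.
  rewrite /distribution integral_pushforward//.
  by case/integrableP: i_f.
by apply: eq_measure_integral => A mA _; exact: law_distribution.
Qed.

Lemma sqint_law (f : Xi -> R) : sqint law f -> sqint Pr (f \o X).
Proof.
by move=> [mf i_f]; split; [exact: measurableT_comp|exact: integrable_law i_f].
Qed.

End one_sample.

Lemma uncorrelated_samples X Y (f g : Xi -> R) : has_law X -> has_law Y ->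
  pair_indep X Y -> sqint law f -> sqint law g -> \int[law]_s f s = 0 ->
  \int[Pr]_w (f (X w) * g (Y w)) = 0.
Proof.
move=> lX lY XY sf sg f0.
have sfX := sqint_law lX sf; have sgY := sqint_law lY sg.
have i_f := sqint_integrable sf.
suff h : (\int[Pr]_w (f (X w) * g (Y w))%:E = 0)%E by rewrite /Rintegral h.
apply: integral_indep_mul0 => //.
- by case: lX.
- by case: lY.
- by case: sf.
- by case: sg.
- exact: sqint_integrable sfX.
- exact: sqint_mul sfX sgY.
- have := EFin_Rintegral (sqint_integrable sfX); rewrite /= => <-.
  by rewrite (Rintegral_law lX)// f0.
Qed.

Definition batch_avg m (X : nat -> Omega -> Xi) (f : Xi -> R) (w : Omega) : R :=
  m%:R^-1 * \sum_(i < m) f (X i w).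

Lemma batch_avg_moments m X f : (0 < m)%N -> iid_batch Pr law m X ->
  sqint law f -> \int[law]_s f s = 0 ->
  [/\ sqint Pr (batch_avg m X f), \int[Pr]_w batch_avg m X f w = 0 &
      \int[Pr]_w (batch_avg m X f w ^+ 2) = m%:R^-1 * \int[law]_s (f s ^+ 2)].
Proof.
move=> m0 iid sf f0.
have sF i : (i < m)%N -> sqint Pr (f \o X i).
  by move=> im; apply: sqint_law => //; exact: iid_has_law iid im.
have [|sS SE] := @Rintegral_sqr_uncorrelated _ _ _ Pr m (fun i => f \o X i) sF.
  move=> i j im jm ij; apply: uncorrelated_samples => //.
  - exact: iid_has_law iid im.
  - exact: iid_has_law iid jm.
  - exact: iid_pair_indep iid im jm ij.
have E0 : \int[Pr]_w (\sum_(i < m) f (X i w)) = 0.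
  rewrite Rintegral_sum => [|i]; last exact: sqint_integrable (sF i (ltn_ord i)).
  rewrite big1// => i _.
  by rewrite (Rintegral_law (iid_has_law iid (ltn_ord i)))//; exact: sqint_integrable.
split; first exact: sqintZ.
- by rewrite RintegralZl// ?E0 ?mulr0//; exact: sqint_integrable.
rewrite Rintegral_sqrZ// SE (eq_bigr (fun=> \int[law]_s (f s ^+ 2))); last first.
  move=> i _; rewrite (Rintegral_law (iid_has_law iid (ltn_ord i)) (f := fun s => f s ^+ 2))//.
  by case: sf.
rewrite sumr_const card_ord -[(\int[_]_s _) *+ m]mulr_natl expr2 -mulrA mulKf//.
by rewrite pnatr_eq0 -lt0n.
Qed.

Lemma batch_avg_uncorrelated m1 m2 X Y f g : (0 < m1)%N -> (0 < m2)%N ->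
  iid_batch Pr law m1 X -> iid_batch Pr law m2 Y ->
  (forall i j, (i < m1)%N -> (j < m2)%N -> pair_indep (X i) (Y j)) ->
  sqint law f -> sqint law g -> \int[law]_s f s = 0 ->
  \int[Pr]_w (batch_avg m1 X f w * batch_avg m2 Y g w) = 0.
Proof.
move=> m10 m20 iX iY XY sf sg f0.
have sX (i : 'I_m1) : sqint Pr (f \o X i) by exact: (sqint_law (iid_has_law iX (ltn_ord i)) sf).
have sY (i : 'I_m2) : sqint Pr (g \o Y i) by exact: (sqint_law (iid_has_law iY (ltn_ord i)) sg).
pose F (c : 'I_m1 * 'I_m2) w := f (X c.1 w) * g (Y c.2 w).
have iF c : Pr.-integrable setT (EFin \o F c) by exact: sqint_mul (sX _) (sY _).
have -> : (fun w => batch_avg m1 X f w * batch_avg m2 Y g w) =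
    (fun w => m1%:R^-1 * m2%:R^-1 * \sum_(c : 'I_m1 * 'I_m2) F c w).
  apply/funext => w; rewrite /batch_avg mulrACA; congr (_ * _).
  rewrite mulr_suml -(pair_bigA _ (fun (i : 'I_m1) (j : 'I_m2) => f (X i w) * g (Y j w)))/=.
  by apply: eq_bigr => i _; rewrite mulr_sumr.
have S0 : \int[Pr]_w (\sum_(c : 'I_m1 * 'I_m2) F c w) = 0.
  rewrite Rintegral_sum// big1// => -[i j] _.
  exact: (uncorrelated_samples (iid_has_law iX (ltn_ord i))
    (iid_has_law iY (ltn_ord j)) (XY _ _ (ltn_ord i) (ltn_ord j)) sf sg f0).
rewrite RintegralZl ?S0 ?mulr0//.
exact: integrable_sumr.
Qed.

(** One step of the hybrid recursion for a fixed coordinate and a fixed past: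
    the old error is damped by [beta], and the two centered averages add their
    variances if the batches are independent, at most twice that otherwise. *)
Lemma hybrid_step_moment m1 m2 X Y f g (kap beta a : R) :
  (0 < m1)%N -> (0 < m2)%N ->
  iid_batch Pr law m1 X -> iid_batch Pr law m2 Y ->
  kap = 2 \/ kap = 1 /\
    (forall i j, (i < m1)%N -> (j < m2)%N -> pair_indep (X i) (Y j)) ->
  sqint law f -> sqint law g -> \int[law]_s f s = 0 -> \int[law]_s g s = 0 ->
  let e w := beta * a + beta * batch_avg m1 X f w + (1 - beta) * batch_avg m2 Y g w in
  sqint Pr e /\ \int[Pr]_w (e w ^+ 2) <= beta ^+ 2 * a ^+ 2 +
    kap * (beta ^+ 2 / m1%:R * \int[law]_s (f s ^+ 2)
           + (1 - beta) ^+ 2 / m2%:R * \int[law]_s (g s ^+ 2)).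
Proof.
move=> m10 m20 iX iY hkap sf sg f0 g0 e.
have [sU U0 U2] := batch_avg_moments m10 iX sf f0.
have [sV V0 V2] := batch_avg_moments m20 iY sg g0.
set U := batch_avg m1 X f in sU U0 U2; set V := batch_avg m2 Y g in sV V0 V2.
have sbU := sqintZ beta sU; have sbV := sqintZ (1 - beta) sV.
have sW := sqintD sbU sbV; have sa := sqint_cst Pr (beta * a).
have eE : e = fun w => beta * a + (beta * U w + (1 - beta) * V w).
  by apply/funext => w; rewrite /e addrA.
have W0 : \int[Pr]_w (beta * a * (beta * U w + (1 - beta) * V w)) = 0.
  have iW := sqint_integrable sW; have iU := sqint_integrable sU.
  have iV := sqint_integrable sV; have ibU := sqint_integrable sbU.
  have ibV := sqint_integrable sbV.
  rewrite RintegralZl// RintegralD//.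
  rewrite (RintegralZl beta measurableT iU) (RintegralZl (1 - beta) measurableT iV).
  by rewrite U0 V0 !mulr0 addr0 mulr0.
have W2 : \int[Pr]_w ((beta * U w + (1 - beta) * V w) ^+ 2) <=
    kap * (beta ^+ 2 * \int[Pr]_w (U w ^+ 2) + (1 - beta) ^+ 2 * \int[Pr]_w (V w ^+ 2)).
  rewrite -!Rintegral_sqrZ// Rintegral_sqrD//.
  case: hkap => [->|[-> XY]].
    have := Rintegral_sqr_ge0 Pr (fun w => beta * U w + (- 1) * ((1 - beta) * V w)).
    rewrite Rintegral_sqrD//; last exact: sqintZ.
    rewrite (Rintegral_sqrZ (- 1))// sqrrN expr1n mul1r.
    under [X in 2 * X]eq_Rintegral do rewrite mulrCA.
    rewrite RintegralZl//; last exact: sqint_mul sbU sbV.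
    set A := \int[Pr]_w _; set B := \int[Pr]_w _; set C := \int[Pr]_w _; lra.
  have -> : \int[Pr]_w (beta * U w * ((1 - beta) * V w)) = 0.
    under eq_Rintegral do rewrite mulrACA.
    rewrite RintegralZl//; last exact: sqint_mul sU sV.
    by rewrite (batch_avg_uncorrelated m10 m20 iX iY XY sf sg f0) mulr0.
  by rewrite mulr0 addr0 mul1r.
split; first by rewrite eE; exact: sqintD sa sW.
rewrite eE Rintegral_sqrD// W0 mulr0 addr0 Rintegral_cst1 exprMn lerD2l.
by move: W2; rewrite U2 V2 !mulrA.
Qed.

End batches.

(** * A mean value inequality for curves *)

Section derivative_bound.
Context {R : realType}.
Notation mu := lebesgue_measure.

(** The increment of a curve is at most the integral of any measurable pointwise
    bound on its speed, even if the derivative is not integrable in any stronger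
    sense.  The speed is replaced by a slightly larger function [u] that is bounded
    below near each point by the speed at that point; the inequality then
    propagates from 0 to 1 by continuous induction. *)
Lemma increment_le_integral k l (h : R -> 'M[R]_(k, l)) (a : R -> R) :
  measurable_fun setT a -> (forall t, 0 <= a t) ->
  (forall t, 0 <= t <= 1 -> forall e, 0 < e -> exists2 r, 0 < r &
     forall s, 0 <= s <= 1 -> `|s - t| < r ->
       frob (h s - h t) <= (a t + e) * `|s - t|) ->
  ((frob (h 1 - h 0))%:E <= \int[mu]_(t in `[0%R, 1%R]) (a t)%:E)%E.
Proof.
move=> ma a0 speed; apply/lee_addgt0Pr => e3 e30.
pose e := e3 / 3; have e0 : 0 < e by rewrite /e divr_gt0.
(* The level sets of a, on which a is nearly constant, are enclosed in open sets
   of slightly larger measure. *)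
pose A k := `[0%R, 1%R] `&` a @^-1` `[k%:R * e, k.+1%:R * e[.
have mA j : measurable (A j).
  apply: measurableI; first exact: measurable_itv.
  by rewrite -[X in measurable X]setTI; apply: ma => //; exact: measurable_itv.
pose ek j : R := (j.+2%:R)^-1 * (2 ^ j.+1)%:R^-1.
have ek0 j : 0 < ek j by rewrite mulr_gt0// invr_gt0 ltr0n// expn_gt0.
have cover j : exists U : set R, [/\ open U, A j `<=` U & (mu (U `\` A j) < (ek j)%:E)%E].
  apply: lebesgue_regularity_outer => //.
  apply: (@le_lt_trans _ _ (mu (`[0%R, 1%R] : set R))).
    apply: le_measure; rewrite ?inE; last exact: subIsetl.
      exact: mA.
    exact: measurable_itv.
  by rewrite lebesgue_measure_itv /= lte_fin ltr01 -EFinB ltry.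
have {cover}[U hU] := choice cover.
have mU j : measurable (U j) by case: (hU j) => /open_measurable.
pose B j := U j `\` A j.
have mB j : measurable (B j) by exact: measurableD.
have mI j D : measurable_fun D (fun x => (\1_(B j) x : R)%:E).
  by apply: measurable_funTS; apply/measurable_EFinP; exact: measurable_indic.
(* The excess of U j over A j is charged with an upper bound of a on A j; the
   integral of the charge is at most e / 2 ^ j.+1. *)
pose v j (x : R) : \bar R := ((j.+2%:R * e)%:E * (\1_(B j) x)%:E)%E.
have v0 j x : (0 <= v j x)%E.
  by rewrite mule_ge0// lee_fin// mulr_ge0// ltW.
have mv j D : measurable_fun D (v j).
  by apply: measurable_funeM; exact: mI.
pose u x : \bar R := ((a x + 2 * e)%:E + \sum_(0 <= j <oo) v j x)%E.
have V0 x : (0 <= \sum_(0 <= j <oo) v j x)%E by apply: nneseries_ge0.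
have u0 x : (0 <= u x)%E.
  by rewrite adde_ge0// lee_fin addr_ge0// mulr_ge0// ltW.
have mV D : measurable_fun D (fun x => \sum_(0 <= j <oo) v j x)%E.
  by apply: measurable_funTS; apply: ge0_emeasurable_sum.
have mae D : measurable_fun D (fun x => (a x + 2 * e)%:E).
  by apply: measurable_funTS; apply/measurable_EFinP; apply: measurable_funD.
have mu_u D : measurable_fun D u by apply: emeasurable_funD.
have u_near j x : U j x -> 0 <= x <= 1 -> ((j.+2%:R * e)%:E <= u x)%E.
  move=> Ux x01; have [Ax|nAx] := pselect (A j x).
    rewrite /u -[X in (X <= _)%E]adde0 leeD// lee_fin.
    by case: Ax => _ /=; rewrite in_itv /= => /andP[le _]; rewrite -addn2 natrD; lra.
  rewrite /u (@nneseriesD1 _ _ j xpredT)//.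
  apply: (@le_trans _ _ (v j x)).
    by rewrite /v indicE mem_set ?mule1.
  rewrite addeCA leeDl// adde_ge0//; last exact: nneseries_ge0.
  by rewrite lee_fin addr_ge0// mulr_ge0// ltW.
have u_total : (\int[mu]_(t in `[0%R, 1%R]) u t <=
    \int[mu]_(t in `[0%R, 1%R]) (a t)%:E + e3%:E)%E.
  rewrite /u ge0_integralD; [|exact: measurable_itv| |exact: mae| |exact: mV]; last 2 first.
  - by move=> x _; rewrite lee_fin addr_ge0// mulr_ge0// ltW.
  - by move=> x _; exact: V0.
  under [X in (X + _)%E]eq_integral do rewrite EFinD.
  rewrite ge0_integralD; [|exact: measurable_itv| | | |exact: measurable_cst];
    last 3 first.
  - by move=> x _; rewrite lee_fin.
  - by apply: measurable_funTS; apply/measurable_EFinP.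
  - by move=> x _; rewrite lee_fin mulr_ge0// ltW.
  rewrite -addeA leeD2l// integral_cst//= lebesgue_measure_itv /= lte_fin ltr01.
  rewrite sube0 mule1.
  have -> : e3%:E = ((2 * e)%:E + e%:E)%E by rewrite -EFinD /e; congr EFin; field.
  rewrite leeD2l// integral_nneseries; [|exact: measurable_itv|
    by move=> j; exact: mv|by move=> j x _; exact: v0].
  apply: le_trans (epsilon_trick0 xpredT (ltW e0)).
  apply: lee_nneseries => [j _ _|j _]; first exact: integral_ge0.
  rewrite /v ge0_integralZl_EFin; [|exact: measurable_itv| | |]; last 3 first.
  - by move=> x _; rewrite lee_fin.
  - exact: mI.
  - by rewrite mulr_ge0// ltW.
  rewrite integral_indic; [|exact: measurable_itv|exact: mB].
  apply: (@le_trans _ _ ((j.+2%:R * e)%:E * (ek j)%:E)%E).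
    rewrite lee_pmul2l//; last by rewrite lte_fin mulr_gt0.
    apply: (@le_trans _ _ (mu (B j))).
      apply: le_measure; rewrite ?inE; last exact: subIsetl.
        by apply: measurableI; [exact: mB|exact: measurable_itv].
      exact: mB.
    by apply: ltW; case: (hU j).
  by rewrite -EFinM lee_fin /ek mulrACA divff// mul1r.
pose W t := (\int[mu]_(x in `[0%R, t]) u x)%E.
have W_incr s t j : 0 <= s -> s <= t -> t <= 1 ->
    (forall x, s < x <= t -> U j x) -> (W s + (j.+2%:R * e * (t - s))%:E <= W t)%E.
  move=> s0 st t1 inU.
  have -> : W t = (W s + \int[mu]_(x in `]s, t]) u x)%E.
    transitivity (\int[mu]_(x in `[0%R, s] `|` `]s, t]) u x)%E.
      by rewrite -itv_bndbnd_setU// bnd_simp.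
    apply: ge0_integral_setU; [exact: measurable_itv|exact: measurable_itv|
      exact: mu_u|by move=> x _; exact: u0|].
    apply/disj_setPRL => x /=; rewrite !in_itv /= => /andP[sx _].
    by apply/negP; rewrite negb_and -!ltNge sx orbT.
  rewrite leeD2l//.
  have -> : (j.+2%:R * e * (t - s))%:E = (\int[mu]_(x in `]s, t]) (j.+2%:R * e)%:E)%E.
    rewrite integral_cst//= lebesgue_measure_itv /= lte_fin -EFinB.
    case: ltP => // ts; have -> : t = s by apply/le_anti; rewrite st ts.
    by rewrite subrr mulr0 mule0.
  apply: ge0_le_integral; [exact: measurable_itv| |exact: measurable_cst|
    exact: mu_u|].
  - by move=> x _; rewrite lee_fin mulr_ge0// ltW.
  - move=> x /=; rewrite in_itv /= => /andP[sx xt]; apply: u_near (inU _ _) _.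
      by rewrite sx.
    by rewrite (le_trans s0 (ltW sx)) (le_trans xt).
pose good t := ((frob (h t - h 0))%:E <= W t)%E.
suff good1 : good 1 by exact: (le_trans good1 u_total).
have local_step t : 0 <= t <= 1 -> exists2 r, 0 < r &
    exists c, (forall s, 0 <= s <= 1 -> `|s - t| < r -> frob (h s - h t) <= c * `|s - t|)
    /\ forall s s', 0 <= s -> s <= s' -> s' <= 1 -> t - r < s -> s' < t + r ->
      (W s + (c * (s' - s))%:E <= W s')%E.
  move=> t01; pose j := Num.trunc (a t / e).
  have /andP[j1 j2] : j%:R * e <= a t < j.+1%:R * e.
    by rewrite -ler_pdivlMr// -ltr_pdivrMr//; apply: truncn_itv; rewrite divr_ge0// ltW.
  have Atj : A j t by split=> /=; rewrite in_itv /= ?t01// j1 j2.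
  have [oU AU _] := hU j.
  have [r1 /= r10 ball_U] : nbhs_ball t (U j).
    by apply/nbhs_ballP; apply: open_nbhs_nbhs; split=> //; exact: AU.
  have [r2 r20 hr2] := speed _ t01 _ e0.
  exists (Num.min r1 r2); first by rewrite lt_min r10.
  exists (j.+2%:R * e); split=> [s s01|s s' s0 ss' s'1 ts s't].
    rewrite lt_min => /andP[_ /(hr2 _ s01)/le_trans]; apply; rewrite ler_wpM2r//.
    by rewrite -(addn1 j.+1) natrD mulrDl mul1r lerD2r ltW.
  apply: W_incr => // x /andP[sx xs']; apply: ball_U; rewrite -ball_normE /=.
  have le1 : Num.min r1 r2 <= r1 by rewrite ge_min lexx.
  by rewrite ltr_norml; apply/andP; split; lra.
apply: contrapT => ngood1.
(* Continuous induction: the infimum of the bad times is good, and so are the times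
   just after it. *)
pose S := [set t | 0 <= t <= 1 /\ ~ good t].
have S1 : S 1 by split=> //; rewrite ler01 lexx.
have Sinf : has_inf S.
  by split; [exists 1|exists 0 => t [/andP[]]].
pose c := inf S.
have c0 : 0 <= c by apply: lb_le_inf; [exists 1|move=> t [/andP[]]].
have c1 : c <= 1 by apply: ge_inf => //; case: Sinf.
have c01 : 0 <= c <= 1 by rewrite c0.
have good_lt t : 0 <= t -> t < c -> good t.
  move=> t0 tc; apply: contrapT => ng.
  have : c <= t.
    by apply: ge_inf; [case: Sinf|split=> //; rewrite t0 (le_trans (ltW tc))].
  by rewrite leNgt tc.
have [r r0 [m [hm Wm]]] := local_step _ c01.
have good_c : good c.
  have [->|cn0] := eqVneq c 0.
    by rewrite /good subrr frob0; exact: integral_ge0.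
  pose s := Num.max 0 (c - r / 2).
  have sc : s < c by rewrite /s gt_max lt_def cn0 c0 /=; lra.
  have s0 : 0 <= s by rewrite /s le_max lexx.
  have s1 : 0 <= s <= 1 by rewrite s0 (le_trans (ltW sc)).
  have rs : c - r < s by rewrite /s lt_max; apply/orP; right; lra.
  have := hm _ s1; rewrite ltr0_norm ?subr_lt0// => hcs.
  have {}hcs := hcs ltac:(lra).
  apply: le_trans (Wm _ _ s0 (ltW sc) c1 rs _); last by lra.
  apply: (@le_trans _ _ ((frob (h s - h 0))%:E + (m * (c - s))%:E)%E).
    rewrite -EFinD lee_fin.
    have -> : h c - h 0 = (h s - h 0) - (h s - h c) by rewrite opprB [RHS]addrC subrKA.
    by rewrite (le_trans (frobB_le _ _))// lerD2l (le_trans hcs)// opprB.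
  by rewrite leeD2r//; exact: good_lt.
have : c + r <= c.
  apply: lb_le_inf; first by exists 1.
  move=> t [t01 nt]; rewrite leNgt; apply/negP => tr.
  have ct : c <= t by apply: ge_inf; [case: Sinf|split].
  apply: nt.
  have t1 : t <= 1 by case/andP: t01.
  have := hm _ t01; rewrite ger0_norm ?subr_ge0// => hct.
  have {}hct := hct ltac:(lra).
  have cr : c - r < c by lra.
  apply: le_trans (Wm _ _ c0 ct t1 cr tr).
  apply: (@le_trans _ _ ((frob (h c - h 0))%:E + (m * (t - c))%:E)%E).
    rewrite -EFinD lee_fin -[h t - h 0](subrKA (h c)).
    by rewrite (le_trans (frobD_le _ _))// [leLHS]addrC lerD2l.
  exact: leeD2r.
lra.
Qed.

End derivative_bound.

(** * The objective and its smoothing *)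

Section objective.
Context {R : realType} {dX : measure_display} {Xi : measurableType dX}.
Context {p q n : nat}.
Variables (pb : problem R Xi p q n) (cs : constants R) (d : 'cV[R]_n -> R).
Hypotheses (Hpb : standing_assumptions pb cs) (Hd : smoothing_function pb d).

Lemma regNy x : (-oo < reg pb x)%E.
Proof. by case: (reg_proper Hpb) => + _; exact. Qed.

Lemma B_psi_ge y : dom (psi pb) y -> d y <= B_psi pb d.
Proof.
move=> hy; apply: sup_upper_bound; last by exists y.
by split; [exists (d y), y|exact: (sm_bounded Hd)].
Qed.

Lemma B_psi_ge0 : 0 <= B_psi pb d.
Proof. by case: (sm_min0 Hd) => y hy dy0; rewrite -dy0 B_psi_ge. Qed.

(** The penalty [gamma * d] lies between 0 and [gamma * B_psi] on the domain of
    [psi], and so does the loss it causes in the supremum. *)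
Lemma phi0_bounds gamma u : 0 < gamma ->
  exists r, [/\ phi0 pb u = r%:E, phi_smooth pb d gamma u <= r &
    r <= phi_smooth pb d gamma u + gamma * B_psi pb d].
Proof.
move=> gamma0; have [hy _] := ystarP Hpb Hd gamma0 u.
have lin y : dot ((Kmx pb)^T *m u) y = dot u (Kmx pb *m y).
  by rewrite !dotE mdot_mulmx.
have le : (phi0 pb u <= (phi_smooth pb d gamma u + gamma * B_psi pb d)%:E)%E.
  apply: ge_ereal_sup => _ [z _ <-]; rewrite lin.
  have [hz|] := pselect (dom (psi pb) z); last first.
    by move=> /negP; rewrite -leNgt leye_eq => /eqP ->; rewrite leNye.
  rewrite (psi_fine Hpb hz) -EFinB lee_fin.
  have := smooth_val_le Hpb Hd gamma0 u hz; rewrite /smooth_val.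
  have := B_psi_ge hz; rewrite -(ler_pM2l gamma0); lra.
have ge : ((phi_smooth pb d gamma u)%:E <= phi0 pb u)%E.
  rewrite (phi_smoothE Hpb Hd gamma0); set y := ystar _ _ _ _ in hy *.
  apply: (@le_trans _ _ ((dot ((Kmx pb)^T *m u) y)%:E - psi pb y)%E).
    rewrite lin (psi_fine Hpb hy) -EFinB lee_fin /smooth_val gerBl.
    by rewrite mulr_ge0 ?(sm_ge0 Hd)// ltW.
  by apply: ereal_sup_ubound; exists y.
have fin : phi0 pb u \is a fin_num.
  by rewrite fin_numElt (lt_le_trans _ ge) ?ltNyr// (le_lt_trans le) ?ltry.
have phiE := fineK fin; rewrite -phiE !lee_fin in ge le.
by exists (fine (phi0 pb u)).
Qed.

Lemma dom_Psi0 x : dom (Psi0 pb) x <-> dom (reg pb) x.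
Proof.
have [r [phiE _ _]] := phi0_bounds (Fmean pb x) ltr01.
rewrite /dom /Psi0 /= phiE; split=> [|hx].
  by apply: contraTT; rewrite -!leNgt !leye_eq => /eqP ->.
by rewrite (fine_of_dom regNy hx) -EFinD ltry.
Qed.

Lemma dom_Psi0_convex x y t : dom (Psi0 pb) x -> dom (Psi0 pb) y -> 0 <= t <= 1 ->
  dom (Psi0 pb) (t *: x + (1 - t) *: y).
Proof.
move=> /dom_Psi0 hx /dom_Psi0 hy t01; apply/dom_Psi0.
by have [] := convex_fun_dom regNy (reg_convex Hpb) hx hy t01.
Qed.

Definition Psi_smooth gamma x := Phi pb d gamma x + fine (reg pb x).

Lemma Psi_smooth_bounds gamma x : 0 < gamma -> dom (Psi0 pb) x ->
  [/\ Psi0 pb x \is a fin_num, Psi_smooth gamma x <= fine (Psi0 pb x) &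
      fine (Psi0 pb x) <= Psi_smooth gamma x + gamma * B_psi pb d].
Proof.
move=> gamma0 /dom_Psi0 hx.
have [r [phiE le1 le2]] := phi0_bounds (Fmean pb x) gamma0.
rewrite /Psi0 phiE (fine_of_dom regNy hx) -EFinD /Psi_smooth /Phi /=.
by split=> //; lra.
Qed.

Lemma Psi0_star_le x : dom (Psi0 pb) x ->
  Psi0_star pb \is a fin_num /\ fine (Psi0_star pb) <= fine (Psi0 pb x).
Proof.
move=> hx; have [fx _ _] := Psi_smooth_bounds ltr01 hx.
have le : (Psi0_star pb <= Psi0 pb x)%E by apply: ereal_inf_lbound; exists x.
have fs : Psi0_star pb \is a fin_num.
  by rewrite fin_numElt (Psi0_bounded Hpb) (le_lt_trans le).
by split=> //; apply: fine_le.
Qed.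

End objective.

Lemma continuous_entry (R : realType) (U : topologicalType) k l
    (F : U -> 'M[R]_(k, l)) i j : continuous F -> continuous (fun z => F z i j).
Proof.
move=> cF z; apply: (@continuous_comp _ _ _ F (fun M : 'M[R]_(k, l) => M i j)).
  exact: cF.
exact: coord_continuous.
Qed.

Lemma expectationE (R : realType) d (T : measurableType d) (P : probability T R)
  (f : T -> R) : ('E_P[f] = \int[P]_w (f w)%:E)%E.
Proof. by rewrite unlock. Qed.

(** * Random points and mean square increments *)

Section jacobian_measurability.
Context {R : realType} {d : measure_display} {T : measurableType d}.

(** The entries of the Jacobian are limits of difference quotients, each of which is
    measurable as a composite with a continuous function. *)
Lemma measurable_jac_comp k l (f : 'cV[R]_k -> T -> 'cV[R]_l) (x : T -> 'cV[R]_k) :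
  measurable_mx x -> (forall z, measurable_mx (f z)) ->
  (forall w z, differentiable (f ^~ w) z) ->
  measurable_mx (fun w => jac (f ^~ w) (x w)).
Proof.
move=> mx mf df i j.
have mfx (v : 'cV[R]_k) : measurable_fun setT (fun w => f (x w + v) w i 0).
  apply: (@measurable_comp_continuous _ _ _ _ x (fun z w => f (z + v) w i 0)) => //.
  - by move=> z; exact: mf.
  - move=> w; have cF : continuous (fun z : 'cV[R]_k => f (z + v) w).
      move=> z; apply: (@continuous_comp _ _ _ (fun z : 'cV[R]_k => z + v) (f ^~ w)).
        apply: (@frob_lipschitz_continuous _ _ _ _ 1) => // z1 z2.
        by rewrite opprD addrACA subrr addr0 mul1r norm_le_frob.
      exact/differentiable_continuous/df.
    exact: continuous_entry cF.
pose e (m : nat) : R := m.+1%:R^-1.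
apply: (@measurable_realfun.measurable_fun_cvg _ _ _ _ (fun m w =>
  (e m)^-1 * (f (x w + e m *: delta_mx j 0) w i 0 - f (x w + 0) w i 0))) => [m|w _].
  by apply: measurable_funM => //; apply: measurable_funB; exact: mfx.
apply/cvgrPdist_le => eps eps0.
have [r r0 hr] := jac_taylor (df w (x w)) eps0.
near=> m.
have e0 : 0 < e m by rewrite invr_gt0.
have er : e m < r by near: m; exact: near_infty_natSinv_lt (PosNum r0).
have fd : frob (e m *: (delta_mx j 0 : 'cV[R]_k)) = e m.
  rewrite frobZ gtr0_norm// [X in _ * X](_ : _ = 1) ?mulr1//.
  apply/eqP; rewrite -(@eqrXn2 _ 2) ?frob_ge0// expr1n frob_col2_sum.
  rewrite (bigD1 j)//= big1 => [|i' /negbTE ij].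
    by rewrite mxE !eqxx expr1n addr0.
  by rewrite mxE ij /= expr0n.
have := hr (e m *: delta_mx j 0); rewrite fd => /(_ er) le.
have := le_trans (entry_le_frob _ i 0) le.
rewrite addr0; have -> : jac (f ^~ w) (x w) *m (e m *: (delta_mx j 0 : 'cV[R]_k)) =
    e m *: col j (jac (f ^~ w) (x w)).
  by rewrite -scalemxAr colE.
rewrite !mxE => le'.
rewrite -(ler_pM2l e0) -{1}(gtr0_norm e0) -normrM mulrBr mulrA divff ?gt_eqF// mul1r.
by rewrite distrC [leRHS]mulrC.
Unshelve. all: by end_near. Qed.

End jacobian_measurability.

Section quadratic_mean.
Context {R : realType} {dX : measure_display} {Xi : measurableType dX}.
Context {p q n : nat}.
Variables (pb : problem R Xi p q n) (cs : constants R) (d : 'cV[R]_n -> R).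
Hypotheses (Hpb : standing_assumptions pb cs) (Hd : smoothing_function pb d).

Lemma measurable_FF x : measurable_mx (FF pb x).
Proof.
move=> i j; rewrite (ord1 j); apply/measurable_EFinP.
by case/integrableP: (FF_integrable Hpb x i).
Qed.

Lemma FF_continuous s : continuous (FF pb ^~ s).
Proof. by move=> x; exact/differentiable_continuous/(FF_differentiable Hpb). Qed.

Lemma Fmean_continuous : continuous (Fmean pb).
Proof. by move=> x; exact/differentiable_continuous/(Fmean_differentiable Hpb). Qed.

Section compositions.
Context {dT : measure_display} {T : measurableType dT}.
Variables (x : T -> 'cV[R]_p) (s : T -> Xi).
Hypotheses (mx : measurable_mx x) (ms : measurable_fun setT s).

Lemma measurable_FF_comp : measurable_mx (fun w => FF pb (x w) (s w)).
Proof.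
move=> i j; apply: (@measurable_comp_continuous _ _ _ _ x
  (fun z w => FF pb z (s w) i j)) => //.
- by move=> z; exact: (measurableT_comp (measurable_FF z i j) ms).
- by move=> w; exact: continuous_entry (@FF_continuous (s w)).
Qed.

Lemma measurable_JF_comp : measurable_mx (fun w => JF pb (x w) (s w)).
Proof.
apply: (measurable_jac_comp (f := fun z w => FF pb z (s w))) => //.
- by move=> z i j; exact: (measurableT_comp (measurable_FF z i j) ms).
- by move=> w z; exact: FF_differentiable Hpb _ _.
Qed.

Lemma measurable_Fmean_comp : measurable_mx (fun w => Fmean pb (x w)).
Proof.
move=> i j; apply: (@measurable_comp_continuous _ _ _ _ x
  (fun z _ => Fmean pb z i j)) => // w.
exact: continuous_entry Fmean_continuous.
Qed.

Lemma measurable_jac_Fmean_comp : measurable_mx (fun w => jac (Fmean pb) (x w)).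
Proof.
apply: (measurable_jac_comp (f := fun z _ => Fmean pb z)) => //.
  by move=> z i j; exact: measurable_cst.
by move=> w z; exact: (Fmean_differentiable Hpb).
Qed.

End compositions.

Lemma measurable_frob2 {dT} {T : measurableType dT} k l (A : T -> 'M[R]_(k, l)) :
  measurable_mx A -> measurable_fun setT (fun w => frob (A w) ^+ 2).
Proof.
move=> mA; under eq_fun do rewrite frob2_sum.
by apply: measurable_sum => c; apply: measurable_funX; exact: mA.
Qed.

Lemma measurable_mulmx_cst {dT} {T : measurableType dT} k l m
    (A : T -> 'M[R]_(k, l)) (B : 'M[R]_(l, m)) :
  measurable_mx A -> measurable_mx (fun w => A w *m B).
Proof.
move=> mA i j; under eq_fun do rewrite mxE.
by apply: measurable_sum => c; apply: measurable_funM => //; exact: mA.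
Qed.

Notation mu := lebesgue_measure.

(** Jensen's inequality on the unit interval, with possibly infinite integrals: the
    tangent line of the square at [X] bounds [a] by [a^2 / (2 X) + X / 2]. *)
Lemma sqr_le_integral_sqr (X : R) (a : R -> R) : 0 <= X ->
  measurable_fun setT a -> (forall t, 0 <= a t) ->
  (X%:E <= \int[mu]_(t in `[0%R, 1%R]) (a t)%:E)%E ->
  ((X ^+ 2)%:E <= \int[mu]_(t in `[0%R, 1%R]) (a t ^+ 2)%:E)%E.
Proof.
move=> X0 ma a0 le.
have I0 : (0 <= \int[mu]_(t in `[0%R, 1%R]) (a t ^+ 2)%:E)%E.
  by apply: integral_ge0 => t _; rewrite lee_fin sqr_ge0.
have [->|Xn0] := eqVneq X 0; first by rewrite expr0n.
have {Xn0}X0 : 0 < X by rewrite lt_def Xn0.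
have [->|] := eqVneq (\int[mu]_(t in `[0%R, 1%R]) (a t ^+ 2)%:E)%E +oo%E.
  by rewrite leey.
rewrite -ltey => Ifin.
have : (\int[mu]_(t in `[0%R, 1%R]) (a t ^+ 2)%:E)%E \is a fin_num.
  by rewrite ge0_fin_numE.
have c0 : 0 <= (2 * X)^-1 by rewrite invr_ge0 mulr_ge0// ltW.
have ma2 D : measurable_fun D (fun t => (a t ^+ 2)%:E).
  by apply: measurable_funTS; apply/measurable_EFinP; exact: measurable_funX.
have := le; have : (\int[mu]_(t in `[0%R, 1%R]) (a t)%:E <=
    \int[mu]_(t in `[0%R, 1%R]) ((2 * X)^-1%:E * (a t ^+ 2)%:E + (X / 2)%:E))%E.
  apply: ge0_le_integral; [exact: measurable_itv| | | |].
  - by move=> t _; rewrite lee_fin.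
  - by apply: measurable_funTS; apply/measurable_EFinP.
  - apply: emeasurable_funD; last exact: measurable_cst.
    by apply: measurable_funeM; exact: ma2.
  - move=> t _; rewrite -EFinM -EFinD lee_fin.
    have -> : (2 * X)^-1 * a t ^+ 2 + X / 2 = a t + (2 * X)^-1 * (a t - X) ^+ 2.
      by field; rewrite gt_eqF.
    by rewrite lerDl mulr_ge0// sqr_ge0.
rewrite ge0_integralD; [|exact: measurable_itv| | | |exact: measurable_cst]; last 3 first.
- by move=> t _; rewrite mule_ge0// lee_fin ?sqr_ge0.
- by apply: measurable_funeM; exact: ma2.
- by move=> t _; rewrite lee_fin divr_ge0// ltW.
rewrite ge0_integralZl_EFin; [|exact: measurable_itv| |exact: ma2|exact: c0]; last first.
  by move=> t _; rewrite lee_fin sqr_ge0.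
rewrite integral_cst//= lebesgue_measure_itv /= lte_fin ltr01 sube0 mule1.
move=> l1 l2; have := le_trans l2 l1.
move=> {l1 l2} + Ifn; rewrite -(fineK Ifn) -EFinM -EFinD !lee_fin.
move: (fine _) => I; rewrite -(ler_pM2l X0) mulrDr mulrA.
have -> : X * (2 * X)^-1 = 1 / 2 by field; rewrite gt_eqF.
have -> : X * (X / 2) = X ^+ 2 / 2 by field.
rewrite -expr2; lra.
Qed.

(** The mean square increment of the sampled functions: pathwise, the increment
    along a segment is bounded by the integral of the speed, and Tonelli's theorem
    exchanges that integral with the expectation. *)
Lemma FF_mean_square_lipschitz x y : dom (Psi0 pb) x -> dom (Psi0 pb) y ->
  (\int[law pb]_s (frob (FF pb y s - FF pb x s) ^+ 2)%:E <=
   (M_F cs ^+ 2 * frob (y - x) ^+ 2)%:E)%E.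
Proof.
move=> hx hy; pose v := y - x.
pose z t := x + t *: v.
pose a (t : R) s := frob (JF pb (z t) s *m v).
have mz dT (T : measurableType dT) (t : T -> R) :
    measurable_fun setT t -> measurable_mx (fun w => z (t w)).
  move=> mt i j; under eq_fun do rewrite !mxE.
  by apply: measurable_funD => //; apply: measurable_funM.
have ma2 : measurable_fun setT (fun c : R * Xi => a c.1 c.2 ^+ 2).
  apply: measurable_frob2; apply: measurable_mulmx_cst; apply: measurable_JF_comp.
    by apply: mz; exact: measurable_fst.
  exact: measurable_snd.
have mas s : measurable_fun setT (a ^~ s).
  have -> : a ^~ s = (@Num.sqrt R) \o (fun t => a t s ^+ 2).
    by apply/funext => t; rewrite /= sqrtr_sqr ger0_norm// frob_ge0.
  apply: measurableT_comp; first by apply: continuous_measurable_fun; exact: sqrt_continuous.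
  apply: measurable_frob2; apply: measurable_mulmx_cst; apply: measurable_JF_comp => //.
  by apply: mz; exact: measurable_id.
pose G (c : R * Xi) : \bar R := ((a c.1 c.2 ^+ 2)%:E * (\1_(`[0%R, 1%R]) c.1)%:E)%E.
have G0 c : (0 <= G c)%E by rewrite mule_ge0// lee_fin ?sqr_ge0.
have mG : measurable_fun setT G.
  apply: emeasurable_funM; first exact/measurable_EFinP.
  apply/measurable_EFinP; apply: measurableT_comp; last exact: measurable_fst.
  by apply: measurable_indic; exact: measurable_itv.
have path s : ((frob (FF pb y s - FF pb x s) ^+ 2)%:E <= \int[mu]_t G (t, s))%E.
  have -> : (\int[mu]_t G (t, s) = \int[mu]_(t in `[0%R, 1%R]) (a t s ^+ 2)%:E)%E.
    rewrite [RHS]integral_mkcond; apply: eq_integral => t _.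
    by rewrite epatch_indic.
  apply: sqr_le_integral_sqr; rewrite ?frob_ge0//; first by move=> t; exact: frob_ge0.
  have -> : FF pb y s = FF pb (z 1) s by rewrite /z scale1r /v addrC subrK.
  have -> : FF pb x s = FF pb (z 0) s by rewrite /z scale0r addr0.
  apply: (increment_le_integral (h := fun t => FF pb (z t) s)) => //.
    by move=> t; exact: frob_ge0.
  move=> t t01 e e0.
  have v0 : 0 < frob v + 1 by rewrite ltr_wpDl ?frob_ge0.
  have [r r0 hr] := jac_taylor (FF_differentiable Hpb s (z t)) (divr_gt0 e0 v0).
  exists (r / (frob v + 1)) => [|t' _]; first by rewrite divr_gt0.
  rewrite ltr_pdivlMr// => tt'.
  have zz : z t' = z t + (t' - t) *: v.
    by apply/matrixP => i j; rewrite !mxE; ring.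
  have fv : frob ((t' - t) *: v) = `|t' - t| * frob v by rewrite frobZ.
  have lt : frob ((t' - t) *: v) < r.
    by rewrite fv; apply: le_lt_trans tt'; rewrite ler_wpM2l// lerDl.
  have := hr _ lt; rewrite -zz -scalemxAr => le.
  rewrite -[FF pb (z t') s - _](subrK ((t' - t) *: (JF pb (z t) s *m v))).
  rewrite (le_trans (frobD_le _ _))// (le_trans (lerD le (lexx _)))//.
  rewrite !frobZ -/(a t s) addrC mulrDl lerD//; first by rewrite mulrC.
  rewrite mulrCA mulrC ler_wpM2r// mulrAC ler_pdivrMr// ler_wpM2l ?(ltW e0)//.
  by rewrite lerDl.
apply: (@le_trans _ _ (\int[law pb]_s \int[mu]_t G (t, s))%E).
  apply: ge0_le_integral => //.
  - by move=> s _; rewrite lee_fin sqr_ge0.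
  - apply/measurable_EFinP; apply: measurable_frob2 => i j.
    under eq_fun do rewrite !mxE.
    by apply: measurable_funB; exact: measurable_FF.
  - exact: measurable_fun_fubini_tonelli_G.
rewrite -fubini_tonelli//.
apply: (@le_trans _ _ (\int[mu]_t ((M_F cs ^+ 2 * frob v ^+ 2)%:E
    * (\1_(`[0%R, 1%R]) t)%:E))%E).
  apply: ge0_le_integral => //.
  - by move=> t _; exact: integral_ge0.
  - exact: measurable_fun_fubini_tonelli_F.
  - apply: measurable_funeM; apply/measurable_EFinP; apply: measurable_indic.
    exact: measurable_itv.
  - move=> t _; rewrite [leRHS]muleC /G /=.
    under eq_integral do rewrite muleC.
    rewrite ge0_integralZl_EFin//; last 2 first.
    + by move=> s _; rewrite lee_fin sqr_ge0.
    + apply/measurable_EFinP; apply: measurable_frob2; apply: measurable_mulmx_cst.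
      apply: measurable_JF_comp; last exact: measurable_id.
      by move=> i j; exact: measurable_cst.
    rewrite indicE; have [t01|_] := boolP (t \in _); last by rewrite !mul0e.
    rewrite !mul1e.
    have hz : dom (Psi0 pb) (z t).
      have -> : z t = t *: y + (1 - t) *: x.
        by apply/matrixP => i j; rewrite !mxE; ring.
      apply: (dom_Psi0_convex Hpb Hd) => //.
      by move: t01; rewrite inE /= in_itv.
    have := JF_bounded Hpb hz; rewrite expectationE => JFM.
    have mJF : measurable_fun setT (fun s => (frob (JF pb (z t) s) ^+ 2)%:E).
      apply/measurable_EFinP; apply: measurable_frob2.
      apply: measurable_JF_comp; last exact: measurable_id.
      by move=> i j; exact: measurable_cst.
    apply: (@le_trans _ _ (\int[law pb]_s ((frob v ^+ 2)%:E *
        (frob (JF pb (z t) s) ^+ 2)%:E))%E).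
      apply: ge0_le_integral => //.
      * by move=> s _; rewrite lee_fin sqr_ge0.
      * apply/measurable_EFinP; apply: measurable_frob2.
        apply: measurable_mulmx_cst; apply: measurable_JF_comp.
          by move=> i j; exact: measurable_cst.
        exact: measurable_id.
      * exact: measurable_funeM.
      * move=> s _; rewrite -EFinM lee_fin mulrC -exprMn.
        by rewrite ler_pXn2r ?nnegrE ?mulr_ge0 ?frob_ge0// frob_mulmx.
    rewrite ge0_integralZl_EFin//; last 2 first.
    + by move=> s _; rewrite lee_fin sqr_ge0.
    + by rewrite sqr_ge0.
    rewrite [M_F cs ^+ 2 * _]mulrC (EFinM (frob v ^+ 2)).
    by apply: lee_wpmul2l; [rewrite lee_fin sqr_ge0|exact: JFM].
have mI : measurable_fun setT (fun t : R => (\1_(`[0%R, 1%R]) t : R)%:E).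
  by apply/measurable_EFinP; apply: measurable_indic; exact: measurable_itv.
rewrite ge0_integralZl_EFin//; last by rewrite mulr_ge0 ?sqr_ge0.
rewrite integral_indic; [|exact: measurableT|exact: measurable_itv].
rewrite [X in (_ * X)%E](_ : _ = 1%E) ?mule1//.
rewrite setIT; apply: (etrans (lebesgue_measure_itv `[0%R, 1%R])).
by rewrite /= lte_fin ltr01 sube0.
Qed.

End quadratic_mean.

(** * Smoothness of the smoothed objective and one inexact proximal step *)

Lemma mxBE (R : realType) k l (A B : 'M[R]_(k, l)) i j : (A - B) i j = A i j - B i j.
Proof. by rewrite !mxE. Qed.

Lemma mulmx_tr_diff (R : realType) k l m (A B : 'M[R]_(k, l)) (u w : 'M[R]_(k, m)) :
  A^T *m u - B^T *m w = (A - B)^T *m u + B^T *m (u - w).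
Proof. by rewrite linearB /= mulmxBl mulmxBr addrA subrK. Qed.

Section second_moments.
Context {R : realType} {d : measure_display} {T : measurableType d}.
Variable P : probability T R.

Lemma sqint_entries k l (A : T -> 'M[R]_(k, l)) (c : R) : measurable_mx A ->
  (\int[P]_w (frob (A w) ^+ 2)%:E <= c%:E)%E ->
  (forall i j, sqint P (fun w => A w i j)) /\
  \sum_(e : 'I_k * 'I_l) \int[P]_w (A w e.1 e.2 ^+ 2) <= c.
Proof.
move=> mA le.
have sA i j : sqint P (fun w => A w i j).
  apply: (@sqint_le _ _ _ _ _ c) => //; apply: le_trans le.
  apply: ge0_le_integral => //.
  - by move=> w _; rewrite lee_fin sqr_ge0.
  - by apply/measurable_EFinP; apply: measurable_funX; exact: mA.
  - by apply/measurable_EFinP; exact: measurable_frob2.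
  - move=> w _; rewrite lee_fin -real_normK ?num_real//.
    by rewrite ler_pXn2r ?nnegrE ?frob_ge0// entry_le_frob.
split=> //; rewrite -Rintegral_sum => [|e]; last by case: (sA e.1 e.2).
under eq_Rintegral do rewrite -frob2_sum.
rewrite -lee_fin EFin_Rintegral//.
under [X in EFin \o X]eq_fun do rewrite frob2_sum.
by apply: integrable_sumr => e; case: (sA e.1 e.2).
Qed.

Lemma mean_mxB k l (A B : T -> 'M[R]_(k, l)) (M N : 'M[R]_(k, l)) :
  (forall i j, P.-integrable setT (EFin \o (fun w => A w i j))) ->
  (forall i j, P.-integrable setT (EFin \o (fun w => B w i j))) ->
  (forall i j, M i j = \int[P]_w A w i j) -> (forall i j, N i j = \int[P]_w B w i j) ->
  forall i j, (M - N) i j = \int[P]_w (A w - B w) i j.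
Proof.
move=> iA iB MA NB i j; rewrite mxBE MA NB -RintegralB//.
by apply: eq_Rintegral => w _; rewrite mxBE.
Qed.

(** Jensen's inequality for the mean of a random matrix. *)
Lemma frob_mean_le k l (A : T -> 'M[R]_(k, l)) (M : 'M[R]_(k, l)) (c : R) :
  measurable_mx A -> (forall i j, M i j = \int[P]_w A w i j) ->
  (\int[P]_w (frob (A w) ^+ 2)%:E <= (c ^+ 2)%:E)%E -> 0 <= c -> frob M <= c.
Proof.
move=> mA MA le c0; have [sA sumA] := sqint_entries mA le.
rewrite -(@ler_pXn2r _ 2) ?nnegrE ?frob_ge0// (le_trans _ sumA)// frob2_sum.
by apply: ler_sum => e _; rewrite MA; exact: Rintegral_jensen.
Qed.

End second_moments.

Section smoothness.
Context {R : realType} {dX : measure_display} {Xi : measurableType dX}.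
Context {p q n : nat}.
Variables (pb : problem R Xi p q n) (cs : constants R) (d : 'cV[R]_n -> R).
Hypotheses (Hpb : standing_assumptions pb cs) (Hd : smoothing_function pb d).

Let LF0 : 0 < L_F cs. Proof. by case: (constants_gt0 Hpb). Qed.
Let MF0 : 0 < M_F cs. Proof. by case: (constants_gt0 Hpb). Qed.
Let Mpsi0 : 0 < M_psi cs. Proof. by case: (constants_gt0 Hpb). Qed.
Let K0 : 0 <= spectral (Kmx pb). Proof. exact: spectral_ge0. Qed.

Lemma measurable_JF x : measurable_mx (JF pb x).
Proof.
by apply: (measurable_JF_comp Hpb (x := fun=> x) (s := id)) => //.
Qed.

Lemma measurable_mxB dT (T : measurableType dT) k l (A B : T -> 'M[R]_(k, l)) :
  measurable_mx A -> measurable_mx B -> measurable_mx (fun w => A w - B w).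
Proof.
move=> mA mB i j; under eq_fun do rewrite !mxE.
by apply: measurable_funB; [exact: mA|exact: mB].
Qed.

Lemma measurable_mx_cst dT (T : measurableType dT) k l (A : 'M[R]_(k, l)) :
  measurable_mx (fun _ : T => A).
Proof. by move=> i j; exact: measurable_cst. Qed.

Lemma Fmean_entry x i j : Fmean pb x i j = \int[law pb]_s FF pb x s i j.
Proof. by rewrite mxE expectationE. Qed.

Lemma jac_Fmean_entry x i j : jac (Fmean pb) x i j = \int[law pb]_s JF pb x s i j.
Proof. by rewrite (jac_Fmean Hpb) mxE expectationE. Qed.

Lemma FF_int x i j : (law pb).-integrable setT (EFin \o (fun s => FF pb x s i j)).
Proof. by rewrite (ord1 j); exact: (FF_integrable Hpb). Qed.

Lemma JF_int x i j : (law pb).-integrable setT (EFin \o (fun s => JF pb x s i j)).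
Proof. exact: (JF_integrable Hpb). Qed.

Lemma jac_Fmean_bounded x : dom (Psi0 pb) x -> frob (jac (Fmean pb) x) <= M_F cs.
Proof.
move=> hx; apply: (@frob_mean_le _ _ _ (law pb) _ _ (JF pb x)); last exact: ltW.
- exact: measurable_JF.
- exact: jac_Fmean_entry.
- by have := JF_bounded Hpb hx; rewrite expectationE.
Qed.

Lemma Fmean_lipschitz x y : dom (Psi0 pb) x -> dom (Psi0 pb) y ->
  frob (Fmean pb y - Fmean pb x) <= M_F cs * frob (y - x).
Proof.
move=> hx hy.
apply: (@frob_mean_le _ _ _ (law pb) _ _ (fun s => FF pb y s - FF pb x s)).
- by apply: measurable_mxB; exact: (measurable_FF Hpb).
- exact: (mean_mxB (FF_int y) (FF_int x) (Fmean_entry y) (Fmean_entry x)).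
- by rewrite exprMn; exact: (FF_mean_square_lipschitz Hpb Hd).
- by rewrite mulr_ge0 ?frob_ge0// ltW.
Qed.

Lemma jac_Fmean_lipschitz x y : dom (Psi0 pb) x -> dom (Psi0 pb) y ->
  frob (jac (Fmean pb) y - jac (Fmean pb) x) <= L_F cs * frob (y - x).
Proof.
move=> hx hy.
apply: (@frob_mean_le _ _ _ (law pb) _ _ (fun s => JF pb y s - JF pb x s)).
- by apply: measurable_mxB; exact: measurable_JF.
- exact: (mean_mxB (JF_int y) (JF_int x) (jac_Fmean_entry y) (jac_Fmean_entry x)).
- by have := JF_lipschitz Hpb hy hx; rewrite expectationE exprMn.
- by rewrite mulr_ge0 ?frob_ge0// ltW.
Qed.

Variable gamma : R.
Hypothesis gamma0 : 0 < gamma.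

Let L := L_Phi pb cs gamma.

(** The gradient is the product of [jac F] and [K ystar(F)]; each factor is bounded,
    and Lipschitz by the preceding lemmas. *)
Lemma grad_Phi_lipschitz x y : dom (Psi0 pb) x -> dom (Psi0 pb) y ->
  frob (grad (Phi pb d gamma) y - grad (Phi pb d gamma) x) <= L * frob (y - x).
Proof.
move=> hx hy; rewrite !(grad_PhiE Hpb Hd gamma0).
set Jx := jac _ x; set Jy := jac _ y.
set ux := Kmx pb *m ystar _ _ _ (Fmean pb x).
set uy := Kmx pb *m ystar _ _ _ (Fmean pb y).
rewrite mulmx_tr_diff.
have l1 : frob ((Jy - Jx)^T *m uy) <=
    (L_F cs * frob (y - x)) * (spectral (Kmx pb) * M_psi cs).
  rewrite (le_trans (frob_mulmx _ _))// frob_tr ler_pM ?frob_ge0//.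
    exact: jac_Fmean_lipschitz.
  exact: (K_ystar_bounded Hpb Hd gamma0).
have l2 : frob (Jx^T *m (uy - ux)) <=
    M_F cs * (spectral (Kmx pb) * (spectral (Kmx pb) / gamma * (M_F cs * frob (y - x)))).
  rewrite (le_trans (frob_mulmx _ _))// frob_tr ler_pM ?frob_ge0//.
    exact: jac_Fmean_bounded.
  rewrite -mulmxBr (le_trans (frob_spectral _ _))// ler_wpM2l//.
  rewrite (le_trans (ystar_lipschitz Hpb Hd gamma0 _ _))//.
  by rewrite ler_wpM2l ?divr_ge0 ?(ltW gamma0)//; exact: Fmean_lipschitz.
rewrite (le_trans (frobD_le _ _))// (le_trans (lerD l1 l2))// /L /L_Phi.
by apply: le_of_eq; field; rewrite gt_eqF.
Qed.

Lemma L_Phi_ge0 : 0 <= L.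
Proof.
apply: addr_ge0; first by rewrite !mulr_ge0// ltW.
by rewrite divr_ge0 ?(ltW gamma0)// mulr_ge0 ?sqr_ge0.
Qed.

Lemma Phi_descent x y : dom (Psi0 pb) x -> dom (Psi0 pb) y ->
  Phi pb d gamma y <= Phi pb d gamma x +
    mdot (grad (Phi pb d gamma) x) (y - x) + L / 2 * frob (y - x) ^+ 2.
Proof.
move=> hx hy; have {1}-> : y = x + (y - x) by rewrite addrC subrK.
apply: descent_segment; first by move=> z; exact: (Phi_differentiable Hpb Hd gamma0).
move=> t t01; have t0 : 0 <= t by case/andP: t01.
have hz : dom (Psi0 pb) (x + t *: (y - x)).
  have -> : x + t *: (y - x) = t *: y + (1 - t) *: x.
    by apply/matrixP => i j; rewrite !mxE; ring.
  exact: (dom_Psi0_convex Hpb Hd).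
rewrite (le_trans (mdot_le _ _))// expr2 mulrA ler_wpM2r ?frob_ge0//.
rewrite (le_trans (grad_Phi_lipschitz hx hz))//.
have -> : x + t *: (y - x) - x = t *: (y - x).
  by apply/matrixP => i j; rewrite !mxE; ring.
by rewrite frobZ ger0_norm// mulrA.
Qed.

(** The weights are the squared constants with which the errors of the two
    estimators enter the error of the gradient estimator, see [grad_error_le]. *)
Definition est_error x (Fe : 'cV[R]_q) (Je : 'M[R]_(q, p)) : R :=
  spectral (Kmx pb) ^+ 2 * M_psi cs ^+ 2 * frob (Je - jac (Fmean pb) x) ^+ 2 +
  M_F cs ^+ 2 * spectral (Kmx pb) ^+ 4 / gamma ^+ 2 * frob (Fe - Fmean pb x) ^+ 2.

(** The difference of the two products splits into the error of the Jacobian, times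
    a bounded dual vector, and the error of the dual vector, which is Lipschitz in
    the estimate of [F]. *)
Lemma grad_error_le x Fe Je : dom (Psi0 pb) x ->
  frob (Je^T *m Kmx pb *m ystar pb d gamma Fe - grad (Phi pb d gamma) x) ^+ 2
  <= 2 * est_error x Fe Je.
Proof.
move=> hx; rewrite (grad_PhiE Hpb Hd gamma0) -mulmxA.
set Jx := jac _ x; set ux := Kmx pb *m ystar _ _ _ (Fmean pb x).
set u := Kmx pb *m ystar _ _ _ Fe.
rewrite mulmx_tr_diff.
have l1 : frob ((Je - Jx)^T *m u) <= frob (Je - Jx) * (spectral (Kmx pb) * M_psi cs).
  rewrite (le_trans (frob_mulmx _ _))// frob_tr ler_wpM2l ?frob_ge0//.
  exact: (K_ystar_bounded Hpb Hd gamma0).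
have l2 : frob (Jx^T *m (u - ux)) <=
    M_F cs * (spectral (Kmx pb) * (spectral (Kmx pb) / gamma * frob (Fe - Fmean pb x))).
  rewrite (le_trans (frob_mulmx _ _))// frob_tr ler_pM ?frob_ge0//.
    exact: jac_Fmean_bounded.
  rewrite -mulmxBr (le_trans (frob_spectral _ _))// ler_wpM2l//.
  exact: (ystar_lipschitz Hpb Hd gamma0).
rewrite (le_trans (frobD2_le _ _))// -mulrDr ler_pM2l//.
have sq (s t : R) : 0 <= s -> s <= t -> s ^+ 2 <= t ^+ 2.
  by move=> s0 st; rewrite ler_pXn2r ?nnegrE// (le_trans s0).
rewrite (le_trans (lerD (sq _ _ (frob_ge0 _) l1) (sq _ _ (frob_ge0 _) l2)))//.
by rewrite /est_error; apply: le_of_eq; field; rewrite gt_eqF.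
Qed.

Variables (theta : R).
Hypotheses (theta01 : 0 < theta <= 1) (L0 : 0 < L).
Let eta := eta_cst L theta.

Lemma eta_gt0 : 0 < eta.
Proof.
have /andP[t0 _] := theta01.
by rewrite /eta /eta_cst divr_gt0// mulr_gt0// addr_gt0.
Qed.

Section one_step.
Variables (x : 'cV[R]_p) (Fe : 'cV[R]_q) (Je : 'M[R]_(q, p)).
Hypothesis hx : dom (Psi0 pb) x.
Let v := Je^T *m Kmx pb *m ystar pb d gamma Fe.
Let xh := prox eta (reg pb) (x - eta *: v).
Let x' := (1 - theta) *: x + theta *: xh.

Lemma prox_point_dom : dom (Psi0 pb) xh.
Proof.
apply/(dom_Psi0 Hpb Hd).
exact: (prox_dom (reg_proper Hpb) (reg_closed Hpb) (reg_convex Hpb) eta_gt0).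
Qed.

Lemma next_point_dom : dom (Psi0 pb) x'.
Proof.
have /andP[t0 t1] := theta01.
have -> : x' = theta *: xh + (1 - theta) *: x by rewrite addrC.
apply: (dom_Psi0_convex Hpb Hd) => //; first exact: prox_point_dom.
by rewrite (ltW t0).
Qed.

(** The descent inequality for the smoothed part, convexity along the averaging and
    the three-point inequality for the regularizer; Young's inequality absorbs the
    pairing of the gradient error with the displacement.  The step size makes the
    displacement enter with the coefficient [theta * L]. *)
Lemma step_decrease :
  Psi_smooth pb d gamma x' + theta * L * frob (xh - x) ^+ 2 <=
  Psi_smooth pb d gamma x + theta / L * est_error x Fe Je.
Proof.
have /andP[t0 t1] := theta01.
have /(dom_Psi0 Hpb Hd) rx := hx.
have /(dom_Psi0 Hpb Hd) rxh := prox_point_dom.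
have desc := Phi_descent hx next_point_dom.
have xE : x' - x = theta *: (xh - x).
  by apply/matrixP => i j; rewrite !mxE; ring.
have step := prox_step (reg_proper Hpb) (reg_closed Hpb) (reg_convex Hpb) eta_gt0 v rx.
have [|_ regle] := convex_fun_dom (regNy Hpb) (reg_convex Hpb) rxh rx (t := theta).
  by rewrite (ltW t0).
move: regle; rewrite addrC -/x' => regle.
have err := grad_error_le Fe Je hx.
rewrite -/v in err; rewrite -/xh in step.
rewrite xE mdotZr frobZ gtr0_norm// exprMn in desc.
move: err step desc regle; rewrite /Psi_smooth.
set g := grad _ _; set D := frob (xh - x).
have young : mdot (g - v) (xh - x) <= (2 * L)^-1 * frob (v - g) ^+ 2 + L / 2 * D ^+ 2.
  rewrite (le_trans (mdot_le _ _))// (frobBC g v) -/D.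
  have -> : (2 * L)^-1 * frob (v - g) ^+ 2 + L / 2 * D ^+ 2 =
      frob (v - g) * D + (2 * L)^-1 * (frob (v - g) - L * D) ^+ 2.
    by field; rewrite gt_eqF.
  by rewrite lerDl mulr_ge0 ?sqr_ge0// invr_ge0 mulr_ge0// ltW.
rewrite mdotBl in young => err step desc regle.
have etaE : D ^+ 2 / eta = L * (3 + theta) / 2 * D ^+ 2.
  by rewrite /eta /eta_cst; field; rewrite !gt_eqF// addr_gt0.
rewrite etaE in step.
have err' : (2 * L)^-1 * frob (v - g) ^+ 2 <= L^-1 * est_error x Fe Je.
  have -> : L^-1 * est_error x Fe Je = (2 * L)^-1 * (2 * est_error x Fe Je).
    by field; rewrite gt_eqF.
  by rewrite ler_wpM2l// invr_ge0 mulr_ge0// ltW.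
move: err' young step desc regle.
move: (mdot g (xh - x)) (mdot v (xh - x)) (Phi _ _ _ x') (Phi _ _ _ x).
move: (fine (reg pb xh)) (fine (reg pb x')) (fine (reg pb x)).
move: ((2 * L)^-1 * _) (D ^+ 2) => E D2 rh r' r mg mv P' P0.
rewrite -[theta / L * _]mulrA; move: (L^-1 * _) => A err' young step desc regle.
have : theta * (mg - mv + rh + (L * (3 + theta) / 2) * D2 - r + mv) <=
    theta * (A + L / 2 * D2).
  by rewrite ler_pM2l//; lra.
lra.
Qed.

(** The exact and the inexact proximal points differ by at most [eta] times the
    gradient error, and the step size satisfies [1 <= 2 * L * eta]. *)
Lemma grad_map_le : frob (grad_map pb d gamma eta x) ^+ 2 <=
  8 * L ^+ 2 * frob (xh - x) ^+ 2 + 4 * est_error x Fe Je.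
Proof.
have /andP[t0 t1] := theta01; have eta0 := eta_gt0.
have err := grad_error_le Fe Je hx; rewrite -/v in err.
rewrite /grad_map; set g := grad _ _ in err *.
set xg := prox _ _ (x - eta *: g).
have nonexp : frob (xh - xg) <= eta * frob (v - g).
  have := prox_nonexpansive (reg_proper Hpb) (reg_closed Hpb) (reg_convex Hpb) eta0
    (x - eta *: v) (x - eta *: g); rewrite -/xh -/xg.
  have -> : (x - eta *: v) - (x - eta *: g) = eta *: (g - v).
    by apply/matrixP => i j; rewrite !mxE; ring.
  by rewrite frobZ gtr0_norm// frobBC (frobBC g).
rewrite frobZ exprMn.
have -> : x - xg = (xh - xg) - (xh - x) by rewrite opprB [RHS]addrC subrKA.
have nonexp2 : frob (xh - xg) ^+ 2 <= eta ^+ 2 * frob (v - g) ^+ 2.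
  by rewrite -exprMn ler_pXn2r ?nnegrE ?frob_ge0// mulr_ge0 ?frob_ge0// ltW.
have tri : frob ((xh - xg) - (xh - x)) ^+ 2 <=
    2 * (eta ^+ 2 * frob (v - g) ^+ 2) + 2 * frob (xh - x) ^+ 2.
  rewrite (le_trans (frobD2_le _ _))// frobN lerD2r ler_pM2l//.
have ->: `|eta^-1| ^+ 2 = (eta ^+ 2)^-1 by rewrite real_normK ?num_real// exprVn.
have eta2 : 0 < eta ^+ 2 by rewrite exprn_gt0.
rewrite mulrC ler_pdivrMr// (le_trans tri)//.
have eta_le : 1 <= 4 * L ^+ 2 * eta ^+ 2.
  have -> : 4 * L ^+ 2 * eta ^+ 2 = (4 / (3 + theta)) ^+ 2.
    by rewrite /eta /eta_cst; field; rewrite !gt_eqF// addr_gt0.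
  rewrite exprn_ege1// ler_pdivlMr ?addr_gt0// mul1r; lra.
have D0 : 0 <= frob (xh - x) ^+ 2 by rewrite sqr_ge0.
have s1 : 2 * frob (xh - x) ^+ 2 <= 2 * (4 * L ^+ 2 * eta ^+ 2) * frob (xh - x) ^+ 2.
  by rewrite ler_wpM2r//; lra.
have s2 : 2 * (eta ^+ 2 * frob (v - g) ^+ 2) <= 4 * est_error x Fe Je * eta ^+ 2.
  rewrite [leRHS]mulrC mulrCA ler_wpM2l ?(ltW eta2)//; lra.
apply: (le_trans (lerD s2 s1)); rewrite [leRHS]mulrDl [leRHS]addrC lerD2l.
by move: (frob _ ^+ 2) (eta ^+ 2) => D2 e2; apply: le_of_eq; ring.
Qed.

End one_step.

End smoothness.

(** * One step of a hybrid estimator with a random past *)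

Section measurable_matrices.
Context {R : realType} {d : measure_display} {T : measurableType d} {k l : nat}.
Implicit Types A B : T -> 'M[R]_(k, l).

Lemma measurable_mxD A B : measurable_mx A -> measurable_mx B ->
  measurable_mx (fun w => A w + B w).
Proof.
move=> mA mB i j; under eq_fun do rewrite mxE.
by apply: measurable_funD; [exact: mA|exact: mB].
Qed.

Lemma measurable_mxZ c A : measurable_mx A -> measurable_mx (fun w => c *: A w).
Proof.
move=> mA i j; under eq_fun do rewrite mxE.
by apply: measurable_funM => //; exact: mA.
Qed.

Lemma measurable_mx_sum (I : Type) (r : seq I) (P : pred I) (F : I -> T -> 'M[R]_(k, l)) :
  (forall i, P i -> measurable_mx (F i)) ->
  measurable_mx (fun w => \sum_(i <- r | P i) F i w).
Proof.
move=> mF; elim: r => [|i r IH].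
  by move=> a b; under eq_fun do rewrite big_nil; exact: measurable_cst.
case Pi: (P i); last by move=> a b; under eq_fun do rewrite big_cons Pi; exact: IH.
move=> a b; under eq_fun do rewrite big_cons Pi.
by apply: measurable_mxD => //; exact: mF.
Qed.

End measurable_matrices.

Lemma batch_avg_center (R : realFieldType) (m : nat) (a : 'I_m -> R) (c : R) :
  (0 < m)%N -> m%:R^-1 * \sum_(i < m) (a i - c) = m%:R^-1 * \sum_(i < m) a i - c.
Proof.
move=> m0; rewrite sumrB sumr_const card_ord mulrBr -[c *+ m]mulr_natl mulKf//.
by rewrite pnatr_eq0 -lt0n.
Qed.

Lemma mxDE (R : realType) k l (A B : 'M[R]_(k, l)) i j : (A + B) i j = A i j + B i j.
Proof. by rewrite mxE. Qed.

Lemma mxZE (R : realType) k l c (A : 'M[R]_(k, l)) i j : (c *: A) i j = c * A i j.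
Proof. by rewrite mxE. Qed.

Section hybrid_estimator.
Context {R : realType} {dX dO : measure_display}.
Context {Xi : measurableType dX} {Omega : measurableType dO}.
Variables (Pr : probability Omega R) (law : probability Xi R).
Context {p k l : nat}.
Variables (D : set 'cV[R]_p) (f : 'cV[R]_p -> Xi -> 'M[R]_(k, l)).
Variables (mean : 'cV[R]_p -> 'M[R]_(k, l)) (lip sigma : R).
Hypothesis mf : forall dT (T : measurableType dT) (x : T -> 'cV[R]_p) (s : T -> Xi),
  measurable_mx x -> measurable_fun setT s -> measurable_mx (fun w => f (x w) (s w)).
Hypothesis mmean : forall dT (T : measurableType dT) (x : T -> 'cV[R]_p),
  measurable_mx x -> measurable_mx (fun w => mean (x w)).
Hypothesis f_int : forall x i j, law.-integrable setT (EFin \o (fun s => f x s i j)).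
Hypothesis f_mean : forall x i j, mean x i j = \int[law]_s f x s i j.
Hypothesis f_lip : forall x y, D x -> D y ->
  (\int[law]_s (frob (f y s - f x s) ^+ 2)%:E <= (lip ^+ 2 * frob (y - x) ^+ 2)%:E)%E.
Hypothesis f_var : forall x, D x ->
  (\int[law]_s (frob (f x s - mean x) ^+ 2)%:E <= (sigma ^+ 2)%:E)%E.

Let mfx x : measurable_mx (f x).
Proof.
apply: (mf (x := fun=> x) (s := id)); last exact: measurable_id.
by move=> i j; exact: measurable_cst.
Qed.

(** Each entry of a centered batch average is a mean of [m] uncorrelated terms. *)
Lemma initial_moment m X x : (0 < m)%N -> iid_batch Pr law m X -> D x ->
  (\int[Pr]_w (frob (m%:R^-1 *: (\sum_(i < m) f x (X i w)) - mean x) ^+ 2)%:E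
   <= (sigma ^+ 2 / m%:R)%:E)%E.
Proof.
move=> m0 iid Dx.
have [sf sum_f] := sqint_entries
  (fun i j => measurable_mxB (mfx x) (measurable_mx_cst (mean x)) i j) (f_var Dx).
pose g (e : 'I_k * 'I_l) s := (f x s - mean x) e.1 e.2.
have g0 e : \int[law]_s g e s = 0.
  rewrite /g; under eq_Rintegral do rewrite mxBE.
  rewrite RintegralB//; last exact: integrable_cst_prob.
  by rewrite Rintegral_cst1 -f_mean subrr.
have mom e := batch_avg_moments m0 iid (sf e.1 e.2) (g0 e).
have eE w : frob (m%:R^-1 *: (\sum_(i < m) f x (X i w)) - mean x) ^+ 2 =
    \sum_(e : 'I_k * 'I_l) batch_avg m X (g e) w ^+ 2.
  rewrite frob2_sum; apply: eq_bigr => e _; congr (_ ^+ 2).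
  rewrite mxBE mxE summxE /batch_avg /g.
  by under [in RHS]eq_bigr do rewrite mxBE; rewrite batch_avg_center.
under eq_integral do rewrite eE.
have ig e : Pr.-integrable setT (EFin \o (fun w => batch_avg m X (g e) w ^+ 2)).
  by case: (mom e) => -[].
rewrite -EFin_Rintegral; last exact: integrable_sumr.
rewrite lee_fin Rintegral_sum//.
rewrite (eq_bigr (fun e => m%:R^-1 * \int[law]_s (g e s ^+ 2))); last first.
  by move=> e _; case: (mom e).
by rewrite -mulr_sumr mulrC ler_wpM2r// invr_ge0.
Qed.

Section step.
Context {dH dI : measure_display} {H : measurableType dH} {I : measurableType dI}.
Variables (past : Omega -> H) (now : Omega -> I).
Hypotheses (mpast : measurable_fun setT past) (mnow : measurable_fun setT now).
Hypothesis indep : forall A B, measurable A -> measurable B ->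
  Pr (past @^-1` A `&` now @^-1` B) = (Pr (past @^-1` A) * Pr (now @^-1` B))%E.
Variables (x0 x1 : H -> 'cV[R]_p) (E0 : H -> 'M[R]_(k, l)).
Hypotheses (mx0 : measurable_mx x0) (mx1 : measurable_mx x1) (mE0 : measurable_mx E0).
Hypotheses (Dx0 : forall w, D (x0 w)) (Dx1 : forall w, D (x1 w)).
Variables (m1 m2 : nat) (X Y : nat -> I -> Xi).
Hypotheses (m10 : (0 < m1)%N) (m20 : (0 < m2)%N).
Hypotheses (mX : forall i, (i < m1)%N -> measurable_fun setT (X i)).
Hypotheses (mY : forall i, (i < m2)%N -> measurable_fun setT (Y i)).
Let X' i w := X i (now w).
Let Y' i w := Y i (now w).
Hypotheses (iX : iid_batch Pr law m1 X') (iY : iid_batch Pr law m2 Y').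
Variables (kap beta : R).
Hypothesis hkap : kap = 2 \/ kap = 1 /\
  (forall i j, (i < m1)%N -> (j < m2)%N -> pair_indep Pr (X' i) (Y' j)).

(** The estimator of one iteration as a function of the past and of the new
    samples, so that the two can be integrated separately. *)
Definition hybrid_update (u : H) (v : I) : 'M[R]_(k, l) :=
  beta *: E0 u
  + (beta / m1%:R) *: \sum_(i < m1) (f (x1 u) (X i v) - f (x0 u) (X i v))
  + ((1 - beta) / m2%:R) *: \sum_(i < m2) f (x1 u) (Y i v).

Let kap0 : 0 <= kap. Proof. by case: hkap => [->|[->]]. Qed.

Let err (z : H * I) := hybrid_update z.1 z.2 - mean (x1 z.1).

Let merr : measurable_mx err.
Proof.
have m1f := measurableT_comp; have mfst := @measurable_fst _ _ H I.
have msnd := @measurable_snd _ _ H I.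
have mx0f : measurable_mx (fun z : H * I => x0 z.1).
  by move=> i j; exact: (measurableT_comp (mx0 i j) mfst).
have mx1f : measurable_mx (fun z : H * I => x1 z.1).
  by move=> i j; exact: (measurableT_comp (mx1 i j) mfst).
have mXs (i : 'I_m1) : measurable_fun setT (fun z : H * I => X i z.2).
  exact: (measurableT_comp (mX (ltn_ord i)) msnd).
have mYs (i : 'I_m2) : measurable_fun setT (fun z : H * I => Y i z.2).
  exact: (measurableT_comp (mY (ltn_ord i)) msnd).
apply: measurable_mxB; last exact: mmean.
apply: measurable_mxD; first apply: measurable_mxD.
- by apply: measurable_mxZ => i j; exact: (measurableT_comp (mE0 i j) mfst).
- apply/measurable_mxZ/measurable_mx_sum => i _.
  by apply: measurable_mxB; apply: mf.
- by apply/measurable_mxZ/measurable_mx_sum => i _; apply: mf.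
Qed.

(** Entrywise, the error with frozen past is the old error times [beta] plus two
    centered batch averages. *)
Let inner_moment u :
  (\int[Pr]_w (frob (err (u, now w)) ^+ 2)%:E <=
   (beta ^+ 2 * frob (E0 u - mean (x0 u)) ^+ 2
    + (kap * beta ^+ 2 * lip ^+ 2 / m1%:R) * frob (x1 u - x0 u) ^+ 2
    + kap * (1 - beta) ^+ 2 * sigma ^+ 2 / m2%:R)%:E)%E.
Proof.
pose A s := f (x1 u) s - f (x0 u) s.
pose M := mean (x1 u) - mean (x0 u).
pose g1 (e : 'I_k * 'I_l) s := A s e.1 e.2 - M e.1 e.2.
pose g2 (e : 'I_k * 'I_l) s := (f (x1 u) s - mean (x1 u)) e.1 e.2.
have mA : measurable_mx A by apply: measurable_mxB.
have [sA sum_A] := sqint_entries mA (f_lip (Dx0 u) (Dx1 u)).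
have AM := mean_mxB (f_int (x1 u)) (f_int (x0 u)) (f_mean (x1 u)) (f_mean (x0 u)).
have [s2 sum_2] := sqint_entries
  (measurable_mxB (mfx (x1 u)) (measurable_mx_cst (mean (x1 u)))) (f_var (Dx1 u)).
have s1 e : sqint law (g1 e) by exact: sqint_subcst.
have g10 e : \int[law]_s g1 e s = 0.
  rewrite RintegralB//; [|exact: sqint_integrable|exact: integrable_cst_prob].
  by rewrite Rintegral_cst1 /M AM subrr.
have g20 e : \int[law]_s g2 e s = 0.
  rewrite /g2; under eq_Rintegral do rewrite mxBE.
  rewrite RintegralB//; last exact: integrable_cst_prob.
  by rewrite Rintegral_cst1 -f_mean subrr.
pose a (e : 'I_k * 'I_l) := (E0 u - mean (x0 u)) e.1 e.2.
pose ee e w := beta * a e + beta * batch_avg m1 X' (g1 e) w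
  + (1 - beta) * batch_avg m2 Y' (g2 e) w.
have mom e := hybrid_step_moment beta (a e) m10 m20 iX iY hkap (s1 e) (s2 e.1 e.2)
  (g10 e) (g20 e).
have eE w : frob (err (u, now w)) ^+ 2 = \sum_(e : 'I_k * 'I_l) ee e w ^+ 2.
  rewrite frob2_sum; apply: eq_bigr => e _; congr (_ ^+ 2).
  rewrite /err /hybrid_update /= mxBE 2!mxDE 3!mxZE 2!summxE.
  rewrite /ee /batch_avg /g1 /g2 /a /M /A.
  under [in RHS]eq_bigr => i _ do rewrite mxBE.
  rewrite batch_avg_center//.
  under [X in (1 - beta) * (_ * X)]eq_bigr => i _ do rewrite mxBE.
  rewrite batch_avg_center// !mxBE.
  under [in LHS]eq_bigr => i _ do rewrite mxBE.
  by ring.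
under eq_integral do rewrite eE.
have ie e : Pr.-integrable setT (EFin \o (fun w => ee e w ^+ 2)).
  by case: (mom e) => -[].
rewrite -EFin_Rintegral; last exact: integrable_sumr.
rewrite lee_fin Rintegral_sum//.
pose V1 e := \int[law]_s (g1 e s ^+ 2); pose V2 e := \int[law]_s (g2 e s ^+ 2).
have sumV1 : \sum_e V1 e <= lip ^+ 2 * frob (x1 u - x0 u) ^+ 2.
  apply: le_trans sum_A; apply: ler_sum => e _; rewrite /V1 /g1 /M AM.
  exact: variance_le.
apply: (@le_trans _ _ (\sum_e (beta ^+ 2 * a e ^+ 2 +
    kap * (beta ^+ 2 / m1%:R * V1 e + (1 - beta) ^+ 2 / m2%:R * V2 e)))).
  by apply: ler_sum => e _; case: (mom e).
rewrite big_split /= -mulr_sumr -frob2_sum -mulr_sumr big_split /= -!mulr_sumr.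
rewrite -addrA lerD2l mulrDr lerD//.
  have -> : kap * beta ^+ 2 * lip ^+ 2 / m1%:R * frob (x1 u - x0 u) ^+ 2 =
    kap * (beta ^+ 2 / m1%:R * (lip ^+ 2 * frob (x1 u - x0 u) ^+ 2)) by ring.
  by rewrite ler_wpM2l// ler_wpM2l// divr_ge0 ?sqr_ge0.
have -> : kap * (1 - beta) ^+ 2 * sigma ^+ 2 / m2%:R =
  kap * ((1 - beta) ^+ 2 / m2%:R * sigma ^+ 2) by ring.
by rewrite ler_wpM2l// ler_wpM2l// divr_ge0 ?sqr_ge0.
Qed.

(** Conditioning on the past: past and present being independent, the second
    moment is an iterated integral whose inner integral has a frozen past. *)
Lemma hybrid_moment :
  (\int[Pr]_w (frob (hybrid_update (past w) (now w) - mean (x1 (past w))) ^+ 2)%:E <=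
   (beta ^+ 2)%:E * \int[Pr]_w (frob (E0 (past w) - mean (x0 (past w))) ^+ 2)%:E
   + (kap * beta ^+ 2 * lip ^+ 2 / m1%:R)%:E *
       \int[Pr]_w (frob (x1 (past w) - x0 (past w)) ^+ 2)%:E
   + (kap * (1 - beta) ^+ 2 * sigma ^+ 2 / m2%:R)%:E)%E.
Proof.
pose G (z : H * I) := (frob (err z) ^+ 2)%:E.
have mG : measurable_fun setT G by apply/measurable_EFinP; exact: measurable_frob2.
have G0 z : (0 <= G z)%E by rewrite lee_fin sqr_ge0.
rewrite (ge0_integral_indep mpast mnow indep mG G0).
have mcomp k' l' (B : H -> 'M[R]_(k', l')) : measurable_mx B ->
    measurable_fun setT (fun w => (frob (B (past w)) ^+ 2)%:E).
  move=> mB; apply/measurable_EFinP; apply: measurable_frob2 => i j.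
  exact: (measurableT_comp (mB i j) mpast).
have mE : measurable_fun setT
    (fun w => (frob (E0 (past w) - mean (x0 (past w))) ^+ 2)%:E).
  by apply: (mcomp _ _ (fun u => E0 u - mean (x0 u))); apply: measurable_mxB => //; exact: mmean.
have mx : measurable_fun setT
    (fun w => (frob (x1 (past w) - x0 (past w)) ^+ 2)%:E).
  by apply: (mcomp _ _ (fun u => x1 u - x0 u)); exact: measurable_mxB.
have c10 : 0 <= kap * beta ^+ 2 * lip ^+ 2 / m1%:R.
  by rewrite divr_ge0// mulr_ge0 ?sqr_ge0// mulr_ge0 ?sqr_ge0.
have c20 : 0 <= kap * (1 - beta) ^+ 2 * sigma ^+ 2 / m2%:R.
  by rewrite divr_ge0// mulr_ge0 ?sqr_ge0// mulr_ge0 ?sqr_ge0.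
apply: (@le_trans _ _ (\int[Pr]_w
   ((beta ^+ 2)%:E * (frob (E0 (past w) - mean (x0 (past w))) ^+ 2)%:E
   + (kap * beta ^+ 2 * lip ^+ 2 / m1%:R)%:E *
       (frob (x1 (past w) - x0 (past w)) ^+ 2)%:E
   + (kap * (1 - beta) ^+ 2 * sigma ^+ 2 / m2%:R)%:E))%E).
  apply: ge0_le_integral => //.
  - by move=> w _; exact: integral_ge0.
  - pose PI : probability I R := distribution Pr (mfun_Sub (mem_set mnow)).
    have mF : measurable_fun setT (fubini_F PI G).
      exact: measurable_fun_fubini_tonelli_F.
    have -> : (fun w => \int[Pr]_w' G (past w, now w'))%E = fubini_F PI G \o past.
      apply/funext => w; rewrite /fubini_F /distribution /=.
      rewrite ge0_integral_pushforward//; exact: measurableT_comp.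
    exact: measurableT_comp.
  - apply: emeasurable_funD; last exact: measurable_cst.
    by apply: emeasurable_funD; exact: measurable_funeM.
  - by move=> w _; rewrite -!EFinM -!EFinD; exact: inner_moment.
have b0 : 0 <= beta ^+ 2 := sqr_ge0 beta.
have f0 (c h : R) : 0 <= c -> (0 <= c%:E * (h ^+ 2)%:E)%E.
  by move=> c0; rewrite mule_ge0// lee_fin sqr_ge0.
rewrite ge0_integralD; [|exact: measurableT| | |by move=> w _; rewrite lee_fin|
  exact: measurable_cst]; last 2 first.
- by move=> w _; apply: adde_ge0; exact: f0.
- by apply: emeasurable_funD; exact: measurable_funeM.
rewrite ge0_integralD; [|exact: measurableT|by move=> w _; exact: f0|
  exact: measurable_funeM|by move=> w _; exact: f0|exact: measurable_funeM].
rewrite integral_cst//= probability_setT mule1.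
by rewrite !ge0_integralZl_EFin// => w _; rewrite lee_fin sqr_ge0.
Qed.

End step.

End hybrid_estimator.

(** * Arithmetic of the rate and of the evaluation counts *)

Section potential.
Context {R : realType}.

(** Let [E = S0 + T (1 - beta)^2 S].  Summing the recursion, with
    [beta^2 <= 1 - (1 - beta)], and using the domination of its [D]-coefficient
    gives [20 sum A <= 20 E / (1 - beta) + 8 L^2 sum D], while the descent gives
    [16 L^2 sum D <= 16 L Delta / theta + 16 sum A].  The sum of the two is the
    claim. *)
Lemma potential_sum (A D : nat -> R) (T : nat) (L theta beta Delta C S S0 : R) :
  0 < L -> 0 < theta -> 0 <= beta < 1 ->
  (forall t, 0 <= A t) -> (forall t, 0 <= D t) ->
  5 / 2 * theta ^+ 2 * C * beta ^+ 2 <= L ^+ 2 * (1 - beta) ->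
  theta * L * \sum_(t < T.+1) D t <= Delta + theta / L * \sum_(t < T.+1) A t ->
  A 0 <= S0 ->
  (forall t, (t < T)%N -> A t.+1 <= beta ^+ 2 * A t
    + beta ^+ 2 * theta ^+ 2 * C * D t + (1 - beta) ^+ 2 * S) ->
  0 <= C ->
  \sum_(t < T.+1) (8 * L ^+ 2 * D t + 4 * A t) <=
  16 * L / theta * Delta + 20 / (1 - beta) * (S0 + T%:R * ((1 - beta) ^+ 2 * S)).
Proof.
move=> L0 th0 /andP[be0 be1] A0 D0 dom descent init step C0.
have w0 : 0 < 1 - beta by rewrite subr_gt0.
have recursion k : (k <= T)%N -> (1 - beta) * (\sum_(t < k) A t) + A k <=
    S0 + beta ^+ 2 * theta ^+ 2 * C * (\sum_(t < k) D t) + k%:R * ((1 - beta) ^+ 2 * S).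
  elim: k => [_|k IH kT]; first by rewrite !big_ord0 mulr0 mulr0 mul0r add0r !addr0.
  have := IH (ltnW kT); have := step k kT.
  rewrite !big_ord_recr/= -natr1.
  have : 0 <= (beta - beta ^+ 2) * A k.
    by rewrite mulr_ge0// subr_ge0 expr2 ler_piMl// ltW.
  move: (\sum_(t < k) A t) (\sum_(t < k) D t) (A k) (A k.+1) (D k) => sA sD a a' dk.
  move: ((1 - beta) ^+ 2 * S) => w2S.
  move: (beta ^+ 2 * theta ^+ 2 * C) => c.
  by rewrite !mulrDl !mulrDr mul1r mulNr; lra.
have := recursion T (leqnn T).
have : (1 - beta) * (\sum_(t < T.+1) A t) <= (1 - beta) * (\sum_(t < T) A t) + A T.
  rewrite big_ord_recr/= mulrDr lerD2l ler_piMl// ?A0//.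
  by rewrite gerBl.
have : \sum_(t < T) D t <= \sum_(t < T.+1) D t by rewrite big_ord_recr/= lerDl.
have : 0 <= \sum_(t < T.+1) D t by apply: sumr_ge0.
move: descent; rewrite big_split/= -!mulr_sumr.
move: (\sum_(t < T.+1) A t) (\sum_(t < T.+1) D t) (\sum_(t < T) D t) => sA sD sD'.
move: ((1 - beta) * (\sum_(t < T) A t) + A T) => m.
set E := T%:R * _; move=> descent sD0 leD lem le.
have le1 : (1 - beta) * sA <= S0 + beta ^+ 2 * theta ^+ 2 * C * sD + E.
  apply: (le_trans lem); apply: (le_trans le); rewrite lerD2r lerD2l ler_wpM2l//.
  by apply: mulr_ge0 => //; rewrite mulr_ge0 ?sqr_ge0.
move: le1; clear m lem le; move: E => E le1.
have le2 : 16 * L ^+ 2 * sD <= 16 * L / theta * Delta + 16 * sA.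
  have h : 0 <= 16 * L / theta by rewrite divr_ge0 ?mulr_ge0 ?ltW.
  have := ler_wpM2l h descent.
  have -> : 16 * L / theta * (theta * L * sD) = 16 * L ^+ 2 * sD.
    by field; rewrite gt_eqF.
  have -> : 16 * L / theta * (Delta + theta / L * sA) =
      16 * L / theta * Delta + 16 * sA by field; rewrite !gt_eqF.
  by [].
have le3 : 20 * sA <= 20 / (1 - beta) * (S0 + E) + 8 * L ^+ 2 * sD.
  have h : 0 <= 20 / (1 - beta) by rewrite divr_ge0// ltW.
  have := ler_wpM2l h le1.
  rewrite mulrA divfK ?gt_eqF// => /le_trans; apply.
  have -> : 20 / (1 - beta) * (S0 + beta ^+ 2 * theta ^+ 2 * C * sD + E) =
    20 / (1 - beta) * (S0 + E) +
    8 / (1 - beta) * (5 / 2 * theta ^+ 2 * C * beta ^+ 2) * sD.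
    by field; rewrite gt_eqF.
  rewrite lerD2l ler_wpM2r// mulrAC ler_pdivrMr//.
  by rewrite -[leRHS]mulrA ler_wpM2l.
move: le2 le3; move: (16 * L / theta * Delta) (20 / (1 - beta) * (S0 + E)) => u v.
move: (L ^+ 2) => L2; rewrite -!(mulrA _ L2); move: (L2 * sD) => z; lra.
Qed.

End potential.

Section rate.
Context {R : realType}.

Lemma powR_exprn_inv (k : nat) (y : R) : (0 < k)%N -> 0 <= y ->
  (y ^+ k) `^ k%:R^-1 = y.
Proof.
by move=> k0 y0; rewrite -powR_mulrn// -powRrM divff ?pnatr_eq0 -?lt0n// powRr1.
Qed.

Lemma powR_3_2 (D : R) : 0 <= D -> D `^ (3 / 2) = (D `^ 2^-1) ^+ 3.
Proof. by move=> D0; rewrite -powR_mulrn ?powR_ge0// -powRrM; congr (_ `^ _); ring. Qed.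

Lemma powR_half_sqr (D : R) : 0 <= D -> (D `^ 2^-1) ^+ 2 = D.
Proof. by move=> D0; rewrite powR12_sqrt// sqr_sqrtr. Qed.

Variables (c1 : R) (b T : nat).
Hypotheses (c10 : 0 < c1) (b0 : (0 < b)%N).
Let x : R := (b%:R * T.+1%:R) `^ 3^-1.
Let bR : R := b%:R.
Let bR0 : 0 < bR. Proof. by rewrite ltr0n. Qed.

Lemma rate_root_gt0 : 0 < x.
Proof. by rewrite powR_gt0// mulr_gt0// ltr0n. Qed.
Let x0 := rate_root_gt0.

Lemma rate_root_cube : x ^+ 3 = b%:R * T.+1%:R.
Proof.
rewrite -powR_mulrn ?powR_ge0// -powRrM mulVf ?pnatr_eq0// powRr1// mulr_ge0.
Qed.

Lemma rate_root_sqr : (b%:R * T.+1%:R) `^ (2 / 3) = x ^+ 2.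
Proof. by rewrite -powR_mulrn ?powR_ge0// -powRrM; congr (_ `^ _); ring. Qed.

Let hb0N : hb0_real c1 b T * T.+1%:R = c1 ^+ 2 * x ^+ 4 / bR.
Proof.
rewrite /hb0_real -/x (exprS x 3) rate_root_cube -/bR; move: (T.+1%:R) => N.
by field; rewrite gt_eqF.
Qed.

(** The quantity [hb0 (T + 1)] is [(c1 x^2)^2 / b], a perfect square up to [b]. *)
Lemma beta_cstE : beta_cst c1 b T = 1 - bR / (c1 * x ^+ 2).
Proof.
rewrite /beta_cst hb0N -/bR; congr (1 - _).
set s := bR `^ 2^-1; have s2 : s ^+ 2 = bR by rewrite powR_half_sqr ?ltW.
have s0 : 0 < s by rewrite powR_gt0.
have -> : c1 ^+ 2 * x ^+ 4 / bR = (c1 * x ^+ 2 / s) ^+ 2.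
  by rewrite -s2; field; rewrite gt_eqF.
rewrite powR_exprn_inv//; last by rewrite divr_ge0 ?mulr_ge0 ?sqr_ge0 ?ltW.
by rewrite -s2; field; rewrite !gt_eqF.
Qed.

Lemma theta_cstE L P : P != 0 ->
  theta_cst c1 L P b T = L * bR / (P * (Num.sqrt c1 * x)).
Proof.
move=> P0; rewrite /theta_cst hb0N -/bR.
set s := bR `^ 4^-1; have s4 : s ^+ 4 = bR.
  by rewrite -powR_mulrn ?powR_ge0// -powRrM mulVf ?pnatr_eq0// powRr1// ltW.
have s0 : 0 < s by rewrite powR_gt0.
have -> : bR `^ (3 / 4) = s ^+ 3.
  by rewrite -powR_mulrn ?powR_ge0// -powRrM; congr (_ `^ _); ring.
set r := Num.sqrt c1; have r0 : 0 < r by rewrite sqrtr_gt0.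
have r2 : r ^+ 2 = c1 by rewrite sqr_sqrtr// ltW.
have -> : c1 ^+ 2 * x ^+ 4 / bR = (r * x / s) ^+ 4.
  by rewrite -s4 -r2; field; rewrite gt_eqF.
rewrite powR_exprn_inv//; last by rewrite divr_ge0 ?mulr_ge0 ?ltW.
by rewrite -s4; field; rewrite P0 !gt_eqF.
Qed.

End rate.

Section batches.
Context {R : realType}.

(** The sizes of the two kinds of batches are balanced: averaging over
   [c0 m / gamma^2] evaluations of the function cancels the factor [gamma^-2] with
   which its error enters the weighted error. *)
Lemma batch_error_le (M c u v gamma c0 m B1 B2 : R) :
  0 < gamma -> 0 < c0 -> 0 < m -> 0 <= M -> 0 <= c -> 0 <= u -> 0 <= v ->
  c0 * m / gamma ^+ 2 <= B1 -> m <= B2 ->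
  M / gamma ^+ 2 * (u / B1) + c * (v / B2) <= (M * u / c0 + c * v) / m.
Proof.
move=> g0 c00 m0 M0 cn0 u0 v0 leB1 leB2.
have g2 : 0 < gamma ^+ 2 by rewrite exprn_gt0.
have B20 : 0 < B2 by exact: lt_le_trans leB2.
have cm0 : 0 < c0 * m / gamma ^+ 2 by rewrite divr_gt0 ?mulr_gt0.
have B10 : 0 < B1 by exact: lt_le_trans leB1.
rewrite mulrDl lerD//; last first.
  by rewrite -mulrA ler_wpM2l// ler_wpM2l// lef_pV2.
have -> : M * u / c0 / m = M / gamma ^+ 2 * (u / (c0 * m / gamma ^+ 2)).
  by field; rewrite !gt_eqF.
by rewrite ler_wpM2l ?divr_ge0 ?(ltW g2)// ler_wpM2l// lef_pV2.
Qed.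

Context {dX : measure_display} {Xi : measurableType dX} {p q n : nat}.
Variables (pb : problem R Xi p q n) (cs : constants R) (c0 kappa hkappa : R).
Hypotheses (c00 : 0 < c0) (kappa0 : 0 <= kappa) (hkappa0 : 0 <= hkappa).
Let k := spectral (Kmx pb).

Lemma P_cst_ge0 : 0 <= P_cst pb cs c0 kappa hkappa.
Proof.
by rewrite mulr_ge0 ?sqrtr_ge0// divr_ge0 ?mulr_ge0 ?sqrtr_ge0 ?spectral_ge0.
Qed.

(** [P] and [Q] collect the drift and the noise coefficients of the weighted error;
    the factor 9/26 normalizes both. *)
Lemma P_cst_sqr : 9 / 26 * P_cst pb cs c0 kappa hkappa ^+ 2 =
  M_F cs ^+ 2 * k ^+ 4 * (kappa * M_F cs ^+ 2) / c0
  + k ^+ 2 * M_psi cs ^+ 2 * (hkappa * L_F cs ^+ 2).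
Proof.
rewrite /P_cst -/k; set w := (X in _ * Num.sqrt X).
have w0 : 0 <= w.
  apply: addr_ge0; first by rewrite mulr_ge0 ?sqr_ge0// mulr_ge0// exprn_even_ge0.
  by rewrite mulr_ge0 ?sqr_ge0// mulr_ge0 ?sqr_ge0// mulr_ge0// ltW.
rewrite exprMn sqr_sqrtr// expr_div_n !exprMn !sqr_sqrtr ?ltW//.
by rewrite /w; move: k => z; field; rewrite gt_eqF.
Qed.

Lemma Q_cstE : 9 / 26 * Q_cst pb cs c0 kappa hkappa =
  M_F cs ^+ 2 * k ^+ 4 * (kappa * sigma_F cs ^+ 2) / c0
  + k ^+ 2 * M_psi cs ^+ 2 * (hkappa * sigma_J cs ^+ 2).
Proof. by rewrite /Q_cst -/k; move: k => z; field; rewrite gt_eqF. Qed.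

Lemma Q_cst_ge0 : 0 <= Q_cst pb cs c0 kappa hkappa.
Proof.
rewrite -(@pmulr_rge0 _ (9 / 26)) ?divr_gt0// Q_cstE.
apply: addr_ge0; last by rewrite mulr_ge0// mulr_ge0 ?sqr_ge0.
rewrite divr_ge0// ?(ltW c00)// mulr_ge0//; first by rewrite mulr_ge0 ?sqr_ge0// exprn_even_ge0.
by rewrite mulr_ge0 ?sqr_ge0.
Qed.

End batches.

Section rate_bound.
Context {R : realType}.

(** Here [m] stands for the batch size [b], [r] for the square root of [c1] and [x]
    for the cube root of [b (T + 1)], in terms of which [theta = L m / (P r x)] and
    [1 - beta = m / (r^2 x^2)]; each contribution is then of order [x^-2].  The
    factor 24 leaves room for 180/13. *)
Lemma rate_bound (x m r P Q L gap : R) (T : nat) :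
  0 < x -> 0 < m -> 0 < r -> 0 < P -> 0 <= Q -> 0 < L ->
  x ^+ 3 = m * T.+1%:R ->
  T.+1%:R^-1 * (16 * L / (L * m / (P * (r * x))) * gap
     + 20 / (m / (r ^+ 2 * x ^+ 2)) * (9 / 26 * Q / ((r ^+ 2) ^+ 2 * x)
       + T%:R * ((m / (r ^+ 2 * x ^+ 2)) ^+ 2 * (9 / 26 * Q / m))))
  <= (16 * r * P * gap + 24 * Q / r ^+ 2) / x ^+ 2.
Proof.
move=> x0 m0 r0 P0 Q0 L0 x3.
have N0 : 0 < T.+1%:R :> R by rewrite ltr0n.
have ND : T%:R = T.+1%:R - 1 :> R by rewrite -natr1 addrK.
have NE : T.+1%:R = x ^+ 3 / m :> R by rewrite x3 mulrAC divff ?mul1r// gt_eqF.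
rewrite ND NE; set N := x ^+ 3 / m.
have -> : N^-1 * (16 * L / (L * m / (P * (r * x))) * gap
     + 20 / (m / (r ^+ 2 * x ^+ 2)) * (9 / 26 * Q / ((r ^+ 2) ^+ 2 * x)
       + (N - 1) * ((m / (r ^+ 2 * x ^+ 2)) ^+ 2 * (9 / 26 * Q / m)))) =
  (16 * r * P * gap + 180 / 13 * Q / r ^+ 2) / x ^+ 2
   - 90 / 13 * Q * m / (r ^+ 2 * x ^+ 5).
  by rewrite /N; field; rewrite !gt_eqF.
rewrite lerBlDr ler_wpDr//.
  rewrite divr_ge0//; first by rewrite mulr_ge0 ?(ltW m0)// mulr_ge0// divr_ge0.
  by rewrite mulr_ge0 ?sqr_ge0// exprn_ge0// ltW.
rewrite ler_wpM2r ?invr_ge0 ?sqr_ge0// lerD2l ler_wpM2r ?invr_ge0 ?sqr_ge0//.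
rewrite ler_wpM2r//; lra.
Qed.

(** The condition under which the drift is absorbed dictates the averaging weight:
    [theta] is chosen so that the two sides are of the same order, the left one
    being at most 45/52 of the right one. *)
Lemma drift_dominated (x m r P L beta : R) :
  0 < x -> 0 < m -> 0 < r -> 0 < P -> 0 <= beta < 1 ->
  5 / 2 * (L * m / (P * (r * x))) ^+ 2 * (9 / 26 * P ^+ 2 / m) * beta ^+ 2 <=
  L ^+ 2 * (m / (r ^+ 2 * x ^+ 2)).
Proof.
move=> x0 m0 r0 P0 /andP[be0 be1].
have b1 : beta ^+ 2 <= 1 by rewrite expr_le1// ltW.
have -> : 5 / 2 * (L * m / (P * (r * x))) ^+ 2 * (9 / 26 * P ^+ 2 / m) * beta ^+ 2 =
   (45 / 52 * beta ^+ 2) * (L ^+ 2 * (m / (r ^+ 2 * x ^+ 2))).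
  by field; rewrite !gt_eqF.
rewrite ler_piMl//.
  by rewrite mulr_ge0 ?sqr_ge0// divr_ge0 ?(ltW m0)// mulr_ge0 ?sqr_ge0.
move: b1; move: (beta ^+ 2) => z; lra.
Qed.

End rate_bound.

Section complexity.
Context {R : realType}.

Lemma iteration_boundE (Delta eps : R) (b : nat) : 0 <= Delta ->
  iteration_bound Delta b eps = (Delta `^ 2^-1) ^+ 3 / (b%:R * eps ^+ 3).
Proof. by move=> D0; rewrite /iteration_bound powR_3_2. Qed.

Lemma ratio_sqr_le (Delta x eps : R) : 0 <= Delta -> 0 < x -> 0 < eps ->
  Delta `^ 2^-1 <= x * eps -> Delta / x ^+ 2 <= eps ^+ 2.
Proof.
move=> D0 x0 e0 le; rewrite ler_pdivrMr ?exprn_gt0// -exprMn -{1}(powR_half_sqr D0).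
by rewrite [eps * x]mulrC ler_sqr ?nnegrE ?powR_ge0// mulr_ge0 ?(ltW e0) ?(ltW x0).
Qed.

Section iteration_number.
Variables (Delta eps : R) (b T : nat).
Hypotheses (D0 : 0 <= Delta) (e0 : 0 < eps) (b0 : (0 < b)%N).
Let y := Delta `^ 2^-1.
Let x := (b%:R * T.+1%:R) `^ 3^-1 : R.
Let y0 : 0 <= y. Proof. exact: powR_ge0. Qed.
Let x0 : 0 < x. Proof. exact: rate_root_gt0. Qed.
Let x3 : x ^+ 3 = b%:R * T.+1%:R. Proof. exact: rate_root_cube. Qed.
Let bR0 : 0 < b%:R :> R. Proof. by rewrite ltr0n. Qed.

(** The evaluation counts are governed by [T * b], whose bound is that of the
    iteration number. *)
Let bound_le (N : R) : N <= iteration_bound Delta b eps -> N * b%:R <= y ^+ 3 / eps ^+ 3.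
Proof.
by rewrite iteration_boundE// -/y invfM [b%:R^-1 * _]mulrC mulrA ler_pdivlMr.
Qed.

(** The floor satisfies [T + 1 > iteration_bound], which is what the rate in terms
    of [T + 1] asks for; passing from [T] to [T + 1] in the size of the initial
    batch costs the cube root of [b], by subadditivity of the cube root. *)
Lemma floor_iterations : Posz T = Num.floor (iteration_bound Delta b eps) ->
  [/\ Delta / x ^+ 2 <= eps ^+ 2, x <= y / eps + b%:R `^ 3^-1
    & T%:R * b%:R <= y ^+ 3 / eps ^+ 3].
Proof.
move=> TE; set I := iteration_bound Delta b eps in TE *.
have [leI ltI] : T%:R <= I /\ I < T.+1%:R.
  have /andP[] := floor_itv I; rewrite -TE => h1 h2; split=> //.
  by move: h2; rewrite -natr1 -[T%:R]/((Posz T)%:~R) intrD.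
have Tb := bound_le leI; split=> //.
- apply: ratio_sqr_le => //; rewrite -/y.
  rewrite -(@ler_pXn2r _ 3) ?nnegrE// ?mulr_ge0 ?(ltW e0) ?(ltW x0)//.
  rewrite exprMn x3; move: ltI; rewrite /I iteration_boundE// -/y.
  rewrite ltr_pdivrMr ?mulr_gt0 ?exprn_gt0// => /ltW.
  by rewrite mulrA [_ * b%:R]mulrC.
- set r := b%:R `^ 3^-1; have r0 : 0 <= r by exact: powR_ge0.
  have r3 : r ^+ 3 = b%:R.
    by rewrite -powR_mulrn// -powRrM mulVf ?pnatr_eq0// powRr1// ltW.
  have s0 : 0 <= y / eps by rewrite divr_ge0// ltW.
  rewrite -(@ler_pXn2r _ 3) ?nnegrE ?addr_ge0 ?(ltW x0)//.
  rewrite x3 -natr1 mulrDr mulr1 [_ * T%:R]mulrC.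
  apply: (@le_trans _ _ ((y / eps) ^+ 3 + r ^+ 3)); first by rewrite r3 lerD2r expr_div_n.
  clear r3; move: s0 r0; move: (y / eps) r => s r' s0 r0.
  have : 0 <= s ^+ 2 * r' by rewrite mulr_ge0 ?sqr_ge0.
  have : 0 <= s * r' ^+ 2 by rewrite mulr_ge0 ?sqr_ge0.
  have -> : (s + r') ^+ 3 = s ^+ 3 + r' ^+ 3 + 3 * (s ^+ 2 * r') + 3 * (s * r' ^+ 2) by ring.
  move: (s ^+ 3) (r' ^+ 3) (s ^+ 2 * r') (s * r' ^+ 2) => u v w z; lra.
Qed.

Lemma exact_iterations : T.+1%:R = iteration_bound Delta b eps ->
  [/\ Delta / x ^+ 2 <= eps ^+ 2, x = y / eps & T%:R * b%:R <= y ^+ 3 / eps ^+ 3].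
Proof.
move=> TE.
have xy : x = y / eps.
  have s0 : 0 <= y / eps by rewrite divr_ge0// ltW.
  apply/eqP; rewrite -(@eqrXn2 _ 3) ?(ltW x0)//; apply/eqP.
  rewrite x3 TE iteration_boundE// -/y expr_div_n; move: y0 e0 => _ _.
  by field; rewrite !gt_eqF.
split=> //; last by apply: bound_le; rewrite -TE ler_nat.
by apply: ratio_sqr_le => //; rewrite -/y xy divfK// gt_eqF.
Qed.

End iteration_number.

(** The first terms of the evaluation bounds are of lower order as [eps] tends to
   0; for [y = 0] both sides are 0. *)
Lemma lower_order_term (y w eps : R) : 0 <= y -> 0 < w -> 0 < eps <= 1 ->
  y / (w * eps) <= (y ^+ 2)^-1 * (y ^+ 3 / (w * eps ^+ 3)).
Proof.
rewrite le_eqVlt => /predU1P[<-|y0] w0 /andP[e0 e1].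
  by rewrite !expr0n/= !mul0r mulr0.
have -> : (y ^+ 2)^-1 * (y ^+ 3 / (w * eps ^+ 3)) = y / (w * eps) / eps ^+ 2.
  by field; rewrite !gt_eqF.
rewrite ler_pdivlMr ?exprn_gt0// ler_piMr//.
  by rewrite divr_ge0 ?mulr_ge0 ?ltW.
by rewrite expr_le1// ltW.
Qed.

Lemma evaluations_le (c0 c1 Delta w eps : R) : 0 <= c0 -> 0 <= Delta -> 0 < w ->
  0 < eps <= 1 ->
  `|c0 * c1 ^+ 2 * Delta `^ 2^-1 / (w * eps) + 3 * c0 * Delta `^ (3 / 2) / (w * eps ^+ 3)|
  <= (c0 * c1 ^+ 2 / Delta + 3 * c0) * `|Delta `^ (3 / 2) / (w * eps ^+ 3)|.
Proof.
move=> c00 D0 w0 e01; have /andP[e0 e1] := e01.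
have y0 : 0 <= Delta `^ 2^-1 by exact: powR_ge0.
rewrite powR_3_2// -{3}(powR_half_sqr D0).
have := lower_order_term y0 w0 e01.
move: (Delta `^ 2^-1) y0 => y y0 le.
have we : 0 < w * eps ^+ 3 by rewrite mulr_gt0// exprn_gt0.
have z0 : 0 <= y ^+ 3 / (w * eps ^+ 3) by rewrite divr_ge0 ?exprn_ge0 ?(ltW we).
have c0c1 : 0 <= c0 * c1 ^+ 2 by rewrite mulr_ge0 ?sqr_ge0.
have u0 : 0 <= y / (w * eps) by rewrite divr_ge0// mulr_ge0 ?(ltW w0) ?(ltW e0).
rewrite -(mulrA _ y) -(mulrA (3 * c0)) (ger0_norm z0).
have k0 : 0 <= 3 * c0 by rewrite mulr_ge0.
rewrite ger0_norm; last by rewrite addr_ge0// mulr_ge0.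
clear k0; by move: (3 * c0) => k; rewrite mulrDl lerD2r -(mulrA _ (y ^+ 2)^-1) ler_wpM2l.
Qed.

End complexity.

(** * Adaptedness of the iterates *)

Section generated_sigma_algebras.
Context {T : pointedType}.
Implicit Types G : set (set T).

Lemma sigma_algebra_mono G G' : G `<=` <<s G' >> -> <<s G >> `<=` <<s G' >>.
Proof. by move=> GG'; apply: smallest_sub => //; exact: smallest_sigma_algebra. Qed.

Lemma measurable_fun_gsigma_mono {d} {U : measurableType d} G G' (g : T -> U) :
  G `<=` <<s G' >> ->
  measurable_fun (setT : set (g_sigma_algebraType G)) (g : g_sigma_algebraType G -> U) ->
  measurable_fun (setT : set (g_sigma_algebraType G')) (g : g_sigma_algebraType G' -> U).
Proof.
move=> GG' mg _ Y mY; have := mg measurableT Y mY.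
exact: (sigma_algebra_mono GG').
Qed.

Lemma measurable_fun_gsigma_gen {d} {U : measurableType d} G (g : T -> U) :
  (forall A, measurable A -> G (g @^-1` A)) ->
  measurable_fun (setT : set (g_sigma_algebraType G)) (g : g_sigma_algebraType G -> U).
Proof.
move=> gG _ Y mY; rewrite setTI.
exact: sub_sigma_algebra (gG _ mY).
Qed.

End generated_sigma_algebras.

Section measurable_products.
Context {R : realType} {d : measure_display} {T : measurableType d}.

Lemma measurable_mx_mul k l m (A : T -> 'M[R]_(k, l)) (B : T -> 'M[R]_(l, m)) :
  measurable_mx A -> measurable_mx B -> measurable_mx (fun w => A w *m B w).
Proof.
move=> mA mB i j; under eq_fun do rewrite mxE.
by apply: measurable_sum => c; apply: measurable_funM; [exact: mA|exact: mB].
Qed.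

Lemma measurable_mx_tr k l (A : T -> 'M[R]_(k, l)) :
  measurable_mx A -> measurable_mx (fun w => (A w)^T).
Proof. by move=> mA i j; under eq_fun do rewrite mxE; exact: mA. Qed.

Lemma measurable_mx_lipschitz k l (C : R) (g : 'cV[R]_k -> 'cV[R]_l) (x : T -> 'cV[R]_k) :
  0 <= C -> (forall u v, frob (g u - g v) <= C * frob (u - v)) ->
  measurable_mx x -> measurable_mx (fun w => g (x w)).
Proof.
move=> C0 gC mx i j.
apply: (@measurable_comp_continuous _ _ _ _ x (fun z _ => g z i j)) => // w.
apply: (@frob_lipschitz_continuous _ _ _ _ C) => // u v.
by rewrite -mxBE (le_trans (entry_le_frob _ _ _)).
Qed.

End measurable_products.

Section iterates.
Context {R : realType} {dX dO : measure_display}.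
Context {Xi : measurableType dX} {Omega : measurableType dO}.
Variables (Pr : probability Omega R) (p q n : nat).
Variables (pb : problem R Xi p q n) (cs : constants R) (d : 'cV[R]_n -> R).
Hypotheses (Hpb : standing_assumptions pb cs) (Hd : smoothing_function pb d).
Variables (gamma beta theta : R) (x0 : 'cV[R]_p) (T : nat).
Variables (bs : batch_sizes) (smp : samples Xi Omega) (sch : schedule R).
Variable tr : trajectory R Omega p q.
Hypothesis gamma0 : 0 < gamma.
Hypothesis theta01 : 0 < theta <= 1.
Let L := L_Phi pb cs gamma.
Hypothesis L0 : 0 < L.
Let eta := eta_cst L theta.
Hypothesis Hsch : forall t, [/\ gamma_ sch t = gamma, beta_ sch t = beta,
  hbeta_ sch t = beta, theta_ sch t = theta & eta_ sch t = eta].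
Hypothesis Hx0 : dom (Psi0 pb) x0.
Hypothesis Hsamp : sampling Pr (law pb) bs smp T.
Hypothesis Hgen : generated bs smp pb d sch x0 T tr.

Let gam t : gamma_ sch t = gamma. Proof. by case: (Hsch t). Qed.
Let bet t : beta_ sch t = beta. Proof. by case: (Hsch t). Qed.
Let hbet t : hbeta_ sch t = beta. Proof. by case: (Hsch t). Qed.
Let the t : theta_ sch t = theta. Proof. by case: (Hsch t). Qed.
Let et t : eta_ sch t = eta. Proof. by case: (Hsch t). Qed.

Let eta0 : 0 < eta. Proof. exact: eta_gt0. Qed.

Lemma xhatE t w : (t <= T)%N -> xhat tr t.+1 w = prox eta (reg pb)
  (xs tr t w - eta *: ((Jt tr t w)^T *m Kmx pb *m ystar pb d gamma (Ft tr t w))).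
Proof. by move=> tT; rewrite (gen_xhat Hgen _ tT) et (gen_v Hgen _ tT) gam. Qed.

Lemma xsE t w : (t <= T)%N ->
  xs tr t.+1 w = (1 - theta) *: xs tr t w + theta *: xhat tr t.+1 w.
Proof. by move=> tT; rewrite (gen_x Hgen _ tT) the. Qed.

Lemma xs_dom t w : (t <= T.+1)%N -> dom (Psi0 pb) (xs tr t w).
Proof.
elim: t => [|t IH] tT; first by rewrite (gen_x0 Hgen).
rewrite xsE// xhatE//; apply: next_point_dom => //.
by apply: IH; exact: ltnW.
Qed.

(** The sigma-algebras of the past and of the current iteration become measurable
    structures on copies of [Omega]; the identity maps into these copies are then
    the independent random elements to which the previous part applies. *)
Definition past_events (t : nat) : set (set Omega) :=
  \bigcup_(s in `I_t) iteration_events bs smp s.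
Notation H t := (g_sigma_algebraType (past_events t)).
Notation Now t := (g_sigma_algebraType (iteration_events bs smp t)).

Lemma iteration_events_measurable t : (t <= T)%N ->
  iteration_events bs smp t `<=` measurable.
Proof.
have ev m X : iid_batch Pr (law pb) m X -> events m X `<=` measurable.
  move=> [hX _] E [i [A [im mA ->]]]; rewrite -[X in measurable X]setTI.
  by case: (hX _ im) => mX _; exact: mX.
case: t => [_|t tT] E.
  by case; apply: ev; [exact: (iid0 Hsamp)|exact: (hiid0 Hsamp)].
have t1 : (0 < t.+1 <= T)%N by [].
by case=> [[[]|]|]; apply: ev; [exact: (iid1 Hsamp t1)|exact: (hiid1 Hsamp t1)|
  exact: (iid2 Hsamp t1)|exact: (hiid2 Hsamp t1)].
Qed.

Lemma past_measurable t (tT : (t <= T.+1)%N) :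
  measurable_fun setT (id : Omega -> H t).
Proof.
move=> _ A mA; rewrite setTI preimage_id.
move: A mA; apply: smallest_sub; first exact: sigma_algebra_measurable.
move=> E [s /= st]; apply: iteration_events_measurable.
by rewrite -ltnS (leq_trans st).
Qed.

Lemma now_measurable t (tT : (t <= T)%N) : measurable_fun setT (id : Omega -> Now t).
Proof.
move=> _ A mA; rewrite setTI preimage_id.
move: A mA; apply: smallest_sub; first exact: sigma_algebra_measurable.
exact: iteration_events_measurable.
Qed.

Lemma past_now_indep t : (0 < t <= T)%N -> forall (A : set (H t)) (B : set (Now t)),
  measurable A -> measurable B ->
  Pr ((id : Omega -> H t) @^-1` A `&` (id : Omega -> Now t) @^-1` B) =
  (Pr ((id : Omega -> H t) @^-1` A) * Pr ((id : Omega -> Now t) @^-1` B))%E.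
Proof.
move=> tT A B mA mB; rewrite setIC muleC.
exact: (fresh Hsamp tT).
Qed.

Lemma past_mx_mono s t k l (g : Omega -> 'M[R]_(k, l)) : (s <= t)%N ->
  @measurable_mx R _ (H s) k l g -> @measurable_mx R _ (H t) k l g.
Proof.
move=> st mg i j.
apply: (measurable_fun_gsigma_mono (g := fun w => g w i j)) (mg i j) => E [r /= rs Er].
by apply: sub_sigma_algebra; exists r => //=; exact: leq_trans st.
Qed.

Lemma batch_events_measurable m (X : nat -> Omega -> Xi) i s t : (i < m)%N ->
  events m X `<=` iteration_events bs smp s -> (s < t)%N ->
  measurable_fun setT (X i : H t -> Xi).
Proof.
move=> im sub st; apply: measurable_fun_gsigma_gen => A mA.
by exists s => //=; apply: sub; exists i, A.
Qed.

Lemma batch_now_measurable m (X : nat -> Omega -> Xi) i t : (i < m)%N ->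
  events m X `<=` iteration_events bs smp t -> measurable_fun setT (X i : Now t -> Xi).
Proof.
move=> im sub; apply: measurable_fun_gsigma_gen => A mA.
by apply: sub; exists i, A.
Qed.

Lemma events_batch0 : events (b0 bs) (batch0 smp) `<=` iteration_events bs smp 0.
Proof. by move=> E; left. Qed.
Lemma events_hbatch0 : events (hb0 bs) (hbatch0 smp) `<=` iteration_events bs smp 0.
Proof. by move=> E; right. Qed.
Lemma events_batch1 t : events (b1 bs) (batch1 smp t.+1) `<=` iteration_events bs smp t.+1.
Proof. by move=> E; left; left; left. Qed.
Lemma events_hbatch1 t :
  events (hb1 bs) (hbatch1 smp t.+1) `<=` iteration_events bs smp t.+1.
Proof. by move=> E; left; left; right. Qed.
Lemma events_batch2 t : events (b2 bs) (batch2 smp t.+1) `<=` iteration_events bs smp t.+1.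
Proof. by move=> E; left; right. Qed.
Lemma events_hbatch2 t :
  events (hb2 bs) (hbatch2 smp t.+1) `<=` iteration_events bs smp t.+1.
Proof. by move=> E; right. Qed.

Let mx_meas t k l (A : Omega -> 'M[R]_(k, l)) := @measurable_mx R _ (H t) k l A.

Lemma xhat_adapted t : (t <= T)%N -> mx_meas t (xs tr t) ->
  mx_meas t.+1 (Ft tr t) -> mx_meas t.+1 (Jt tr t) -> mx_meas t.+1 (xhat tr t.+1).
Proof.
move=> tT mx mF mJ.
have -> : xhat tr t.+1 = fun w => prox eta (reg pb)
  (xs tr t w - eta *: ((Jt tr t w)^T *m Kmx pb *m ystar pb d gamma (Ft tr t w))).
  by apply/funext => w; exact: xhatE.
apply: (@measurable_mx_lipschitz R _ (H t.+1) _ _ 1 (prox eta (reg pb))) => //.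
  move=> u v; rewrite mul1r.
  exact: (prox_nonexpansive (reg_proper Hpb) (reg_closed Hpb) (reg_convex Hpb) eta0).
apply: (@measurable_mxB _ _ (H t.+1)); first exact: past_mx_mono mx.
apply: (@measurable_mxZ _ _ (H t.+1)).
apply: (@measurable_mx_mul _ _ (H t.+1)).
  by apply: (@measurable_mulmx_cst _ _ (H t.+1)); exact: (@measurable_mx_tr _ _ (H t.+1)).
apply: (@measurable_mx_lipschitz R _ (H t.+1) _ _ (spectral (Kmx pb) / gamma)) => //.
  by rewrite divr_ge0 ?spectral_ge0// ltW.
exact: (ystar_lipschitz Hpb Hd gamma0).
Qed.

Lemma next_adapted t : (t <= T)%N -> mx_meas t (xs tr t) ->
  mx_meas t.+1 (Ft tr t) -> mx_meas t.+1 (Jt tr t) -> mx_meas t.+1 (xs tr t.+1).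
Proof.
move=> tT mx mF mJ; have mxh := xhat_adapted tT mx mF mJ.
have -> : xs tr t.+1 = fun w => (1 - theta) *: xs tr t w + theta *: xhat tr t.+1 w.
  by apply/funext => w; exact: xsE.
by apply: (@measurable_mxD _ _ (H t.+1)); apply: (@measurable_mxZ _ _ (H t.+1)) => //;
  exact: past_mx_mono mx.
Qed.

(** The point [xs t] is determined by the iterations before [t], whereas the
    estimators at [t] also depend on the batches of iteration [t]. *)
Lemma iterates_adapted t : (t <= T)%N ->
  [/\ mx_meas t (xs tr t), mx_meas t.+1 (Ft tr t) & mx_meas t.+1 (Jt tr t)].
Proof.
elim: t => [_|t IH tT].
  split.
  - have -> : xs tr 0 = fun=> x0 by apply/funext => w; exact: (gen_x0 Hgen).
    exact: (@measurable_mx_cst _ _ (H 0)).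
  - have -> : Ft tr 0 = fun w => (b0 bs)%:R^-1 *: \sum_(i < b0 bs) FF pb x0 (batch0 smp i w).
      by apply/funext => w; exact: (gen_F0 Hgen).
    apply: (@measurable_mxZ _ _ (H 1)); apply: (@measurable_mx_sum _ _ (H 1)) => i _.
    apply: (@measurable_FF_comp _ _ _ _ _ _ _ _ Hpb _ (H 1) (fun=> x0)).
      exact: (@measurable_mx_cst _ _ (H 1)).
    exact: batch_events_measurable (ltn_ord i) events_batch0 _.
  - have -> : Jt tr 0 = fun w => (hb0 bs)%:R^-1 *: \sum_(i < hb0 bs) JF pb x0 (hbatch0 smp i w).
      by apply/funext => w; exact: (gen_J0 Hgen).
    apply: (@measurable_mxZ _ _ (H 1)); apply: (@measurable_mx_sum _ _ (H 1)) => i _.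
    apply: (@measurable_JF_comp _ _ _ _ _ _ _ _ Hpb _ (H 1) (fun=> x0)).
      exact: (@measurable_mx_cst _ _ (H 1)).
    exact: batch_events_measurable (ltn_ord i) events_hbatch0 _.
have [mx mF mJ] := IH (ltnW tT); have mx1 := next_adapted (ltnW tT) mx mF mJ.
have mx1' : mx_meas t.+2 (xs tr t.+1) by exact: past_mx_mono mx1.
have mx0' : mx_meas t.+2 (xs tr t) by apply: past_mx_mono mx; rewrite leqW.
have mF' : mx_meas t.+2 (Ft tr t) by exact: past_mx_mono mF.
have mJ' : mx_meas t.+2 (Jt tr t) by exact: past_mx_mono mJ.
split=> //.
- have -> : Ft tr t.+1 = fun w => beta *: Ft tr t w
    + (beta / (b1 bs)%:R) *: \sum_(i < b1 bs)
        (FF pb (xs tr t.+1 w) (batch1 smp t.+1 i w)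
         - FF pb (xs tr t w) (batch1 smp t.+1 i w))
    + ((1 - beta) / (b2 bs)%:R) *: \sum_(i < b2 bs)
        FF pb (xs tr t.+1 w) (batch2 smp t.+1 i w).
    by apply/funext => w; rewrite (gen_F Hgen _ tT) bet.
  have mb1 (i : 'I_(b1 bs)) := batch_events_measurable (ltn_ord i) (@events_batch1 t) (ltnSn _).
  have mb2 (i : 'I_(b2 bs)) := batch_events_measurable (ltn_ord i) (@events_batch2 t) (ltnSn _).
  apply: (@measurable_mxD _ _ (H t.+2)); first apply: (@measurable_mxD _ _ (H t.+2)).
  + exact: (@measurable_mxZ _ _ (H t.+2)).
  + apply: (@measurable_mxZ _ _ (H t.+2)); apply: (@measurable_mx_sum _ _ (H t.+2)) => i _.
    by apply: (@measurable_mxB _ _ (H t.+2));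
      apply: (@measurable_FF_comp _ _ _ _ _ _ _ _ Hpb _ (H t.+2)) => //; exact: mb1.
  + apply: (@measurable_mxZ _ _ (H t.+2)); apply: (@measurable_mx_sum _ _ (H t.+2)) => i _.
    by apply: (@measurable_FF_comp _ _ _ _ _ _ _ _ Hpb _ (H t.+2)) => //; exact: mb2.
- have -> : Jt tr t.+1 = fun w => beta *: Jt tr t w
    + (beta / (hb1 bs)%:R) *: \sum_(i < hb1 bs)
        (JF pb (xs tr t.+1 w) (hbatch1 smp t.+1 i w)
         - JF pb (xs tr t w) (hbatch1 smp t.+1 i w))
    + ((1 - beta) / (hb2 bs)%:R) *: \sum_(i < hb2 bs)
        JF pb (xs tr t.+1 w) (hbatch2 smp t.+1 i w).
    by apply/funext => w; rewrite (gen_J Hgen _ tT) hbet.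
  have mb1 (i : 'I_(hb1 bs)) := batch_events_measurable (ltn_ord i) (@events_hbatch1 t) (ltnSn _).
  have mb2 (i : 'I_(hb2 bs)) := batch_events_measurable (ltn_ord i) (@events_hbatch2 t) (ltnSn _).
  apply: (@measurable_mxD _ _ (H t.+2)); first apply: (@measurable_mxD _ _ (H t.+2)).
  + exact: (@measurable_mxZ _ _ (H t.+2)).
  + apply: (@measurable_mxZ _ _ (H t.+2)); apply: (@measurable_mx_sum _ _ (H t.+2)) => i _.
    by apply: (@measurable_mxB _ _ (H t.+2));
      apply: (@measurable_JF_comp _ _ _ _ _ _ _ _ Hpb _ (H t.+2)) => //; exact: mb1.
  + apply: (@measurable_mxZ _ _ (H t.+2)); apply: (@measurable_mx_sum _ _ (H t.+2)) => i _.
    by apply: (@measurable_JF_comp _ _ _ _ _ _ _ _ Hpb _ (H t.+2)) => //; exact: mb2.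
Qed.

(** * Moments along the trajectory *)

Let kappa : R := kappa_cst Pr bs smp T.
Let hkappa : R := hkappa_cst Pr bs smp T.
Hypotheses (b0_gt0 : (0 < b0 bs)%N) (hb0_gt0 : (0 < hb0 bs)%N).
Hypotheses (b1_gt0 : (0 < b1 bs)%N) (hb1_gt0 : (0 < hb1 bs)%N).
Hypotheses (b2_gt0 : (0 < b2 bs)%N) (hb2_gt0 : (0 < hb2 bs)%N).
Hypothesis gamma1 : gamma <= 1.

Notation integrable_real g := (Pr.-integrable setT (EFin \o g)).

Lemma ge0_integrable_le (g : Omega -> R) (c : R) : measurable_fun setT g ->
  (forall w, 0 <= g w) -> (\int[Pr]_w (g w)%:E <= c%:E)%E ->
  integrable_real g /\ \int[Pr]_w g w <= c.
Proof.
move=> mg g0 le; have ig : integrable_real g.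
  apply/integrableP; split; first exact/measurable_EFinP.
  under eq_integral do rewrite /= ger0_norm//.
  by rewrite (le_lt_trans le)// ltry.
by split=> //; rewrite -lee_fin EFin_Rintegral.
Qed.

Definition F_error t w := frob (Ft tr t w - Fmean pb (xs tr t w)) ^+ 2.
Definition J_error t w := frob (Jt tr t w - jac (Fmean pb) (xs tr t w)) ^+ 2.
Definition displacement t w := frob (xhat tr t.+1 w - xs tr t w) ^+ 2.

Lemma F_error_adapted t : (t <= T)%N ->
  measurable_fun (setT : set (H t.+1)) (F_error t : H t.+1 -> R).
Proof.
move=> tT; have [mx mF _] := iterates_adapted tT.
apply: (@measurable_frob2 _ _ (H t.+1)); apply: (@measurable_mxB _ _ (H t.+1)) => //.
by apply: (@measurable_Fmean_comp _ _ _ _ _ _ _ _ Hpb _ (H t.+1)); exact: past_mx_mono mx.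
Qed.

Lemma J_error_adapted t : (t <= T)%N ->
  measurable_fun (setT : set (H t.+1)) (J_error t : H t.+1 -> R).
Proof.
move=> tT; have [mx _ mJ] := iterates_adapted tT.
apply: (@measurable_frob2 _ _ (H t.+1)); apply: (@measurable_mxB _ _ (H t.+1)) => //.
by apply: (@measurable_jac_Fmean_comp _ _ _ _ _ _ _ _ Hpb _ (H t.+1));
  exact: past_mx_mono mx.
Qed.

Lemma displacement_adapted t : (t <= T)%N ->
  measurable_fun (setT : set (H t.+1)) (displacement t : H t.+1 -> R).
Proof.
move=> tT; have [mx mF mJ] := iterates_adapted tT.
apply: (@measurable_frob2 _ _ (H t.+1)); apply: (@measurable_mxB _ _ (H t.+1)).
  exact: xhat_adapted.
exact: past_mx_mono mx.
Qed.

Lemma adapted_measurable t (g : Omega -> R) : (t <= T)%N ->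
  measurable_fun (setT : set (H t.+1)) (g : H t.+1 -> R) -> measurable_fun setT g.
Proof. by move=> tT mg; exact: (measurableT_comp mg (past_measurable _)). Qed.

Lemma next_displacement t w : (t <= T)%N ->
  frob (xs tr t.+1 w - xs tr t w) ^+ 2 = theta ^+ 2 * displacement t w.
Proof.
move=> tT; rewrite xsE// /displacement.
have -> : (1 - theta) *: xs tr t w + theta *: xhat tr t.+1 w - xs tr t w =
    theta *: (xhat tr t.+1 w - xs tr t w).
  by apply/matrixP => i j; rewrite !mxE; ring.
by rewrite frobZ exprMn real_normK ?num_real.
Qed.

Lemma kappa_cases : kappa = 2 \/ kappa = 1 /\ forall t, (0 < t <= T)%N ->
  forall i j, (i < b1 bs)%N -> (j < b2 bs)%N ->
    pair_indep Pr (batch1 smp t i) (batch2 smp t j).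
Proof.
rewrite /kappa /kappa_cst; case: asboolP => [h|_]; last by left.
right; split=> // t tT i j ib jb A B mA mB.
by apply: (h t tT); apply: sub_sigma_algebra; [exists i, A|exists j, B].
Qed.

Lemma hkappa_cases : hkappa = 2 \/ hkappa = 1 /\ forall t, (0 < t <= T)%N ->
  forall i j, (i < hb1 bs)%N -> (j < hb2 bs)%N ->
    pair_indep Pr (hbatch1 smp t i) (hbatch2 smp t j).
Proof.
rewrite /hkappa /hkappa_cst; case: asboolP => [h|_]; last by left.
right; split=> // t tT i j ib jb A B mA mB.
by apply: (h t tT); apply: sub_sigma_algebra; [exists i, A|exists j, B].
Qed.

Lemma FF_lip x y : dom (Psi0 pb) x -> dom (Psi0 pb) y ->
  (\int[law pb]_s (frob (FF pb y s - FF pb x s) ^+ 2)%:E <=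
   (M_F cs ^+ 2 * frob (y - x) ^+ 2)%:E)%E.
Proof. exact: FF_mean_square_lipschitz Hpb Hd _ _. Qed.

Lemma FF_var x : dom (Psi0 pb) x ->
  (\int[law pb]_s (frob (FF pb x s - Fmean pb x) ^+ 2)%:E <= (sigma_F cs ^+ 2)%:E)%E.
Proof. by move=> hx; have := FF_variance Hpb hx; rewrite expectationE. Qed.

Lemma JF_lip x y : dom (Psi0 pb) x -> dom (Psi0 pb) y ->
  (\int[law pb]_s (frob (JF pb y s - JF pb x s) ^+ 2)%:E <=
   (L_F cs ^+ 2 * frob (y - x) ^+ 2)%:E)%E.
Proof. by move=> hx hy; have := JF_lipschitz Hpb hy hx; rewrite expectationE. Qed.

Lemma JF_var x : dom (Psi0 pb) x ->
  (\int[law pb]_s (frob (JF pb x s - jac (Fmean pb) x) ^+ 2)%:E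
   <= (sigma_J cs ^+ 2)%:E)%E.
Proof. by move=> hx; have := JF_variance Hpb hx; rewrite expectationE. Qed.

Lemma F_error0 : integrable_real (F_error 0) /\
  \int[Pr]_w F_error 0 w <= sigma_F cs ^+ 2 / (b0 bs)%:R.
Proof.
apply: ge0_integrable_le.
- by apply: adapted_measurable (F_error_adapted _).
- by move=> w; exact: sqr_ge0.
under eq_integral do rewrite /F_error (gen_F0 Hgen) (gen_x0 Hgen).
exact: (initial_moment (@measurable_FF_comp _ _ _ _ _ _ _ _ Hpb)
  (FF_int Hpb) (@Fmean_entry _ _ _ _ _ _ pb) FF_var b0_gt0 (iid0 Hsamp) Hx0).
Qed.

Lemma J_error0 : integrable_real (J_error 0) /\
  \int[Pr]_w J_error 0 w <= sigma_J cs ^+ 2 / (hb0 bs)%:R.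
Proof.
apply: ge0_integrable_le.
- by apply: adapted_measurable (J_error_adapted _).
- by move=> w; exact: sqr_ge0.
under eq_integral do rewrite /J_error (gen_J0 Hgen) (gen_x0 Hgen).
exact: (initial_moment (@measurable_JF_comp _ _ _ _ _ _ _ _ Hpb)
  (JF_int Hpb) (jac_Fmean_entry Hpb) JF_var hb0_gt0 (hiid0 Hsamp) Hx0).
Qed.

Lemma F_error_step t : (t < T)%N -> integrable_real (F_error t) ->
  integrable_real (displacement t) -> integrable_real (F_error t.+1) /\
  \int[Pr]_w F_error t.+1 w <= beta ^+ 2 * \int[Pr]_w F_error t w
    + kappa * beta ^+ 2 * M_F cs ^+ 2 / (b1 bs)%:R * (theta ^+ 2 * \int[Pr]_w displacement t w)
    + kappa * (1 - beta) ^+ 2 * sigma_F cs ^+ 2 / (b2 bs)%:R.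
Proof.
move=> tT iF iD; have tT' := ltnW tT; have t1 : (0 < t.+1 <= T)%N by [].
have [mx mF mJ] := iterates_adapted tT'; have mx1 := next_adapted tT' mx mF mJ.
have mx0 : mx_meas t.+1 (xs tr t) by exact: past_mx_mono mx.
have mX i (ib : (i < b1 bs)%N) := batch_now_measurable ib (@events_batch1 t).
have mY i (ib : (i < b2 bs)%N) := batch_now_measurable ib (@events_batch2 t).
have hk : kappa = 2 \/ kappa = 1 /\ (forall i j, (i < b1 bs)%N -> (j < b2 bs)%N ->
    pair_indep Pr (batch1 smp t.+1 i) (batch2 smp t.+1 j)).
  by case: kappa_cases => [->|[-> h]]; [left|right; split=> // i j; exact: h].
apply: ge0_integrable_le.
- exact: adapted_measurable (F_error_adapted _).
- by move=> w; exact: sqr_ge0.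
have le : (\int[Pr]_w (F_error t.+1 w)%:E <=
   (beta ^+ 2)%:E * \int[Pr]_w (F_error t w)%:E
   + (kappa * beta ^+ 2 * M_F cs ^+ 2 / (b1 bs)%:R)%:E *
       \int[Pr]_w (frob (xs tr t.+1 w - xs tr t w) ^+ 2)%:E
   + (kappa * (1 - beta) ^+ 2 * sigma_F cs ^+ 2 / (b2 bs)%:R)%:E)%E.
  rewrite [X in (X <= _)%E](eq_integral (fun w => (frob (beta *: Ft tr t w
    + (beta / (b1 bs)%:R) *: \sum_(i < b1 bs)
        (FF pb (xs tr t.+1 w) (batch1 smp t.+1 i w)
         - FF pb (xs tr t w) (batch1 smp t.+1 i w))
    + ((1 - beta) / (b2 bs)%:R) *: \sum_(i < b2 bs)
        FF pb (xs tr t.+1 w) (batch2 smp t.+1 i w) - Fmean pb (xs tr t.+1 w)) ^+ 2)%:E));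
    last by move=> w _; rewrite /F_error (gen_F Hgen _ tT) bet.
  exact: (@hybrid_moment _ _ _ _ _ Pr (law pb) _ _ _ (dom (Psi0 pb)) (FF pb) (Fmean pb)
    (M_F cs) (sigma_F cs) (@measurable_FF_comp _ _ _ _ _ _ _ _ Hpb)
    (@measurable_Fmean_comp _ _ _ _ _ _ _ _ Hpb) (FF_int Hpb) (@Fmean_entry _ _ _ _ _ _ pb)
    FF_lip FF_var _ _ (H t.+1) (Now t.+1) id id (past_measurable (leqW tT))
    (now_measurable tT) (past_now_indep t1) (xs tr t) (xs tr t.+1) (Ft tr t) mx0 mx1 mF
    (fun w => xs_dom w (leqW tT')) (fun w => xs_dom w (leqW tT)) (b1 bs) (b2 bs)
    (batch1 smp t.+1) (batch2 smp t.+1) b1_gt0 b2_gt0 mX mY (iid1 Hsamp t1)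
    (iid2 Hsamp t1) kappa beta hk).
apply: (le_trans le).
under [X in (_ + _ * X + _)%E]eq_integral do rewrite (next_displacement _ tT') EFinM.
by rewrite integralZl//= -EFin_Rintegral// -EFin_Rintegral//.
Qed.

Lemma J_error_step t : (t < T)%N -> integrable_real (J_error t) ->
  integrable_real (displacement t) -> integrable_real (J_error t.+1) /\
  \int[Pr]_w J_error t.+1 w <= beta ^+ 2 * \int[Pr]_w J_error t w
    + hkappa * beta ^+ 2 * L_F cs ^+ 2 / (hb1 bs)%:R * (theta ^+ 2 * \int[Pr]_w displacement t w)
    + hkappa * (1 - beta) ^+ 2 * sigma_J cs ^+ 2 / (hb2 bs)%:R.
Proof.
move=> tT iF iD; have tT' := ltnW tT; have t1 : (0 < t.+1 <= T)%N by [].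
have [mx mF mJ] := iterates_adapted tT'; have mx1 := next_adapted tT' mx mF mJ.
have mx0 : mx_meas t.+1 (xs tr t) by exact: past_mx_mono mx.
have mX i (ib : (i < hb1 bs)%N) := batch_now_measurable ib (@events_hbatch1 t).
have mY i (ib : (i < hb2 bs)%N) := batch_now_measurable ib (@events_hbatch2 t).
have hk : hkappa = 2 \/ hkappa = 1 /\ (forall i j, (i < hb1 bs)%N -> (j < hb2 bs)%N ->
    pair_indep Pr (hbatch1 smp t.+1 i) (hbatch2 smp t.+1 j)).
  by case: hkappa_cases => [->|[-> h]]; [left|right; split=> // i j; exact: h].
apply: ge0_integrable_le.
- exact: adapted_measurable (J_error_adapted _).
- by move=> w; exact: sqr_ge0.
have le : (\int[Pr]_w (J_error t.+1 w)%:E <=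
   (beta ^+ 2)%:E * \int[Pr]_w (J_error t w)%:E
   + (hkappa * beta ^+ 2 * L_F cs ^+ 2 / (hb1 bs)%:R)%:E *
       \int[Pr]_w (frob (xs tr t.+1 w - xs tr t w) ^+ 2)%:E
   + (hkappa * (1 - beta) ^+ 2 * sigma_J cs ^+ 2 / (hb2 bs)%:R)%:E)%E.
  rewrite [X in (X <= _)%E](eq_integral (fun w => (frob (beta *: Jt tr t w
    + (beta / (hb1 bs)%:R) *: \sum_(i < hb1 bs)
        (JF pb (xs tr t.+1 w) (hbatch1 smp t.+1 i w)
         - JF pb (xs tr t w) (hbatch1 smp t.+1 i w))
    + ((1 - beta) / (hb2 bs)%:R) *: \sum_(i < hb2 bs)
        JF pb (xs tr t.+1 w) (hbatch2 smp t.+1 i w) - jac (Fmean pb) (xs tr t.+1 w)) ^+ 2)%:E));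
    last by move=> w _; rewrite /J_error (gen_J Hgen _ tT) hbet.
  exact: (@hybrid_moment _ _ _ _ _ Pr (law pb) _ _ _ (dom (Psi0 pb)) (JF pb) (jac (Fmean pb))
    (L_F cs) (sigma_J cs) (@measurable_JF_comp _ _ _ _ _ _ _ _ Hpb)
    (@measurable_jac_Fmean_comp _ _ _ _ _ _ _ _ Hpb) (JF_int Hpb) (jac_Fmean_entry Hpb)
    JF_lip JF_var _ _ (H t.+1) (Now t.+1) id id (past_measurable (leqW tT))
    (now_measurable tT) (past_now_indep t1) (xs tr t) (xs tr t.+1) (Jt tr t) mx0 mx1 mJ
    (fun w => xs_dom w (leqW tT')) (fun w => xs_dom w (leqW tT)) (hb1 bs) (hb2 bs)
    (hbatch1 smp t.+1) (hbatch2 smp t.+1) hb1_gt0 hb2_gt0 mX mY (hiid1 Hsamp t1)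
    (hiid2 Hsamp t1) hkappa beta hk).
apply: (le_trans le).
under [X in (_ + _ * X + _)%E]eq_integral do rewrite (next_displacement _ tT') EFinM.
by rewrite integralZl//= -EFin_Rintegral// -EFin_Rintegral//.
Qed.

Definition weighted_error t w : R :=
  est_error pb cs gamma (xs tr t w) (Ft tr t w) (Jt tr t w).

Let cJ := spectral (Kmx pb) ^+ 2 * M_psi cs ^+ 2.
Let cF := M_F cs ^+ 2 * spectral (Kmx pb) ^+ 4 / gamma ^+ 2.

Let cJ0 : 0 <= cJ. Proof. by rewrite mulr_ge0 ?sqr_ge0. Qed.
Let cF0 : 0 <= cF.
Proof. by rewrite divr_ge0 ?sqr_ge0// mulr_ge0 ?sqr_ge0// exprn_ge0 ?spectral_ge0. Qed.

Let weighted_errorE t w : weighted_error t w = cJ * J_error t w + cF * F_error t w.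
Proof. by []. Qed.

Lemma weighted_error_ge0 t w : 0 <= weighted_error t w.
Proof. by rewrite weighted_errorE addr_ge0// mulr_ge0 ?sqr_ge0. Qed.

Lemma weighted_error_adapted t : (t <= T)%N ->
  measurable_fun (setT : set (H t.+1)) (weighted_error t : H t.+1 -> R).
Proof.
move=> tT; apply: measurable_funD; apply: measurable_funM => //.
  exact: J_error_adapted.
exact: F_error_adapted.
Qed.

Definition gap : R := fine (Psi0 pb x0) - fine (Psi0_star pb) + B_psi pb d.

(** Along each path the objective telescopes, so that only its deterministic
    initial value and its infimum remain to be integrated later. *)
Lemma pathwise_sum m w : (m <= T.+1)%N ->
  theta * L * \sum_(t < m) displacement t w <=
  gap + theta / L * \sum_(t < m) weighted_error t w.
Proof.
have telescope : forall m, (m <= T.+1)%N ->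
    Psi_smooth pb d gamma (xs tr m w) + theta * L * \sum_(t < m) displacement t w <=
    Psi_smooth pb d gamma x0 + theta / L * \sum_(t < m) weighted_error t w.
  elim=> [_|k IH kT]; first by rewrite !big_ord0 !mulr0 !addr0 (gen_x0 Hgen).
  have kT' : (k <= T)%N by [].
  have := IH (ltnW kT); rewrite !big_ord_recr /= (mulrDr (theta * L)) (mulrDr (theta / L)).
  have := step_decrease Hpb Hd gamma0 theta01 L0 (Ft tr k w) (Jt tr k w) (xs_dom w (ltnW kT)).
  rewrite -/L -/eta -(xhatE w kT') -(xsE w kT') -/(displacement k w) -/(weighted_error k w).
  move: (Psi_smooth _ _ _ (xs tr k w)) (Psi_smooth _ _ _ (xs tr k.+1 w)).
  move: (Psi_smooth _ _ _ x0) (theta * L) (theta / L) (displacement k w) (weighted_error k w).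
  move: (\sum_(t < k) displacement t w) (\sum_(t < k) weighted_error t w).
  by move=> *; lra.
move=> mT; have := telescope _ mT.
have [_ up _] := Psi_smooth_bounds Hpb Hd gamma0 Hx0.
have hm := xs_dom w mT.
have [_ _ low] := Psi_smooth_bounds Hpb Hd gamma0 hm.
have [_ star] := Psi0_star_le Hpb Hd hm.
have gB : gamma * B_psi pb d <= B_psi pb d by rewrite ler_piMl// (B_psi_ge0 Hd).
rewrite /gap; move: up low star gB.
move: (theta * L * _) (theta / L * _) (fine (Psi0 pb x0)) (fine (Psi0_star pb)).
move: (Psi_smooth _ _ _ (xs tr m w)) (Psi_smooth _ _ _ x0) (fine (Psi0 pb (xs tr m w))).
by move: (gamma * B_psi pb d) (B_psi pb d) => *; lra.
Qed.

(** A displacement is bounded by the right-hand side of the pathwise inequality, and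
    so inherits the integrability of the errors. *)
Lemma mean_pathwise_sum m : (m <= T.+1)%N ->
  (forall t, (t < m)%N -> integrable_real (weighted_error t)) ->
  (forall t, (t < m)%N -> integrable_real (displacement t)) /\
  theta * L * \sum_(t < m) \int[Pr]_w displacement t w <=
  gap + theta / L * \sum_(t < m) \int[Pr]_w weighted_error t w.
Proof.
move=> mT iA; have /andP[t0 _] := theta01.
have tL0 : 0 < theta * L by rewrite mulr_gt0.
have iSA : integrable_real (fun w => \sum_(t < m) weighted_error t w).
  apply: (@integrable_sumr _ _ _ Pr 'I_m _ (fun (t : 'I_m) w => weighted_error t w)) => t.
  exact: iA.
have iR : integrable_real
    (fun w => gap + theta / L * \sum_(t < m) weighted_error t w).
  exact: (integrable_add (integrable_cst_prob Pr gap) (integrable_scale (theta / L) iSA)).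
have D0 t w : 0 <= displacement t w by exact: sqr_ge0.
have iD t : (t < m)%N -> integrable_real (displacement t).
  move=> tm; have tT : (t <= T)%N by rewrite -ltnS (leq_trans tm).
  have iRt := integrable_scale (theta * L)^-1 iR.
  apply: (le_integrable measurableT _ _ iRt).
    by apply/measurable_EFinP; exact: (adapted_measurable tT (displacement_adapted tT)).
  move=> w _; rewrite /= lee_fin (ger0_norm (D0 _ _)) (le_trans _ (ler_norm _))//.
  rewrite mulrC ler_pdivlMr// mulrC (le_trans _ (pathwise_sum w mT))//.
  rewrite ler_pM2l// (bigD1 (Ordinal tm))//= lerDl.
  by apply: sumr_ge0 => *; exact: D0.
split=> //.
have iSD : integrable_real (fun w => \sum_(t < m) displacement t w).
  by apply: (@integrable_sumr _ _ _ Pr 'I_m _ (fun (t : 'I_m) w => displacement t w)) => t;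
    exact: iD.
rewrite -(@Rintegral_sum _ _ _ Pr 'I_m _ (fun (t : 'I_m) w => displacement t w)); last first.
  by move=> t; exact: iD.
rewrite -(@Rintegral_sum _ _ _ Pr 'I_m _ (fun (t : 'I_m) w => weighted_error t w)); last first.
  by move=> t; exact: iA.
rewrite -RintegralZl// -RintegralZl// -[gap in leRHS](Rintegral_cst1 Pr).
rewrite -RintegralD//; [|exact: integrable_cst_prob|exact: (integrable_scale (theta / L) iSA)].
apply: le_Rintegral => //; first exact: (integrable_scale (theta * L) iSD).
by move=> w _; exact: pathwise_sum.
Qed.

Let errC := cF * (kappa * M_F cs ^+ 2 / (b1 bs)%:R) + cJ * (hkappa * L_F cs ^+ 2 / (hb1 bs)%:R).
Let errS := cF * (kappa * sigma_F cs ^+ 2 / (b2 bs)%:R)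
  + cJ * (hkappa * sigma_J cs ^+ 2 / (hb2 bs)%:R).
Let errS0 := cF * (sigma_F cs ^+ 2 / (b0 bs)%:R) + cJ * (sigma_J cs ^+ 2 / (hb0 bs)%:R).

Lemma weighted_error_integrable t : integrable_real (F_error t) ->
  integrable_real (J_error t) -> integrable_real (weighted_error t) /\
  \int[Pr]_w weighted_error t w = cJ * \int[Pr]_w J_error t w + cF * \int[Pr]_w F_error t w.
Proof.
move=> iF iJ; have iJ' := integrable_scale cJ iJ; have iF' := integrable_scale cF iF.
split; first exact: integrable_add.
under eq_Rintegral do rewrite weighted_errorE.
by rewrite RintegralD// !RintegralZl.
Qed.

(** Integrability spreads alternately: the errors up to [t] control the
    displacement at [t], and the displacement controls the errors at [t.+1]. *)
Lemma errors_integrable t : (t <= T)%N ->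
  [/\ forall s, (s <= t)%N -> integrable_real (F_error s),
      forall s, (s <= t)%N -> integrable_real (J_error s) &
      forall s, (s <= t)%N -> integrable_real (displacement s)].
Proof.
elim: t => [_|t IH tT].
  have [iF _] := F_error0; have [iJ _] := J_error0.
  have iA s : (s < 1)%N -> integrable_real (weighted_error s).
    by case: s => // _; case: (weighted_error_integrable iF iJ).
  have [iD _] := mean_pathwise_sum (ltn0Sn T) iA.
  split=> s; rewrite leqn0 => /eqP ->; [exact: iF|exact: iJ|exact: iD].
have [iF iJ iD] := IH (ltnW tT).
have [iFt _] := F_error_step tT (iF _ (leqnn t)) (iD _ (leqnn t)).
have [iJt _] := J_error_step tT (iJ _ (leqnn t)) (iD _ (leqnn t)).
have iF' s : (s <= t.+1)%N -> integrable_real (F_error s).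
  by rewrite leq_eqVlt => /predU1P[->//|]; rewrite ltnS; exact: iF.
have iJ' s : (s <= t.+1)%N -> integrable_real (J_error s).
  by rewrite leq_eqVlt => /predU1P[->//|]; rewrite ltnS; exact: iJ.
have iA s : (s < t.+2)%N -> integrable_real (weighted_error s).
  by rewrite ltnS => st; case: (weighted_error_integrable (iF' _ st) (iJ' _ st)).
have [iD' _] := mean_pathwise_sum (m := t.+2) tT iA.
by split; [exact: iF'|exact: iJ'|move=> s st; exact: iD'].
Qed.

Lemma weighted_error_initial : \int[Pr]_w weighted_error 0 w <= errS0.
Proof.
have [iF leF] := F_error0; have [iJ leJ] := J_error0.
have [_ ->] := weighted_error_integrable iF iJ.
by rewrite /errS0 addrC lerD// ler_wpM2l.
Qed.

Lemma weighted_error_step t : (t < T)%N ->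
  \int[Pr]_w weighted_error t.+1 w <= beta ^+ 2 * \int[Pr]_w weighted_error t w
   + beta ^+ 2 * theta ^+ 2 * errC * \int[Pr]_w displacement t w + (1 - beta) ^+ 2 * errS.
Proof.
move=> tT; have [iF iJ iD] := errors_integrable (ltnW tT).
have [iFt leF] := F_error_step tT (iF _ (leqnn t)) (iD _ (leqnn t)).
have [iJt leJ] := J_error_step tT (iJ _ (leqnn t)) (iD _ (leqnn t)).
have [_ ->] := weighted_error_integrable iFt iJt.
have [_ ->] := weighted_error_integrable (iF _ (leqnn t)) (iJ _ (leqnn t)).
apply: (le_trans (lerD (ler_wpM2l cJ0 leJ) (ler_wpM2l cF0 leF))).
rewrite /errC /errS; clear; move: cF cJ (\int[Pr]_w _) (\int[Pr]_w _) (\int[Pr]_w _).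
by move=> *; apply: le_of_eq; ring.
Qed.

(** * The randomly chosen output *)

Variable tau : Omega -> 'I_T.+1.
Hypothesis Htau : random_index Pr bs smp pb cs sch tau.

(** The integral of a nonnegative function is the supremum of the integrals of the
    simple functions below it, hence monotone in arbitrary functions, such as the
    squared gradient mapping at the random output. *)
Lemma ge0_le_integral_lower (f g : Omega -> \bar R) : (forall w, 0 <= f w)%E ->
  (forall w, f w <= g w)%E -> (\int[Pr]_w f w <= \int[Pr]_w g w)%E.
Proof.
move=> f0 fg; rewrite !ge0_integralTE//; last by move=> w; exact: le_trans (fg w).
apply: le_ereal_sup => _ [h hf <-]; exists h => // w.
exact: le_trans (hf w) (fg w).
Qed.

Lemma tau_uniform t : Pr (tau @^-1` [set t]) = (T.+1%:R^-1)%:E.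
Proof.
have /andP[t0 _] := theta01.
rewrite (tau_law Htau) the gam -/L; congr EFin.
rewrite (eq_bigr (fun=> theta / L)); last by move=> s _; rewrite the gam.
rewrite sumr_const card_ord -[_ *+ T.+1]mulr_natl invfM mulrCA divff ?mulr1//.
by rewrite gt_eqF// divr_gt0.
Qed.

(** Independence from the event [tau = t] and from its complement, which are the
    only nontrivial preimages under the indicator of that event. *)
Lemma past_output_indep t (A : set (H T.+1)) (B : set bool) :
  measurable A -> measurable B ->
  Pr ((id : Omega -> H T.+1) @^-1` A `&` (fun w => tau w == t) @^-1` B) =
  (Pr ((id : Omega -> H T.+1) @^-1` A) * Pr ((fun w => tau w == t) @^-1` B))%E.
Proof.
move=> mA _; rewrite preimage_id.
have mA' : measurable (A : set Omega).
  by rewrite -[X in measurable X]setTI; exact: (past_measurable (leqnn _)).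
have mE := tau_measurable Htau t.
have eT : (fun w => tau w == t) @^-1` [set true] = tau @^-1` [set t].
  by apply/seteqP; split=> w /=; [move/eqP|move=> ->; exact: eqxx].
have eF : (fun w => tau w == t) @^-1` [set false] = ~` (tau @^-1` [set t]).
  by apply/seteqP; split=> w /=; [move=> h /eqP; rewrite h|move=> /eqP/negbTE].
have indE : Pr (A `&` tau @^-1` [set t]) = (Pr A * Pr (tau @^-1` [set t]))%E.
  rewrite setIC muleC.
  exact: (tau_independent Htau (ex_intro2 _ _ t I erefl) mA).
have [/eqP->|/eqP->|/eqP->|/eqP->] := set_bool B.
- by rewrite eT.
- rewrite eF -setDE measureD//; last by rewrite ltey_eq fin_num_measure.
  rewrite [X in (_ - X)%E]indE probability_setC//.
  have sub_mul (a e : \bar R) : a \is a fin_num -> e \is a fin_num ->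
      (a - a * e = a * (1 - e))%E.
    by move=> fa fe; rewrite muleBr ?mule1// fin_num_adde_defr.
  by apply: sub_mul; [exact: (fin_num_measure Pr _ mA')|exact: (fin_num_measure Pr _ mE)].
- by rewrite preimage_set0 setI0 measure0 mule0.
- by rewrite preimage_setT setIT probability_setT mule1.
Qed.

Lemma tau_eq_measurable t : measurable_fun setT (fun w => tau w == t).
Proof.
apply: (@measurable_fun_bool _ _ _ _ true).
rewrite setTI (_ : _ @^-1` _ = tau @^-1` [set t]).
  exact: (tau_measurable Htau).
by apply/seteqP; split=> w /=; [move/eqP|move=> ->; exact: eqxx].
Qed.

Lemma output_integral t (g : Omega -> R) :
  measurable_fun (setT : set (H T.+1)) (g : H T.+1 -> R) -> (forall w, 0 <= g w) ->
  (\int[Pr]_w (g w * (tau w == t)%:R)%:E = (T.+1%:R^-1)%:E * \int[Pr]_w (g w)%:E)%E.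
Proof.
move=> mg g0.
have mY := tau_eq_measurable t.
pose G (z : H T.+1 * bool) : \bar R := ((g z.1)%:E * (z.2%:R)%:E)%E.
have mb : measurable_fun setT (fun b : bool => b%:R%:E : \bar R) by [].
have mG : measurable_fun setT G.
  apply: emeasurable_funM.
    apply: (measurableT_comp (f := fun u : H T.+1 => (g u)%:E)); last exact: measurable_fst.
    exact/measurable_EFinP.
  exact: (measurableT_comp mb (@measurable_snd _ _ (H T.+1) bool)).
have G0 z : (0 <= G z)%E by rewrite mule_ge0// lee_fin.
have := ge0_integral_indep (past_measurable (leqnn T.+1)) mY (@past_output_indep t) mG G0.
rewrite /G /=; under eq_integral do rewrite -EFinM.
move=> ->.
have inner w : (\int[Pr]_w' ((g w)%:E * ((tau w' == t)%:R)%:E) =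
    (T.+1%:R^-1)%:E * (g w)%:E)%E.
  rewrite ge0_integralZl_EFin; [|exact: measurableT|by move=> w' _; rewrite lee_fin|
    exact: (measurableT_comp mb mY)|exact: g0].
  rewrite muleC; congr (_ * _)%E.
  rewrite -(tau_uniform t) -[tau @^-1` _]setIT.
  rewrite -(integral_indic Pr measurableT (tau_measurable Htau t)).
  apply: eq_integral => w' _; rewrite indicE.
  suff -> : (w' \in tau @^-1` [set t]) = (tau w' == t) by [].
  by apply/idP/eqP => [|tw]; rewrite inE.
under eq_integral do rewrite inner.
rewrite ge0_integralZl_EFin//; first by move=> w _; rewrite lee_fin.
exact/measurable_EFinP/(adapted_measurable (leqnn T)).
Qed.

(** The gradient mapping at [xs t] is dominated by a function of the past, so that
    the independence of [tau] replaces the sum over the values of [tau] by a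
    uniform average. *)
Lemma output_error :
  ('E_Pr[fun w => (frob (grad_map pb d gamma eta (xs tr (tau w) w)) ^+ 2)%R] <=
  (T.+1%:R^-1 * \sum_(t < T.+1) (8 * L ^+ 2 * \int[Pr]_w displacement t w
     + 4 * \int[Pr]_w weighted_error t w))%:E)%E.
Proof.
pose g t w := 8 * L ^+ 2 * displacement t w + 4 * weighted_error t w.
have g0 t w : 0 <= g t w.
  apply: addr_ge0; last by rewrite mulr_ge0 ?weighted_error_ge0.
  by apply: mulr_ge0; [rewrite mulr_ge0 ?sqr_ge0|exact: sqr_ge0].
have mgt t : (t <= T)%N -> measurable_fun (setT : set (H t.+1)) (g t : H t.+1 -> R).
  move=> tT; apply: measurable_funD; apply: measurable_funM => //.
    exact: displacement_adapted.
  exact: weighted_error_adapted.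
have mg t : (t <= T)%N -> measurable_fun (setT : set (H T.+1)) (g t : H T.+1 -> R).
  move=> tT; apply: (measurable_fun_gsigma_mono (g := g t)) (mgt _ tT) => E [r /= rt Er].
  by apply: sub_sigma_algebra; exists r => //=; exact: leq_trans rt _.
have [iF iJ iD] := errors_integrable (leqnn T).
have ig t : (t <= T)%N -> integrable_real (g t).
  move=> tT; have [iA _] := weighted_error_integrable (iF _ tT) (iJ _ tT).
  exact: (integrable_add (integrable_scale _ (iD _ tT)) (integrable_scale _ iA)).
have intg t : (t <= T)%N -> \int[Pr]_w g t w =
    8 * L ^+ 2 * \int[Pr]_w displacement t w + 4 * \int[Pr]_w weighted_error t w.
  move=> tT; have [iA _] := weighted_error_integrable (iF _ tT) (iJ _ tT).
  have iD' := integrable_scale (8 * L ^+ 2) (iD _ tT).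
  have iA' := integrable_scale 4 iA.
  by rewrite RintegralD// (RintegralZl _ measurableT (iD _ tT)) (RintegralZl _ measurableT iA).
rewrite expectationE.
apply: (@le_trans _ _ (\int[Pr]_w \sum_(t < T.+1) (g t w * (tau w == t)%:R)%:E)%E).
  apply: ge0_le_integral_lower => w; first by rewrite lee_fin sqr_ge0.
  rewrite sumEFin lee_fin (bigD1 (tau w))//= eqxx mulr1.
  rewrite big1 ?addr0; last by move=> t; rewrite eq_sym => /negbTE ->; rewrite mulr0.
  have tT : (tau w <= T)%N by rewrite -ltnS.
  rewrite /g /displacement /weighted_error (xhatE w tT).
  exact: (grad_map_le Hpb Hd gamma0 theta01 L0 (Ft tr (tau w) w) (Jt tr (tau w) w)
    (xs_dom w (leqW tT))).
rewrite ge0_integral_sum//; last 2 first.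
- move=> t; apply/measurable_EFinP; apply: measurable_funM.
    have tT : (t <= T)%N by rewrite -ltnS.
    exact: (adapted_measurable (leqnn T) (mg _ tT)).
  have mb : measurable_fun setT (fun b : bool => b%:R : R) by [].
  exact: (measurableT_comp mb (tau_eq_measurable t)).
- by move=> t w _; rewrite lee_fin mulr_ge0.
rewrite (eq_bigr (fun t : 'I_T.+1 => (T.+1%:R^-1 * \int[Pr]_w g t w)%:E)); last first.
  move=> t _; have tT : (t <= T)%N by rewrite -ltnS.
  by rewrite output_integral//; [rewrite -EFin_Rintegral//; exact: ig|exact: mg].
rewrite sumEFin lee_fin -mulr_sumr; apply: le_of_eq; congr (_ * _).
by apply: eq_bigr => t _; rewrite intg// -ltnS.
Qed.

(** The three bounds [C], [S], [S0] stand for the coefficients of the drift, of the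
    fresh noise and of the initial noise in the error recursion. *)
Lemma mean_output_error (C S S0 : R) : 0 <= beta < 1 -> 0 <= C ->
  errC <= C -> errS <= S -> errS0 <= S0 ->
  5 / 2 * theta ^+ 2 * C * beta ^+ 2 <= L ^+ 2 * (1 - beta) ->
  ('E_Pr[fun w => (frob (grad_map pb d gamma eta (xs tr (tau w) w)) ^+ 2)%R]
   <= (T.+1%:R^-1 * (16 * L / theta * gap
        + 20 / (1 - beta) * (S0 + T%:R * ((1 - beta) ^+ 2 * S))))%:E)%E.
Proof.
move=> be C0 leC leS leS0 dom; have /andP[t0 _] := theta01.
apply: (le_trans output_error); rewrite lee_fin ler_wpM2l ?invr_ge0//.
have [iF iJ iD] := errors_integrable (leqnn T).
have iA t : (t < T.+1)%N -> integrable_real (weighted_error t).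
  by move=> tT; have [] := weighted_error_integrable (iF t tT) (iJ t tT).
have [_ descent] := mean_pathwise_sum (leqnn T.+1) iA.
pose A t := \int[Pr]_w weighted_error t w.
pose D t := \int[Pr]_w displacement t w.
have A0 t : 0 <= A t by apply: Rintegral_ge0 => w _; exact: weighted_error_ge0.
have D0 t : 0 <= D t by apply: Rintegral_ge0 => w _; exact: sqr_ge0.
apply: (@potential_sum R A D T L theta beta gap C S S0) => //.
  exact: le_trans weighted_error_initial leS0.
move=> t tT; apply: (le_trans (weighted_error_step tT)).
rewrite -/(A t) -/(D t) -!addrA lerD2l lerD//.
  by rewrite ler_wpM2r ?D0// ler_wpM2l// mulr_ge0 ?sqr_ge0.
by rewrite ler_wpM2l ?sqr_ge0.
Qed.

End iterates.

(** * The complexity theorem *)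

Section rounding.
Context {R : realType}.

Lemma ceil_batch (r : R) (m : nat) : 0 < r -> Posz m = Num.ceil r ->
  [/\ (0 < m)%N, r <= m%:R & m%:R <= r + 1].
Proof.
move=> r0 mE; have /andP[h1 h2] := ceil_itv r.
rewrite -mE in h1 h2; have le : r <= m%:R by exact: h2.
split=> //; first by rewrite -(ltr0n R) (lt_le_trans r0).
by move: h1; rewrite intrB ltrBlDr => /ltW.
Qed.

End rounding.

Theorem theorem3p3 (R : realType) (dX dO : measure_display)
  (Xi : measurableType dX) (Omega : measurableType dO) (Pr : probability Omega R)
  (p q n : nat) (pb : problem R Xi p q n) (cst : constants R)
  (d : 'cV[R]_n -> R)
  (Hpb : standing_assumptions pb cst)
  (Hpsi : forall mu : R, 0 < mu -> ~ strongly_convex mu (psi pb))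
  (Hd : smoothing_function pb d)
  (c0 c1 gamma : R) (b T : nat) (x0 : 'cV[R]_p)
  (Hc0 : 0 < c0) (Hc1 : 0 < c1) (Hgamma : 0 < gamma <= 1) (Hb : (0 < b)%N)
  (Hx0 : dom (Psi0 pb) x0)
  (bs : batch_sizes) (smp : samples Xi Omega) (sch : schedule R)
  (tr : trajectory R Omega p q) (tau : Omega -> 'I_T.+1) :
  let kappa : R := kappa_cst Pr bs smp T in
  let hkappa : R := hkappa_cst Pr bs smp T in
  let L := L_Phi pb cst gamma in
  let beta := beta_cst c1 b T in
  let theta := theta_cst c1 L (P_cst pb cst c0 kappa hkappa) b T in
  let eta := eta_cst L theta in
  let Delta := Delta_cst pb cst d c0 c1 kappa hkappa x0 in
  let bT : R := b%:R * T.+1%:R in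
  let error :=
    ('E_Pr[fun w => (frob (grad_map pb d gamma eta (xs tr (tau w) w)) ^+ 2)%R])%E in
  (hb1 bs = b /\ hb2 bs = b) ->
  (Posz (b1 bs) = Num.ceil (b1_real c0 gamma b) /\ b2 bs = b1 bs) ->
  Posz (hb0 bs) = Num.ceil (hb0_real c1 b T) ->
  Posz (b0 bs) = Num.ceil (b0_real c0 c1 gamma b T) ->
  (forall t, [/\ gamma_ sch t = gamma, beta_ sch t = beta, hbeta_ sch t = beta,
                 theta_ sch t = theta & eta_ sch t = eta]) ->
  0 < beta <= 1 -> 0 < theta <= 1 ->
  sampling Pr (law pb) bs smp T ->
  generated bs smp pb d sch x0 T tr ->
  random_index Pr bs smp pb cst sch tau ->
  [/\ (error <= (Delta / bT `^ (2 / 3))%:E)%E,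
      (forall eps : R, 0 < eps ->
         Posz T = Num.floor (iteration_bound Delta b eps) ->
         [/\ (error <= (eps ^+ 2)%:E)%E,
             (function_evals bs T)%:R <=
               function_bound c0 c1 Delta gamma eps
               + c0 * c1 ^+ 2 * b%:R `^ 3^-1 / gamma ^+ 2 + (3 * T + 1)%:R
           & (jacobian_evals bs T)%:R <=
               jacobian_bound c1 Delta eps + c1 ^+ 2 * b%:R `^ 3^-1 + 1]),
      (forall eps : R, 0 < eps ->
         T.+1%:R = iteration_bound Delta b eps ->
         (b1 bs)%:R = b1_real c0 gamma b ->
         (hb0 bs)%:R = hb0_real c1 b T ->
         (b0 bs)%:R = b0_real c0 c1 gamma b T ->
         [/\ (error <= (eps ^+ 2)%:E)%E,
             (function_evals bs T)%:R <= function_bound c0 c1 Delta gamma eps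
           & (jacobian_evals bs T)%:R <= jacobian_bound c1 Delta eps]),
      (exists C : R, \forall eps \near 0^'+, forall g : R, 0 < g <= 1 ->
         `|function_bound c0 c1 Delta g eps|
           <= C * `|Delta `^ (3 / 2) / (g ^+ 2 * eps ^+ 3)|) /\
      (fun eps : R => jacobian_bound c1 Delta eps) =O_ (0^'+)
        (fun eps : R => Delta `^ (3 / 2) / eps ^+ 3)
    & forall c2 : R, 0 < c2 ->
      (forall eps : R, 0 < eps ->
         function_bound c0 c1 Delta (c2 * eps) eps =
           c0 * c1 ^+ 2 * Delta `^ 2^-1 / (c2 ^+ 2 * eps ^+ 3)
           + 3 * c0 * Delta `^ (3 / 2) / (c2 ^+ 2 * eps ^+ 5)) /\
      (fun eps : R => function_bound c0 c1 Delta (c2 * eps) eps) =O_ (0^'+)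
        (fun eps : R => Delta `^ (3 / 2) / eps ^+ 5)].
Proof.
move=> kappa hkappa L beta theta eta Delta bT error [hb1E hb2E] [b1E b2E] hb0E b0E Hsch.
move=> /andP[beta0 beta1] theta01 Hsamp Hgen Htau.
have /andP[gamma0 gamma1] := Hgamma; have /andP[theta0 _] := theta01.
have bR0 : 0 < b%:R :> R by rewrite ltr0n.
set x : R := bT `^ 3^-1; have xgt0 : 0 < x by exact: rate_root_gt0.
have x3 : x ^+ 3 = b%:R * T.+1%:R by exact: rate_root_cube.
set P := P_cst pb cst c0 kappa hkappa; set Q := Q_cst pb cst c0 kappa hkappa.
have k1 : 1 <= kappa by rewrite /kappa /kappa_cst; case: asboolP => _; rewrite ?ler1n.
have hk1 : 1 <= hkappa by rewrite /hkappa /hkappa_cst; case: asboolP => _; rewrite ?ler1n.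
have k0 : 0 <= kappa by exact: le_trans k1.
have hk0 : 0 <= hkappa by exact: le_trans hk1.
have P0 : 0 <= P by exact: P_cst_ge0.
have Q0 : 0 <= Q by exact: Q_cst_ge0.
have L0 : 0 <= L by exact: L_Phi_ge0.
(* Vanishing of L or P would make theta vanish. *)
have Lgt0 : 0 < L.
  rewrite lt_neqAle L0 andbT; apply/eqP => h; move: theta0.
  by rewrite /theta /theta_cst -h !mul0r ltxx.
have Pgt0 : 0 < P.
  rewrite lt_neqAle P0 andbT; apply/eqP => h; move: theta0.
  by rewrite /theta /theta_cst -/P -h mul0r invr0 mulr0 ltxx.
set gap := fine (Psi0 pb x0) - fine (Psi0_star pb) + B_psi pb d.
have gap0 : 0 <= gap.
  have [_ le] := Psi0_star_le Hpb Hd Hx0.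
  by rewrite addr_ge0 ?subr_ge0// (B_psi_ge0 Hd).
set r := Num.sqrt c1; have r0 : 0 < r by rewrite sqrtr_gt0.
have r2 : r ^+ 2 = c1 by rewrite sqr_sqrtr// ltW.
have DeltaE : Delta = 16 * r * P * gap + 24 * Q / r ^+ 2 by rewrite r2.
have Delta0 : 0 <= Delta.
  rewrite DeltaE addr_ge0//; first by rewrite mulr_ge0// mulr_ge0// mulr_ge0// ltW.
  by rewrite divr_ge0 ?sqr_ge0// mulr_ge0.
have hb0x : hb0_real c1 b T = r ^+ 4 * x by rewrite /hb0_real -r2 -exprM.
have g2 : 0 < gamma ^+ 2 by rewrite exprn_gt0.
have hb0r0 : 0 < r ^+ 4 * x by rewrite mulr_gt0 ?exprn_gt0.
have b1r0 : 0 < b1_real c0 gamma b by rewrite divr_gt0// mulr_gt0.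
have b0r0 : 0 < b0_real c0 c1 gamma b T.
  by rewrite /b0_real hb0x divr_gt0// mulr_gt0.
rewrite hb0x in hb0E; rewrite /b0_real hb0x -/(b0_real _ _ _ _ _) in b0r0 b0E.
have [b1n b1lo b1up] := ceil_batch b1r0 b1E.
have [b0n b0lo b0up] := ceil_batch b0r0 b0E.
have [hb0n hb0lo hb0up] := ceil_batch hb0r0 hb0E.
have PE := P_cst_sqr pb cst Hc0 k0 hk0; rewrite -/P in PE.
have QE := Q_cstE pb cst kappa hkappa Hc0; rewrite -/Q in QE.
(* The rounded batches are at least as large as the real values, which is the
   direction that the error bounds ask for. *)
have rate : (error <= (Delta / x ^+ 2)%:E)%E.
  have betaE : 1 - beta = b%:R / (r ^+ 2 * x ^+ 2).
    by rewrite /beta (beta_cstE _ Hc1 Hb) -/x r2 subKr.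
  have thetaE : theta = L * b%:R / (P * (r * x)).
    by rewrite /theta (theta_cstE T Hc1 Hb)// gt_eqF.
  have beta01 : 0 <= beta < 1.
    rewrite (ltW beta0)/= -subr_gt0 betaE divr_gt0// mulr_gt0// exprn_gt0//.
  have MF0 : 0 <= M_F cst ^+ 2 * spectral (Kmx pb) ^+ 4.
    by rewrite mulr_ge0 ?sqr_ge0// exprn_ge0 ?spectral_ge0.
  have KM0 : 0 <= spectral (Kmx pb) ^+ 2 * M_psi cst ^+ 2 by rewrite mulr_ge0 ?sqr_ge0.
  have hb1n : (0 < hb1 bs)%N by rewrite hb1E.
  have hb2n : (0 < hb2 bs)%N by rewrite hb2E.
  have b2n : (0 < b2 bs)%N by rewrite b2E.
  have km (z w : R) : 0 <= z -> 0 <= z * w ^+ 2 by move=> z0; rewrite mulr_ge0 ?sqr_ge0.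
  apply: le_trans (@mean_output_error R _ _ _ _ _ _ _ _ _ _ _ Hpb Hd gamma beta theta
    x0 T bs smp sch tr gamma0 theta01 Lgt0 Hsch Hx0 Hsamp Hgen b0n hb0n b1n hb1n b2n
    hb2n gamma1 tau Htau (9 / 26 * P ^+ 2 / b%:R) (9 / 26 * Q / b%:R)
    (9 / 26 * Q / (r ^+ 4 * x)) beta01 _ _ _ _ _) _.
  - by rewrite divr_ge0 ?(ltW bR0)// mulr_ge0 ?sqr_ge0.
  - rewrite PE; apply: batch_error_le => //; rewrite ?km ?hb1E//.
  - rewrite QE; apply: batch_error_le => //; rewrite ?km ?hb2E ?b2E//.
  - apply: (@le_trans _ _ ((M_F cst ^+ 2 * spectral (Kmx pb) ^+ 4 * sigma_F cst ^+ 2 / c0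
       + spectral (Kmx pb) ^+ 2 * M_psi cst ^+ 2 * sigma_J cst ^+ 2) / (r ^+ 4 * x))).
      by apply: batch_error_le => //; exact: sqr_ge0.
    rewrite QE ler_wpM2r ?invr_ge0 ?(ltW hb0r0)// lerD//.
      rewrite ler_wpM2r ?invr_ge0 ?(ltW Hc0)// ler_wpM2l//.
      by rewrite ler_peMl// sqr_ge0.
    by rewrite ler_wpM2l// ler_peMl// sqr_ge0.
  - rewrite thetaE betaE; exact: drift_dominated.
  rewrite lee_fin DeltaE -/gap betaE thetaE.
  have -> : r ^+ 4 = (r ^+ 2) ^+ 2 by rewrite -exprM.
  exact: rate_bound.
have small (eps : R) : 0 < eps -> Delta / x ^+ 2 <= eps ^+ 2 -> (error <= (eps ^+ 2)%:E)%E.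
  by move=> e0 le; apply: (le_trans rate); rewrite lee_fin.
have r4 : r ^+ 4 = c1 ^+ 2 by rewrite -r2 -exprM.
have fE : (function_evals bs T)%:R = (b0 bs)%:R + 3 * (T%:R * (b1 bs)%:R) :> R.
  by rewrite /function_evals b2E natrD !natrM natrD natrM; ring.
have jE : (jacobian_evals bs T)%:R = (hb0 bs)%:R + 3 * (T%:R * b%:R) :> R.
  by rewrite /jacobian_evals hb1E hb2E natrD !natrM natrD natrM; ring.
have ge0g : 0 <= c0 / gamma ^+ 2 by rewrite divr_ge0// ltW.
have fbE (eps : R) : 0 < eps -> function_bound c0 c1 Delta gamma eps =
    c0 / gamma ^+ 2 * (c1 ^+ 2 * (Delta `^ 2^-1 / eps))
    + 3 * (c0 / gamma ^+ 2 * ((Delta `^ 2^-1) ^+ 3 / eps ^+ 3)).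
  move=> e0; rewrite /function_bound powR_3_2//; move: (Delta `^ 2^-1) => y.
  by field; rewrite !gt_eqF.
have jbE (eps : R) : 0 < eps -> jacobian_bound c1 Delta eps =
    c1 ^+ 2 * (Delta `^ 2^-1 / eps) + 3 * ((Delta `^ 2^-1) ^+ 3 / eps ^+ 3).
  move=> e0; rewrite /jacobian_bound powR_3_2//; move: (Delta `^ 2^-1) => y.
  by field; rewrite !gt_eqF.
have b0xE : c0 * (r ^+ 4 * x) / gamma ^+ 2 = c0 / gamma ^+ 2 * (c1 ^+ 2 * x).
  by rewrite r4 mulrAC.
have b1xE : b1_real c0 gamma b = c0 / gamma ^+ 2 * b%:R by rewrite /b1_real mulrAC.
have c12 : 0 <= c1 ^+ 2 by rewrite sqr_ge0.
split.
- by rewrite rate_root_sqr.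
- move=> eps e0 TE; have [lex xle Tb] := floor_iterations Delta0 e0 Hb TE.
  split; first exact: small.
    rewrite fE fbE//.
    have le1 : (b0 bs)%:R <= c0 / gamma ^+ 2 * (c1 ^+ 2 * (Delta `^ 2^-1 / eps + b%:R `^ 3^-1)) + 1.
      apply: (le_trans b0up); rewrite lerD2r b0xE; by do 2 rewrite ler_wpM2l//.
    have le2 : T%:R * (b1 bs)%:R <= c0 / gamma ^+ 2 * ((Delta `^ 2^-1) ^+ 3 / eps ^+ 3) + T%:R.
      apply: (@le_trans _ _ (T%:R * (b1_real c0 gamma b + 1))); first by rewrite ler_wpM2l.
      by rewrite b1xE mulrDr mulr1 lerD2r mulrCA ler_wpM2l.
    have -> : c0 * c1 ^+ 2 * b%:R `^ 3^-1 / gamma ^+ 2 =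
        c0 / gamma ^+ 2 * (c1 ^+ 2 * b%:R `^ 3^-1) 
      by move: (_ `^ _) => z; field; rewrite gt_eqF.
    rewrite natrD natrM; move: le1; rewrite (mulrDr (c1 ^+ 2)) (mulrDr (c0 / _)).
    move: le2.
    move: (c0 / gamma ^+ 2 * (c1 ^+ 2 * (_ / _))) => u1.
    move: (c0 / gamma ^+ 2 * (c1 ^+ 2 * _)) (c0 / gamma ^+ 2 * _) => u2 u3.
    move: ((b0 bs)%:R : R) => u6; lra.
  rewrite jE jbE//.
  have le1 : (hb0 bs)%:R <= c1 ^+ 2 * (Delta `^ 2^-1 / eps + b%:R `^ 3^-1) + 1.
    by apply: (le_trans hb0up); rewrite lerD2r r4 ler_wpM2l.
  move: le1 Tb; rewrite (mulrDr (c1 ^+ 2)).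
  move: (c1 ^+ 2 * (_ / _)) (_ / eps ^+ 3) => u1 u2; lra.
- move=> eps e0 TE b1X hb0X b0X.
  have [lex xE Tb] := exact_iterations Delta0 e0 Hb TE; rewrite -/bT -/x in xE.
  split; first exact: small.
    have b0Y : (b0 bs)%:R = c0 / gamma ^+ 2 * (c1 ^+ 2 * x) by rewrite -b0xE b0X /b0_real hb0x.
    rewrite fE fbE// b1X b0Y b1xE xE lerD2l ler_wpM2l// mulrCA.
    exact: ler_wpM2l.
  rewrite jE jbE// hb0X hb0x r4 xE lerD2l.
  exact: ler_wpM2l.
- split.
    exists (c0 * c1 ^+ 2 / Delta + 3 * c0); near=> eps => g /andP[g0 _].
    apply: evaluations_le => //; rewrite ?(ltW Hc0) ?exprn_gt0//.
    by apply/andP; split; near: eps; [exact: nbhs_right_gt|exact: nbhs_right_le].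
  apply/eqO_exP; exists (c1 ^+ 2 / Delta + 3).
    by rewrite ltr_wpDl// divr_ge0.
  near=> eps.
  have e01 : 0 < eps <= 1.
    by apply/andP; split; near: eps; [exact: nbhs_right_gt|exact: nbhs_right_le].
  have := evaluations_le c1 ler01 Delta0 ltr01 e01.
  by rewrite !mul1r !mulr1.
move=> c2 c20; have fbcE (eps : R) : 0 < eps -> function_bound c0 c1 Delta (c2 * eps) eps =
    c0 * c1 ^+ 2 * Delta `^ 2^-1 / (c2 ^+ 2 * eps ^+ 3)
    + 3 * c0 * Delta `^ (3 / 2) / (c2 ^+ 2 * eps ^+ 5).
  move=> e0; rewrite /function_bound; move: (Delta `^ 2^-1) (Delta `^ (3 / 2)) => y z.
  by field; rewrite !gt_eqF.
split=> //; apply/eqO_exP; exists ((c0 * c1 ^+ 2 / Delta + 3 * c0) / c2 ^+ 2).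
  by rewrite divr_gt0 ?exprn_gt0// ltr_wpDl ?mulr_gt0// divr_ge0// mulr_ge0 ?(ltW Hc0).
near=> eps.
have /andP[e0 e1] : 0 < eps <= 1.
  by apply/andP; split; near: eps; [exact: nbhs_right_gt|exact: nbhs_right_le].
rewrite /function_bound.
have w0 : 0 < (c2 * eps) ^+ 2 by rewrite exprn_gt0// mulr_gt0.
have e01 : 0 < eps <= 1 by rewrite e0 e1.
apply: (le_trans (evaluations_le c1 (ltW Hc0) Delta0 w0 e01)); apply: le_of_eq.
rewrite -[RHS]mulrA; congr (_ * _).
have -> : Delta `^ (3 / 2) / ((c2 * eps) ^+ 2 * eps ^+ 3) =
    (c2 ^+ 2)^-1 * (Delta `^ (3 / 2) / eps ^+ 5).
  by move: (_ `^ _) => y; field; rewrite !gt_eqF.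
by rewrite normrM ger0_norm// invr_ge0 sqr_ge0.
Unshelve. all: by end_near. Qed.
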